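(* Let $P(M,G)$ be a reductive $G$-structure on a principal bundle $Q(M,H)$, and let $\Xi$ be an $H$-invariant vector field on $Q$. Then the flow $\{(\Phi_{\mathrm K})_t\}$ of the generalized Kosmann vector field $\Xi_{\mathrm K}$ associated with $\Xi$ induces on each gauge-natural bundle $Q_\lambda$ associated with $Q$ a one-parameter group $\{((\Phi_{\mathrm K})_t)_\lambda\}$ of global automorphisms.
   Context: Reductive $G$-structure: $G$ is a Lie subgroup of $H$, with Lie algebras $\mathfrak g\subset\mathfrak h$, such that $\mathfrak h=\mathfrak g\oplus\mathfrak m$ for a (fixed) vector subspace $\mathfrak m$ with $\mathrm{Ad}_a(\mathfrak m)\subset\mathfrak m$ for all $a\in G$, and $P(M,G)$ is a principal subbundle of $Q(M,H)$ over the same base $M$, $\dim M=m$. For each $u\in P$ there is a canonical decomposition $T_uQ=T_uP\oplus\mathcal M_u$, where $\mathcal M_u=\{\frac{d}{dt}|_{t=0}\,u\cdot\exp(t\mu)\mid\mu\in\mathfrak m\}$ is a subspace of the vertical space $V_uQ$. The generalized Kosmann vector field $\Xi_{\mathrm K}$ associated with $\Xi$ is the $TP$-component of the restriction $\Xi|_P$ in this decomposition; it is a $G$-invariant vector field on $P$. Gauge-natural bundles: for natural numbers $k\ge h$, $G^k_m$ is the group of $k$-jets $j^k_0\alpha$ of locally invertible maps $\alpha\colon\mathbb R^m\to\mathbb R^m$ with $\alpha(0)=0$; $T^h_mH$ is the group of $h$-jets $j^h_0a$ of maps $a\colon\mathbb R^m\to H$ under pointwise multiplication; $W^{k,h}_mH=G^k_m\rtimes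 T^h_mH$ has multiplication $(j^k_0\alpha,j^h_0a)\odot(j^k_0\beta,j^h_0b)=(j^k_0(\alpha\circ\beta),j^h_0((a\circ\beta)\cdot b))$. $W^{k,h}Q=L^kM\times_MJ^hQ$ ($L^kM$ the $k$-th order frame bundle of $M$, $J^hQ$ the bundle of $h$-jets of local sections of $Q$) is a principal $W^{k,h}_mH$-bundle over $M$ with right action $(j^k_0\epsilon,j^h_x\sigma)\odot(j^k_0\alpha,j^h_0a)=(j^k_0(\epsilon\circ\alpha),j^h_x(\sigma\cdot(a\circ\alpha^{-1}\circ\epsilon^{-1})))$. A gauge-natural bundle of order $(k,h)$ associated with $Q$ is $Q_\lambda=W^{k,h}Q\times_\lambda F$ for a left action $\lambda$ of $W^{k,h}_mH$ on a manifold $F$. A principal automorphism $\Phi$ of $Q$ over a diffeomorphism $\varphi\colon M\to M$ induces $W^{k,h}\Phi(j^k_0\epsilon,j^h_x\sigma)=(j^k_0(\varphi\circ\epsilon),j^h_{\varphi(x)}(\Phi\circ\sigma\circ\varphi^{-1}))$ on $W^{k,h}Q$ and the automorphism $\Phi_\lambda([w,f]_\lambda)=[W^{k,h}\Phi(w),f]_\lambda$ of $Q_\lambda$. Induction from $P$: every point $u\in Q$ is of the form $u=u_1\cdot a_1$ with $u_1\in P$ and $a_1\in H$. A $G$-equivariant automorphism $\Phi_{\mathrm K}$ of $P$ determines the $H$-equivariant map of $Q$ given by $u_1\cdot a_1\mapsto\Phi_{\mathrm K}(u_1)\cdot a_1$, and $(\Phi_{\mathrm K})_\lambda$ is the automorphism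 of $Q_\lambda$ induced by this map by the rule above; in abbreviated notation, $[u,f]_\lambda\mapsto[W^{k,h}\Phi_{\mathrm K}(u_1),a_1\cdot f]_\lambda$. This does not depend on the choice of $u_1,a_1$ nor on the chosen representative.
   Formalization: The flow of the Kosmann field need not be complete (e.g. d/dx on M=(0,1), trivial groups), so the one-parameter group of global automorphisms is asserted when the flow is globally defined; in general the induced maps are shown to form a local one-parameter group. *)

(* Defs.v *)
From mathcomp Require Import all_boot all_order all_algebra.
From mathcomp Require Import all_classical all_reals all_analysis.

Set Implicit Arguments.
Unset Strict Implicit.
Unset Printing Implicit Defensive.

Import Order.TTheory GRing.Theory Num.Theory.
Import numFieldNormedType.Exports.

Local Open Scope classical_set_scope.
Local Open Scope ring_scope.

(** * Calculus on R^n *)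

(* [Ck k A f]: [f] is of class C^k on [A]; only meant for open [A]. *)
Fixpoint Ck (R : realType) (V W : normedModType R) (k : nat) (A : set V)
    (f : V -> W) : Prop :=
  if k is k'.+1 then
    (forall x, A x -> differentiable f x) /\
    (forall v, Ck k' A (fun x => 'D_v f x))
  else forall x, A x -> {for x, continuous f}.

Definition smooth_on (R : realType) (V W : normedModType R) (A : set V)
    (f : V -> W) : Prop :=
  forall k, Ck k A f.

(* Multi-indices b in m variables with lo <= |b| <= k. *)
Definition mindex (m lo k : nat) : Type :=
  {b : {ffun 'I_m -> 'I_k.+1} | (lo <= \sum_i b i <= k)%N}.

Definition partial (R : realType) (m p : nat) (i : 'I_m)
    (f : 'rV[R]_m -> 'rV[R]_p) : 'rV[R]_m -> 'rV[R]_p :=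
  fun x => 'D_(delta_mx 0 i) f x.

Definition mpartial (R : realType) (m p lo k : nat) (b : mindex m lo k)
    (f : 'rV[R]_m -> 'rV[R]_p) : 'rV[R]_m -> 'rV[R]_p :=
  foldr (fun i g => iter (val b i) (partial i) g) f (enum 'I_m).

(* All the partial derivatives of [f] at [x] of order between lo and k. *)
Definition taylor (R : realType) (m p lo k : nat)
    (f : 'rV[R]_m -> 'rV[R]_p) (x : 'rV[R]_m) :
    'rV[R]_(#|{: mindex m lo k}| * p) :=
  mxvec (\matrix_(i, j) mpartial (enum_val i : mindex m lo k) f x 0 j).

(** * Manifolds *)

(* As for partial homeomorphisms, [cmap] and [cinv] are total, but their values
   are relevant only on [cdom] and on the image of [cdom] respectively. *)
Record chart (R : realType) (T : Type) (n : nat) := Chart {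
  cdom : set T;
  cmap : T -> 'rV[R]_n;
  cinv : 'rV[R]_n -> T }.

Definition cimg (R : realType) (T : Type) (n : nat) (c : chart R T n) :
    set 'rV[R]_n :=
  cmap c @` cdom c.

(* A set with a family of charts, with no compatibility requirement: the type
   in which the smooth structures on products, jet groups and associated bundles
   are described. *)
Record charted (R : realType) := Charted {
  scarrier :> Type;
  sdim : nat;
  charts : set (chart R scarrier sdim) }.

Definition sopen (R : realType) (X : charted R) (U : set X) : Prop :=
  forall c, charts c -> open (cmap c @` (U `&` cdom c)).

Definition near_pt (R : realType) (X : charted R) (x : X) (P : X -> Prop) :
    Prop :=
  exists U : set X, [/\ sopen U, U x & forall y, U y -> P y].

(* [f] is smooth on a neighbourhood of [x]; its values elsewhere are
   irrelevant, so total functions also represent locally defined maps. *)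
Definition smooth_at (R : realType) (X Y : charted R) (f : X -> Y) (x : X) :
    Prop :=
  exists (c : chart R X (sdim X)) (d : chart R Y (sdim Y)) (U : set 'rV[R]_(sdim X)),
    [/\ charts c /\ cdom c x,
        charts d,
        [/\ open U, U (cmap c x) & U `<=` cimg c],
        (forall v, U v -> cdom d (f (cinv c v))) &
        smooth_on U (cmap d \o f \o cinv c)].

Definition smooth (R : realType) (X Y : charted R) (f : X -> Y) : Prop :=
  forall x, smooth_at f x.

Definition diffeo (R : realType) (X Y : charted R) (f : X -> Y) : Prop :=
  smooth f /\ exists g : Y -> X, [/\ smooth g, cancel f g & cancel g f].

Definition local_inverse (R : realType) (X Y : charted R) (f : X -> Y) (x : X)
    (g : Y -> X) : Prop :=
  [/\ smooth_at g (f x),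
      near_pt x (fun x' => g (f x') = x') &
      near_pt (f x) (fun y => f (g y) = y)].

Definition local_diffeo_at (R : realType) (X Y : charted R) (f : X -> Y) (x : X) :
    Prop :=
  smooth_at f x /\ exists g, local_inverse f x g.

Definition prod_chart (R : realType) (S T : Type) (n p : nat)
    (c : chart R S n) (d : chart R T p) : chart R (S * T) (n + p) :=
  Chart [set z | cdom c z.1 /\ cdom d z.2]
        (fun z => row_mx (cmap c z.1) (cmap d z.2))
        (fun v => (cinv c (lsubmx v), cinv d (rsubmx v))).

Definition prod_charted (R : realType) (X Y : charted R) : charted R :=
  @Charted R (X * Y)%type (sdim X + sdim Y)
    [set e | exists c d, [/\ charts c, charts d & e = prod_chart c d]].

Definition euclid (R : realType) (n : nat) : charted R :=
  @Charted R 'rV[R]_n n [set Chart setT id id].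

Definition origin (R : realType) (n : nat) : euclid R n := (0 : 'rV[R]_n).
Arguments origin {R n}.

Definition line (R : realType) : charted R :=
  @Charted R R 1 [set Chart setT (fun t => const_mx t) (fun v => v 0 0)].

Record is_manifold (R : realType) (X : charted R)
    (chart_at : X -> chart R X (sdim X)) : Prop := IsManifold {
  chart_atP : forall x, charts (chart_at x) /\ cdom (chart_at x) x;
  cmapK : forall c : chart R X (sdim X), charts c ->
    {in cdom c, cancel (cmap c) (cinv c)};
  cimg_open : forall c : chart R X (sdim X), charts c -> open (cimg c);
  chart_compat : forall c d : chart R X (sdim X), charts c -> charts d ->
    open (cmap c @` (cdom c `&` cdom d)) /\
    smooth_on (cmap c @` (cdom c `&` cdom d)) (cmap d \o cinv c);
  manifold_hausdorff : forall x y : X, x <> y ->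
    exists U V : set X, [/\ sopen U, sopen V, U x, V y & U `&` V = set0];
  manifold_second_countable : exists B : nat -> set X,
    (forall i, sopen (B i)) /\
    (forall (U : set X) x, sopen U -> U x -> exists i, B i x /\ B i `<=` U) }.

(* [chart_at] only selects, for each point, the chart used to represent tangent
   vectors at this point: T_x M is R^(dim M), read in the chart [chart_at x]. *)
Record manifold (R : realType) := Manifold {
  mspace :> charted R;
  chart_at : mspace -> chart R mspace (sdim mspace);
  manifoldP : is_manifold chart_at }.

Definition mdiff (R : realType) (M N : manifold R) (f : M -> N) (x : M)
    (v : 'rV[R]_(sdim M)) : 'rV[R]_(sdim N) :=
  'd (cmap (chart_at (f x)) \o f \o cinv (chart_at x)) (cmap (chart_at x) x) v.

Definition velocity (R : realType) (M : manifold R) (g : R -> M) (t : R) :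
    'rV[R]_(sdim M) :=
  derive1 (cmap (chart_at (g t)) \o g) t.

Definition immersion (R : realType) (M N : manifold R) (f : M -> N) : Prop :=
  smooth f /\ forall x, injective (mdiff f x).

(* A vector field is smooth when its components in every chart are. *)
Definition smooth_vector_field (R : realType) (M : manifold R)
    (X : M -> 'rV[R]_(sdim M)) : Prop :=
  forall c : chart R M (sdim M), charts c ->
    smooth_on (cimg c) (fun v =>
      let y := cinv c v in
      'd (cmap c \o cinv (chart_at y)) (cmap (chart_at y) y) (X y) :
        'rV[R]_(sdim M)).

Definition integral_curve (R : realType) (M : manifold R)
    (X : M -> 'rV[R]_(sdim M)) (J : set R) (g : R -> M) : Prop :=
  forall t, J t -> @smooth_at R (line R) M g t /\ velocity g t = X (g t).

(* [Phi] with domain [D] (an open subset of R x M) is the maximal local flow of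
   [X]; the flow is global exactly when [D] is everything. *)
Record is_flow (R : realType) (M : manifold R) (X : M -> 'rV[R]_(sdim M))
    (D : set (R * M)) (Phi : R -> M -> M) : Prop := IsFlow {
  flow_open : @sopen R (prod_charted (line R) M) D;
  flow_smooth : forall p, D p ->
    @smooth_at R (prod_charted (line R) M) M (fun p => Phi p.1 p.2) p;
  flow_interval : forall u, is_interval [set t | D (t, u)];
  flow_dom0 : forall u, D (0, u);
  flow0 : forall u, Phi 0 u = u;
  flow_integral : forall u,
    integral_curve X [set t | D (t, u)] (fun t => Phi t u);
  flow_maximal : forall u (J : set R) (g : R -> M),
    open J -> is_interval J -> J 0 -> g 0 = u -> integral_curve X J g ->
    forall t, J t -> D (t, u) }.

(** * Lie groups and principal bundles *)

Record lie_group (R : realType) := LieGroup {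
  gmfd :> manifold R;
  gone : gmfd;
  gmul : gmfd -> gmfd -> gmfd;
  ginv : gmfd -> gmfd;
  gmulA : associative gmul;
  gmul1 : left_id gone gmul;
  gmulV : left_inverse gone ginv gmul;
  gmul_smooth : @smooth R (prod_charted gmfd gmfd) gmfd (fun z => gmul z.1 z.2);
  ginv_smooth : @smooth R gmfd gmfd ginv }.

Arguments gone {R} _.

(* The Lie algebra, as a vector space, is the tangent space at the unit. *)
Definition Ad (R : realType) (H : lie_group R) (a : H)
    (v : 'rV[R]_(sdim H)) : 'rV[R]_(sdim H) :=
  @mdiff R H H (fun b => gmul (gmul a b) (ginv a)) (gone H) v.

(* [g] is the curve t |-> exp (t mu). *)
Definition one_parameter_subgroup (R : realType) (H : lie_group R)
    (mu : 'rV[R]_(sdim H)) (g : R -> H) : Prop :=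
  [/\ @smooth R (line R) H g,
      forall s t, g (s + t) = gmul (g s) (g t) &
      velocity g 0 = mu].

Record principal_bundle (R : realType) (M : manifold R) (H : lie_group R) :=
  PrincipalBundle {
  ptot :> manifold R;
  bproj : ptot -> M;
  bact : ptot -> H -> ptot;
  bproj_smooth : smooth bproj;
  bact_smooth : @smooth R (prod_charted ptot H) ptot (fun z => bact z.1 z.2);
  bact1 : forall u, bact u (gone H) = u;
  bactM : forall u a b, bact u (gmul a b) = bact (bact u a) b;
  bproj_act : forall u a, bproj (bact u a) = bproj u;
  local_triviality : forall x : M,
    exists (U : set M) (tau : M * H -> ptot) (psi : ptot -> H),
      [/\ sopen U /\ U x,
          (forall y a, U y ->
             @smooth_at R (prod_charted M H) ptot tau (y, a) /\
             bproj (tau (y, a)) = y),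
          (forall y a b, U y -> tau (y, gmul a b) = bact (tau (y, a)) b),
          (forall u, U (bproj u) -> smooth_at psi u /\ tau (bproj u, psi u) = u) &
          (forall y a, U y -> psi (tau (y, a)) = a)] }.

Arguments bproj {R M H} _ _.
Arguments bact {R M H} _ _ _.

Definition principal_automorphism (R : realType) (M : manifold R)
    (H : lie_group R) (Q : principal_bundle M H) (phi : M -> M) (Phi : Q -> Q) :
    Prop :=
  [/\ diffeo phi, diffeo Phi,
      forall u, bproj Q (Phi u) = phi (bproj Q u) &
      forall u a, Phi (bact Q u a) = bact Q (Phi u) a].

Definition invariant_vector_field (R : realType) (M : manifold R)
    (H : lie_group R) (Q : principal_bundle M H) (X : Q -> 'rV[R]_(sdim Q)) :
    Prop :=
  smooth_vector_field X /\
  forall u a, @mdiff R Q Q (fun u' => bact Q u' a) u (X u) = X (bact Q u a).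

(** * Reductive G-structures and the generalized Kosmann vector field *)

(* The Lie subgroup and the principal subbundle are given by their inclusions,
   [jG] and [jP]; the Lie subalgebra is the image of the differential of [jG]. *)
Record reductive_structure (R : realType) (M : manifold R) (H G : lie_group R)
    (Q : principal_bundle M H) (P : principal_bundle M G) :=
  ReductiveStructure {
  jG : G -> H;
  jG_immersion : immersion jG;
  jG_inj : injective jG;
  jG_mul : forall a b, jG (gmul a b) = gmul (jG a) (jG b);
  jP : P -> Q;
  jP_immersion : immersion jP;
  jP_inj : injective jP;
  jP_proj : forall u, bproj Q (jP u) = bproj P u;
  jP_act : forall u a, jP (bact P u a) = bact Q (jP u) (jG a);
  mfrak : {vspace 'rV[R]_(sdim H)};
  mfrak_add : (limg (linfun (mdiff jG (gone G))) + mfrak = fullv)%VS;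
  mfrak_cap : (limg (linfun (mdiff jG (gone G))) :&: mfrak = 0)%VS;
  mfrak_Ad : forall (a : G) mu, mu \in mfrak -> Ad (jG a) mu \in mfrak }.

(* The subspace {d/dt|_0 u . exp (t mu) | mu in m} of T_u Q. *)
Definition m_space (R : realType) (M : manifold R) (H G : lie_group R)
    (Q : principal_bundle M H) (P : principal_bundle M G)
    (S : reductive_structure Q P) (u : Q) : set 'rV[R]_(sdim Q) :=
  [set v | exists mu (g : R -> H),
     [/\ mu \in mfrak S, one_parameter_subgroup mu g &
         v = @velocity R Q (fun t => bact Q u (g t)) 0]].

(* The T_uP-component of Xi in T_uQ = T_uP (+) m_space u; [xget 0] picks
   the unique element of the set. *)
Definition kosmann (R : realType) (M : manifold R) (H G : lie_group R)
    (Q : principal_bundle M H) (P : principal_bundle M G)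
    (S : reductive_structure Q P) (Xi : Q -> 'rV[R]_(sdim Q)) (u : P) :
    'rV[R]_(sdim P) :=
  xget 0 [set v : 'rV[R]_(sdim P) |
    m_space S (jP S u) (Xi (jP S u) - mdiff (jP S) u v)].

(** * Jets *)

Definition jet_eq (R : realType) (X Y : charted R) (k : nat) (x : X)
    (f g : X -> Y) : Prop :=
  f x = g x /\
  forall (b : chart R X (sdim X)) (c : chart R Y (sdim Y)),
    charts b -> cdom b x -> charts c -> cdom c (f x) ->
    forall i : mindex (sdim X) 0 k,
      mpartial i (cmap c \o f \o cinv b) (cmap b x) =
      mpartial i (cmap c \o g \o cinv b) (cmap b x).

(* The k-jet of [f] at [x], as an equivalence class. *)
Definition jet (R : realType) (X Y : charted R) (k : nat) (x : X) (f : X -> Y) :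
    set (X -> Y) :=
  [set g | smooth_at g x /\ jet_eq k x f g].

(** * The group W^{k,h}_m H *)

Definition germ_rep (R : realType) (m : nat) (H : lie_group R)
    (alpha : euclid R m -> euclid R m) (a : euclid R m -> H) : Prop :=
  [/\ local_diffeo_at alpha origin, alpha origin = origin & smooth_at a origin].

Definition Wgroup (R : realType) (m : nat) (H : lie_group R) (k h : nat) :
    Type :=
  {w : set (euclid R m -> euclid R m) * set (euclid R m -> H) |
    exists alpha a, germ_rep alpha a /\ w = (jet k origin alpha, jet h origin a)}.

(* w = (j^k_0 alpha, j^h_0 a) *)
Definition Wrep (R : realType) (m : nat) (H : lie_group R) (k h : nat)
    (w : Wgroup m H k h) (alpha : euclid R m -> euclid R m)
    (a : euclid R m -> H) : Prop :=
  germ_rep alpha a /\ sval w = (jet k origin alpha, jet h origin a).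

(* w3 = w1 (.) w2 *)
Definition Wmul (R : realType) (m : nat) (H : lie_group R) (k h : nat)
    (w1 w2 w3 : Wgroup m H k h) : Prop :=
  exists alpha a beta b,
    [/\ Wrep w1 alpha a, Wrep w2 beta b &
        Wrep w3 (alpha \o beta) (fun y => gmul (a (beta y)) (b y))].

Definition Wone (R : realType) (m : nat) (H : lie_group R) (k h : nat)
    (w : Wgroup m H k h) : Prop :=
  Wrep w id (fun=> gone H).

(* The chart of W^{k,h}_m H given by a chart c of H: the coordinates are the
   derivatives at 0 of alpha (of orders 1, ..., k) and of c o a
   (of orders 0, ..., h). *)
Definition Wspace (R : realType) (m : nat) (H : lie_group R) (k h : nat) :
    charted R :=
  @Charted R (Wgroup m H k h)
    (#|{: mindex m 1 k}| * m + #|{: mindex m 0 h}| * sdim H)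
    [set C | exists c : chart R H (sdim H),
       [/\ charts c,
           cdom C = [set w | exists alpha a, Wrep w alpha a /\ cdom c (a origin)] &
           forall w alpha a, Wrep w alpha a -> cdom c (a origin) ->
             cmap C w = row_mx (taylor 1 k alpha origin) (taylor 0 h (cmap c \o a) origin) /\
             cinv C (cmap C w) = w]].

Definition smooth_left_action (R : realType) (m : nat) (H : lie_group R)
    (k h : nat) (F : manifold R) (lam : Wgroup m H k h -> F -> F) : Prop :=
  [/\ @smooth R (prod_charted (Wspace m H k h) F) F (fun z => lam z.1 z.2),
      forall w f, Wone w -> lam w f = f &
      forall w1 w2 w3 f, Wmul w1 w2 w3 -> lam w3 f = lam w1 (lam w2 f)].

(** * The bundle W^{k,h} Q *)

Definition frame_rep (R : realType) (M : manifold R) (H : lie_group R)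
    (Q : principal_bundle M H) (eps : euclid R (sdim M) -> M)
    (sigma : M -> Q) : Prop :=
  [/\ local_diffeo_at eps origin, smooth_at sigma (eps origin) &
      near_pt (eps origin) (fun y => bproj Q (sigma y) = y)].

Definition WQ (R : realType) (M : manifold R) (H : lie_group R)
    (Q : principal_bundle M H) (k h : nat) : Type :=
  {w : set (euclid R (sdim M) -> M) * set (M -> Q) |
    exists eps sigma,
      frame_rep eps sigma /\ w = (jet k origin eps, jet h (eps origin) sigma)}.

(* w = (j^k_0 eps, j^h_x sigma), where x = eps 0 *)
Definition WQrep (R : realType) (M : manifold R) (H : lie_group R)
    (Q : principal_bundle M H) (k h : nat) (w : WQ Q k h)
    (eps : euclid R (sdim M) -> M) (sigma : M -> Q) : Prop :=
  frame_rep eps sigma /\ sval w = (jet k origin eps, jet h (eps origin) sigma).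

(* w' = w (.) g *)
Definition WQact (R : realType) (M : manifold R) (H : lie_group R)
    (Q : principal_bundle M H) (k h : nat) (w : WQ Q k h)
    (g : Wgroup (sdim M) H k h) (w' : WQ Q k h) : Prop :=
  exists eps sigma alpha a epsV alphaV,
    [/\ WQrep w eps sigma, Wrep g alpha a,
        local_inverse eps origin epsV, local_inverse alpha origin alphaV &
        WQrep w' (eps \o alpha)
          (fun y => bact Q (sigma y) (a (alphaV (epsV y))))].

(* w' = W^{k,h}Phi (w), where Phi is defined at least over a neighbourhood of
   the base point of w and covers phi. *)
Definition WQlift (R : realType) (M : manifold R) (H : lie_group R)
    (Q : principal_bundle M H) (k h : nat) (phi : M -> M) (Phi : Q -> Q)
    (w w' : WQ Q k h) : Prop :=
  forall eps sigma, WQrep w eps sigma ->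
    exists phiV, local_inverse phi (eps origin) phiV /\
      WQrep w' (phi \o eps) (Phi \o sigma \o phiV).

(** * The gauge-natural bundle Q_lambda *)

(* The class [w, f]_lambda for (w (.) g, f) ~ (w, lambda_g f). *)
Definition lam_class (R : realType) (M : manifold R) (H : lie_group R)
    (Q : principal_bundle M H) (k h : nat) (F : manifold R)
    (lam : Wgroup (sdim M) H k h -> F -> F) (w : WQ Q k h) (f : F) :
    set (WQ Q k h * F) :=
  [set p | exists g, WQact w g p.1 /\ f = lam g p.2].

Definition Qlam (R : realType) (M : manifold R) (H : lie_group R)
    (Q : principal_bundle M H) (k h : nat) (F : manifold R)
    (lam : Wgroup (sdim M) H k h -> F -> F) : Type :=
  {q : set (WQ Q k h * F) | exists w f, q = lam_class lam w f}.

(* q lies in the fibre over x *)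
Definition in_fibre (R : realType) (M : manifold R) (H : lie_group R)
    (Q : principal_bundle M H) (k h : nat) (F : manifold R)
    (lam : Wgroup (sdim M) H k h -> F -> F) (q : Qlam Q lam) (x : M) : Prop :=
  exists w f eps sigma,
    [/\ sval q = lam_class lam w f, WQrep w eps sigma & eps origin = x].

(* A chart b of M and a section sigma of Q, both defined on O, yield the section
   s x = (j^k_0 (y |-> b^-1 (b x + y)), j^h_x sigma) of W^{k,h}Q over O, hence a
   trivialisation (x, f) |-> [s x, f] of Q_lambda over O.  The charts of
   Q_lambda are these trivialisations read in b and in a chart c of F. *)
Definition Qlam_space (R : realType) (M : manifold R) (H : lie_group R)
    (Q : principal_bundle M H) (k h : nat) (F : manifold R)
    (lam : Wgroup (sdim M) H k h -> F -> F) : charted R :=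
  @Charted R (Qlam Q lam) (sdim M + sdim F)
    [set C | exists (b : chart R M (sdim M)) (c : chart R F (sdim F))
                    (O : set M) (sigma : M -> Q),
       let trivialises (q : Qlam Q lam) (x : M) (f : F) :=
         [/\ O x, cdom c f &
             exists w,
               WQrep w (fun y => cinv b (cmap b x + y)) sigma /\
               sval q = lam_class lam w f] in
       [/\ charts b, charts c,
           [/\ sopen O, O `<=` cdom b &
               forall x, O x -> smooth_at sigma x /\ bproj Q (sigma x) = x],
           cdom C = [set q | exists x f, trivialises q x f] &
           forall q x f, trivialises q x f ->
             cmap C q = row_mx (cmap b x) (cmap c f) /\
             cinv C (cmap C q) = q]].

(* q' = Phi_lambda q *)
Definition Qlam_lift (R : realType) (M : manifold R) (H : lie_group R)
    (Q : principal_bundle M H) (k h : nat) (F : manifold R)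
    (lam : Wgroup (sdim M) H k h -> F -> F) (phi : M -> M) (Phi : Q -> Q)
    (q q' : Qlam Q lam) : Prop :=
  forall w f, sval q = lam_class lam w f ->
    exists w', WQlift phi Phi w w' /\ sval q' = lam_class lam w' f.

Definition Qlam_automorphism (R : realType) (M : manifold R) (H : lie_group R)
    (Q : principal_bundle M H) (k h : nat) (F : manifold R)
    (lam : Wgroup (sdim M) H k h -> F -> F) (phi : M -> M)
    (psi : Qlam Q lam -> Qlam Q lam) : Prop :=
  [/\ diffeo phi,
      @diffeo R (Qlam_space Q lam) (Qlam_space Q lam) psi &
      forall q x, in_fibre q x -> in_fibre (psi q) (phi x)].

(* A one-parameter group of global automorphisms. *)
Definition one_parameter_group (R : realType) (M : manifold R) (H : lie_group R)
    (Q : principal_bundle M H) (k h : nat) (F : manifold R)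
    (lam : Wgroup (sdim M) H k h -> F -> F) (phi : R -> M -> M)
    (Psi : R -> Qlam Q lam -> Qlam Q lam) : Prop :=
  [/\ forall t, Qlam_automorphism (phi t) (Psi t),
      forall q, Psi 0 q = q,
      forall s t q, Psi (s + t) q = Psi s (Psi t q) &
      @smooth R (prod_charted (line R) (Qlam_space Q lam)) (Qlam_space Q lam)
        (fun p => Psi p.1 p.2)].

(* The same when Psi t is only defined over the open set {x | E (t, x)}, on
   which phi t is defined. *)
Definition local_one_parameter_group (R : realType) (M : manifold R)
    (H : lie_group R) (Q : principal_bundle M H) (k h : nat) (F : manifold R)
    (lam : Wgroup (sdim M) H k h -> F -> F) (E : set (R * M))
    (phi : R -> M -> M) (Psi : R -> Qlam Q lam -> Qlam Q lam) : Prop :=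
  [/\ @sopen R (prod_charted (line R) M) E /\ (forall x, E (0, x)),
      forall t x, E (t, x) ->
        @smooth_at R (prod_charted (line R) M) M (fun p => phi p.1 p.2) (t, x) /\
        E (- t, phi t x),
      forall q t x, in_fibre q x -> E (t, x) ->
        in_fibre (Psi t q) (phi t x) /\
        @smooth_at R (prod_charted (line R) (Qlam_space Q lam)) (Qlam_space Q lam)
          (fun p => Psi p.1 p.2) (t, q),
      forall q, Psi 0 q = q &
      forall q s t x, in_fibre q x -> E (t, x) -> E (s, phi t x) ->
        E (s + t, x) /\ Psi (s + t) q = Psi s (Psi t q)].

(* Main.v *)
(* The complement m being Ad(G)-stable, the splitting T_u Q = T_u P (+) M_u is
   G-equivariant, so the Kosmann field is G-invariant.  Integral curves being
   unique, its maximal flow commutes with the right action of G and satisfies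
   the one-parameter group law; hence its domain is saturated over M, and the
   flow descends to M and extends to Q by u.a |-> PhiK(u).a.  The lifts to
   W^{k,h}Q commute with the right action of W^{k,h}_m H, so they act on Q_lambda
   and inherit the group law.  Read in two trivialisations of Q_lambda, the lifted
   flow is (t, x, f) |-> (phi_t x, lambda (g(t, x), f)), where the coordinates of
   g(t, x) are partial derivatives of smooth functions depending on (t, x):
   this gives its smoothness. *)

Require Import Defs.
From mathcomp Require Import all_boot all_order all_algebra.
From mathcomp Require Import all_classical all_reals all_analysis.
From mathcomp Require Import ring lra.
Import Order.TTheory GRing.Theory Num.Theory.
Import numFieldNormedType.Exports.
Set Implicit Arguments.
Unset Strict Implicit.
Unset Printing Implicit Defensive.
Local Open Scope classical_set_scope.
Local Open Scope ring_scope.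

(** * Smooth maps between normed spaces *)

(** Jets are classes of total functions, and the operations on them are relations between
    representatives. Every operation therefore needs independence of representatives, which comes
    down to three facts: the chain rule for jets, the jet of a local inverse, and the jet of the
    group-valued quotient of two maps into a principal bundle. The hypothesis [h <= k] enters here:
    acting on (eps, sigma) multiplies sigma by a \o alpha^-1 \o eps^-1, so h-jets of alpha and eps,
    known up to order k, show up in the h-jet of a section. The chain rule is an induction on
    directional derivatives, whereas [jet_eq] only compares derivatives along multi-indices; the
    symmetry of second derivatives reconciles the two. Uniqueness of integral curves uses a local
    Lipschitz bound, and the smoothness behind this bound is read off from the flow itself, whose
    derivative at time 0 is the field. Smoothness on Q_lambda is established in charts built for the
    occasion: those of F and of W^{k,h}_m H are imposed by the smoothness of [lam], and the other
    ones come from local sections of Q. *)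

Section CkTheory.
Context {R : realType}.

Lemma Ck_sub (V W : normedModType R) k (A B : set V) (f : V -> W) :
  A `<=` B -> Ck k B f -> Ck k A f.
Proof.
elim: k f => [|k IH] f AB /=; first by move=> H x /AB /H.
by move=> [H1 H2]; split=> [x /AB /H1//|v]; apply: IH.
Qed.

(** The derivatives in [Ck] are taken in the ambient space whatever [A] is, so being C^k is a
    condition on each point separately. This allows smoothness to be handled by filters. *)
Lemma Ck_pointwise (V W : normedModType R) k (A : set V) (f : V -> W) :
  (forall x, A x -> Ck k [set x] f) -> Ck k A f.
Proof.
elim: k f => [|k IH] f H /=; first by move=> x Ax; apply: (H x Ax).
by split=> [x Ax|v]; [apply: (H x Ax).1|apply: IH => x Ax; apply: (H x Ax).2].
Qed.

Lemma Ck_le (V W : normedModType R) k (A : set V) (f : V -> W) :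
  Ck k.+1 A f -> Ck k A f.
Proof.
elim: k f => [|k IH] f [H1 H2].
  by move=> x Ax; apply/differentiable_continuous/H1.
by split=> // v; apply: IH.
Qed.

Lemma open_near (T : topologicalType) (A : set T) (P : T -> Prop) x :
  open A -> A x -> (forall y, A y -> P y) -> \forall y \near x, P y.
Proof.
by move=> oA Ax H; apply: filterS (open_nbhs_nbhs (conj oA Ax)) => y /H.
Qed.

Lemma near_shift0 (V : normedModType R) (P : V -> Prop) (a : V) :
  (\forall x \near a, P x) -> \forall h \near (0 : V), P (h + a).
Proof.
move=> H.
have : h + a @[h --> (0 : V)] --> 0 + a.
  by apply: cvgD; [exact: cvg_id|exact: cvg_cst].
by rewrite add0r; apply.
Qed.

Lemma near_eq_differentiable (V W : normedModType R) (f g : V -> W) (a : V) :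
  {near a, f =1 g} -> differentiable f a -> differentiable g a.
Proof.
move=> fg df; pose z : V -> W := g - f.
have z0 : \forall x \near a, z x = 0.
  by apply: filterS fg => x fx; rewrite /z -[LHS]/(g x - f x) fx subrr.
have E : z \o shift a = cst (z a) + (\0 : V -> W) +o_ (nbhs 0) id.
  apply/eqaddoP => e e0; apply: filterS (near_shift0 z0) => h zh.
  rewrite -![(_ + _ : _ -> _) _]/(_ + _) -![(- _ : _ -> _) _]/(- _) /=.
  rewrite (nbhs_singleton z0) zh; by rewrite addr0 subr0 normr0 mulr_ge0// ltW.
have zd : differentiable z a.
  apply/diff_locallyP.
  have -> : 'd z a = \0 :> (V -> W).
    by apply: (@diff_unique _ _ _ z \0) => //; exact: cst_continuous.
  by split => //; exact: cst_continuous.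
have -> : g = z + f.
  by apply/funext => x; rewrite /z -[RHS]/(g x - f x + f x) subrK.
exact: differentiableD.
Qed.

Lemma differentiable_mxP (V : normedModType R) m n (f : V -> 'M[R]_(m, n)) x :
  differentiable f x <-> forall i j, differentiable (fun y => f y i j) x.
Proof.
split=> [df i j|H].
  rewrite (_ : (fun y => f y i j) = (fun N : 'M[R]_(m, n) => N i j) \o f)//.
  exact/differentiable_comp/differentiable_coord.
rewrite (_ : f = \sum_(i < m) \sum_(j < n) (fun y => f y i j *: delta_mx i j)).
  by do 2!apply: differentiable_sum => ?; apply: differentiableZl.
apply/funext => y; rewrite {1}(matrix_sum_delta (f y)).
by rewrite fct_sumE; apply: eq_bigr => i _; rewrite fct_sumE.
Qed.

Lemma Ck_ext (V W : normedModType R) k (A : set V) (f g : V -> W) :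
  open A -> (forall x, A x -> f x = g x) -> Ck k A f -> Ck k A g.
Proof.
move=> oA; elim: k f g => [|k IH] f g fg /=.
  move=> H x Ax; change (g y @[y --> x] --> g x); rewrite -(fg x Ax).
  apply: cvg_trans (H x Ax).
  exact/near_eq_cvg/(open_near oA Ax fg).
move=> [H1 H2]; split=> [x Ax|v].
  exact: near_eq_differentiable (open_near oA Ax fg) (H1 x Ax).
apply: IH (H2 v) => x Ax.
exact/near_eq_derive/(open_near oA Ax fg).
Qed.

Lemma Ck_cst (V W : normedModType R) k (A : set V) (c : W) :
  Ck k A (fun=> c).
Proof.
elim: k c => [|k IH] c; first by move=> x _; apply: cst_continuous.
split=> [x _|v]; first exact: differentiable_cst.
suff -> : 'D_v (fun=> c : W) = (fun=> 0 : W) by [].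
by apply/funext => x; rewrite derive_cst.
Qed.

Lemma CkD (V W : normedModType R) k (A : set V) (f g : V -> W) :
  open A -> Ck k A f -> Ck k A g -> Ck k A (fun x => f x + g x).
Proof.
move=> oA; elim: k f g => [|k IH] f g.
  by move=> H1 H2 x Ax; apply: cvgD; [apply: H1|apply: H2].
move=> [f1 f2] [g1 g2]; split=> [x Ax|v].
  by apply: differentiableD; [apply: f1|apply: g1].
apply: (Ck_ext oA _ (IH _ _ (f2 v) (g2 v))) => x Ax.
by rewrite -deriveD//; apply: diff_derivable; [apply: f1|apply: g1].
Qed.

Lemma CkM (V : normedModType R) k (A : set V) (f g : V -> R) :
  open A -> Ck k A f -> Ck k A g -> Ck k A (fun x => f x * g x).
Proof.
move=> oA; elim: k f g => [|k IH] f g.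
  by move=> H1 H2 x Ax; apply: cvgM; [apply: H1|apply: H2].
move=> cf cg; have [f1 f2] := cf; have [g1 g2] := cg; split=> [x Ax|v].
  by apply: differentiableM; [apply: f1|apply: g1].
have h1 := IH _ _ (Ck_le cf) (g2 v); have h2 := IH _ _ (Ck_le cg) (f2 v).
apply: (Ck_ext oA _ (CkD oA h1 h2)) => x Ax.
by rewrite deriveM//; apply: diff_derivable; [apply: f1|apply: g1].
Qed.

Lemma Ck_mxP (V : normedModType R) k (A : set V) m n (f : V -> 'M[R]_(m, n)) :
  open A -> Ck k A f <-> forall i j, Ck k A (fun x => f x i j).
Proof.
move=> oA; elim: k f => [|k IH] f; split.
- move=> H i j x Ax.
  apply: (@cvg_comp _ _ _ f (fun N : 'M[R]_(m, n) => N i j)); first exact: H.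
  exact: coord_continuous.
- move=> H x Ax; apply/cvgrPdist_lt => e e0; near=> y.
  rewrite /Num.Def.normr/= mx_normrE; apply/bigmax_ltP; split=> // i _.
  rewrite !mxE; move: i; near: y; apply: filter_forall => -[i j].
  by have /cvgrPdist_lt/(_ e e0) := H i j x Ax.
- move=> [H1 H2] i j; split=> [x Ax|v].
    by have /differentiable_mxP := H1 x Ax; apply.
  apply: (Ck_ext oA _ ((IH _).1 (H2 v) i j)) => x Ax.
  by rewrite derive_mx ?mxE//; apply/diff_derivable/H1.
- move=> H; split=> [x Ax|v].
    by apply/differentiable_mxP => i j; apply: (H i j).1.
  apply/IH => i j; apply: (Ck_ext oA _ ((H i j).2 v)) => x Ax.
  rewrite derive_mx ?mxE//; apply/derivable_mxP => i' j'.
  by apply/diff_derivable/(H i' j').1.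
Unshelve. all: by end_near. Qed.

Lemma Ck_sum (V W : normedModType R) k (A : set V) I (r : seq I)
    (f : I -> V -> W) :
  open A -> (forall i, Ck k A (f i)) -> Ck k A (fun x => \sum_(i <- r) f i x).
Proof.
move=> oA H; elim: r => [|i r IH].
  by rewrite (_ : (fun x => _) = fun=> 0);
    [apply: Ck_cst|apply/funext => x; rewrite big_nil].
rewrite (_ : (fun x => _) = fun x => f i x + \sum_(i <- r) f i x).
  exact: CkD.
by apply/funext => x; rewrite big_cons.
Qed.

Lemma diff_rV_sum p (W : normedModType R) (g : 'rV[R]_p -> W) a v :
  differentiable g a ->
  'd g a v = \sum_(i < p) v 0 i *: 'D_(delta_mx 0 i) g a.
Proof.
move=> dg; rewrite {1}(row_sum_delta v) linear_sum; apply: eq_bigr => i _.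
by rewrite linearZ deriveE.
Qed.

Lemma derive_comp_rV (V W : normedModType R) p (f : V -> 'rV[R]_p)
    (g : 'rV[R]_p -> W) x v :
  differentiable f x -> differentiable g (f x) ->
  'D_v (fun x => g (f x)) x =
  \sum_(i < p) ('D_v f x) 0 i *: 'D_(delta_mx 0 i) g (f x).
Proof.
move=> df dg; rewrite -[fun x => g (f x)]/(g \o f).
have dgf : differentiable (g \o f) x by exact: differentiable_comp.
by rewrite deriveE// diff_comp//= diff_rV_sum// deriveE.
Qed.

(** By the chain rule the derivative of g \o f is a sum of products of a derivative of f with (D_i
    g) \o f. The latter is C^k by induction, f being C^(k+1) and a fortiori C^k. *)
Lemma Ck_comp_scalar (V : normedModType R) p k (A : set V) (B : set 'rV[R]_p)
    (f : V -> 'rV[R]_p) (g : 'rV[R]_p -> R) :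
  open A -> open B -> (forall x, A x -> B (f x)) ->
  Ck k A f -> Ck k B g -> Ck k A (fun x => g (f x)).
Proof.
move=> oA oB AB; elim: k g => [|k IH] g.
  move=> cf cg x Ax; apply: (@cvg_comp _ _ _ f g); first exact: cf.
  exact/cg/AB.
move=> cf cg; have [f1 f2] := cf; have [g1 g2] := cg; split=> [x Ax|v].
  by apply: differentiable_comp; [apply: f1|apply/g1/AB].
have H : Ck k A (fun x => \sum_(i < p)
    ('D_v f x) 0 i * 'D_(delta_mx 0 i) g (f x)).
  apply: Ck_sum => // i; apply: CkM => //.
    exact: ((Ck_mxP _ _ oA).1 (f2 v)).
  by apply: (IH _ _ (g2 _)); apply: Ck_le.
apply: (Ck_ext oA _ H) => x Ax.
by rewrite derive_comp_rV//; [apply: f1|apply/g1/AB].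
Qed.

Lemma Ck_comp (V : normedModType R) p m n k (A : set V) (B : set 'rV[R]_p)
    (f : V -> 'rV[R]_p) (g : 'rV[R]_p -> 'M[R]_(m, n)) :
  open A -> open B -> (forall x, A x -> B (f x)) ->
  Ck k A f -> Ck k B g -> Ck k A (fun x => g (f x)).
Proof.
move=> oA oB AB cf cg; apply/Ck_mxP => // i j.
exact: (Ck_comp_scalar oA oB AB cf ((Ck_mxP k g oB).1 cg i j)).
Qed.

Lemma Ck_linear n p k (A : set 'rV[R]_n) (f : {linear 'rV[R]_n -> 'rV[R]_p}) :
  open A -> Ck k A f.
Proof.
move=> oA.
have E : (f : _ -> _) = fun x => \sum_(i < n) x 0 i *: f (delta_mx 0 i).
  by apply/funext => x; rewrite {1}(row_sum_delta x) linear_sum;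
    apply: eq_bigr => i _; rewrite linearZ.
have df x : differentiable f x.
  rewrite E (_ : (fun x => _) = \sum_(i < n) (fun x : 'rV[R]_n => x 0 i *: f (delta_mx 0 i))).
    by apply: differentiable_sum => i; apply/differentiableZl/differentiable_coord.
  by apply/funext => y; rewrite fct_sumE.
(* Aiming one order higher avoids an induction: the directional derivatives of a linear map are
   constant. *)
apply: Ck_le; split=> // v.
suff -> : 'D_v f = (fun=> f v) by exact: Ck_cst.
apply/funext => x; rewrite deriveE// diff_lin// => y.
exact/differentiable_continuous.
Qed.

End CkTheory.

(** * Germs of smooth maps *)

Section GermTheory.
Context {R : realType}.

Lemma near_open (T : topologicalType) (P : T -> Prop) x :
  (\forall y \near x, P y) ->
  exists U : set T, [/\ open U, U x & forall y, U y -> P y].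
Proof.
move=> H; have : nbhs x [set y | P y] := H.
by rewrite nbhsE => -[U [oU Ux] UP]; exists U.
Qed.

(* Pointwise along a neighbourhood rather than on an open set, so that filter
   lemmas apply. *)
Definition sm (V W : normedModType R) (f : V -> W) (a : V) : Prop :=
  \forall y \near a, smooth_on [set y] f.

Lemma smP (V W : normedModType R) (f : V -> W) a :
  sm f a <-> exists U, [/\ open U, U a & smooth_on U f].
Proof.
split; last first.
  by move=> [U [oU Ua H]]; apply: (open_near oU Ua) => y Uy k; apply: Ck_sub (H k) => _ ->.
move=> /near_open[U [oU Ua H]]; exists U; split=> // k.
by apply: Ck_pointwise => x /H.
Qed.

Lemma sm_near (V W : normedModType R) (f : V -> W) a :
  sm f a -> \forall y \near a, sm f y.
Proof. exact: near_join. Qed.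

Lemma sm_ext (V W : normedModType R) (f g : V -> W) a :
  {near a, f =1 g} -> sm f a -> sm g a.
Proof.
move=> fg /smP[U [oU Ua H]].
have [U' [oU' U'a {}fg]] := near_open fg.
apply/smP; exists (U `&` U'); split=> //; first exact: openI.
move=> k; apply: (Ck_ext (openI oU oU')); last first.
  by apply: Ck_sub (H k) => x [].
by move=> x [_ /fg].
Qed.

Lemma sm_eq (V W : normedModType R) (f g : V -> W) a :
  f =1 g -> sm f a -> sm g a.
Proof. by move=> /funext ->. Qed.

Lemma sm_differentiable (V W : normedModType R) (f : V -> W) a :
  sm f a -> differentiable f a.
Proof. by move=> /nbhs_singleton/(_ 1%N) [+ _]; apply. Qed.

Lemma sm_continuous (V W : normedModType R) (f : V -> W) a :
  sm f a -> {for a, continuous f}.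
Proof. by move=> /sm_differentiable/differentiable_continuous. Qed.

Lemma sm_cst (V W : normedModType R) (c : W) (a : V) : sm (fun=> c) a.
Proof. by apply: nearW => y k; apply: Ck_cst. Qed.

Lemma smD (V W : normedModType R) (f g : V -> W) a :
  sm f a -> sm g a -> sm (fun x => f x + g x) a.
Proof.
move=> /smP[U [oU Ua fU]] /smP[U' [oU' U'a gU]]; apply/smP; exists (U `&` U').
split=> //; first exact: openI.
by move=> k; apply: (CkD (openI oU oU'));
  [apply: Ck_sub (fU k)|apply: Ck_sub (gU k)] => x [].
Qed.

Lemma smM (V : normedModType R) (f g : V -> R) a :
  sm f a -> sm g a -> sm (fun x => f x * g x) a.
Proof.
move=> /smP[U [oU Ua fU]] /smP[U' [oU' U'a gU]]; apply/smP; exists (U `&` U').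
split=> //; first exact: openI.
by move=> k; apply: (CkM (openI oU oU'));
  [apply: Ck_sub (fU k)|apply: Ck_sub (gU k)] => x [].
Qed.

Lemma sm_sum (V W : normedModType R) I (r : seq I) (f : I -> V -> W) a :
  (forall i, sm (f i) a) -> sm (fun x => \sum_(i <- r) f i x) a.
Proof.
move=> H; elim: r => [|i r IH].
  by apply: sm_eq (sm_cst 0 a) => x; rewrite big_nil.
by apply: sm_eq (smD (H i) IH) => x; rewrite big_cons.
Qed.

Lemma sm_derive (V W : normedModType R) (f : V -> W) a v :
  sm f a -> sm ('D_v f) a.
Proof. by apply: filterS => y H k; apply: (H k.+1).2. Qed.

Lemma sm_mxP (V : normedModType R) m n (f : V -> 'M[R]_(m, n)) a :
  sm f a <-> forall i j, sm (fun x => f x i j) a.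
Proof.
split=> [/smP[U [oU Ua H]] i j|H].
  by apply/smP; exists U; split=> // k; have /Ck_mxP := H k; apply.
have /near_open[U [oU Ua HU]] : \forall y \near a, forall ij : 'I_m * 'I_n,
    smooth_on [set y] (fun x => f x ij.1 ij.2).
  by apply: filter_forall => ij; apply: H.
apply/smP; exists U; split=> // k; apply/(Ck_mxP k f oU) => i j.
by apply: Ck_pointwise => x /HU/(_ (i, j)).
Qed.

Lemma sm_lin n p (f : {linear 'rV[R]_n -> 'rV[R]_p}) a : sm f a.
Proof.
by apply/smP; exists setT; split=> //; [exact: openT|move=> k; apply/Ck_linear/openT].
Qed.

Lemma sm_id n (a : 'rV[R]_n) : sm id a.
Proof. exact: (sm_lin idfun). Qed.

Lemma sm_coord n (a : 'rV[R]_n) i j : sm (fun x : 'rV[R]_n => x i j) a.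
Proof. by have /sm_mxP := sm_id a; apply. Qed.

Lemma sm_comp (V : normedModType R) p
    (f : V -> 'rV[R]_p) m n (g : 'rV[R]_p -> 'M[R]_(m, n)) a :
  sm f a -> sm g (f a) -> sm (fun x => g (f x)) a.
Proof.
move=> sf; have cf := sm_continuous sf.
move: sf => /smP[U [oU Ua fU]] /smP[B [oB Bfa gB]].
have : nbhs a (U `&` f @^-1` B).
  by apply: filterI; [exact: open_nbhs_nbhs|exact/cf/open_nbhs_nbhs].
move=> /near_open[A [oA Aa HA]].
apply/smP; exists A; split=> // k; apply: (Ck_comp oA oB _ _ (gB k)).
  by move=> x /HA[].
by apply: Ck_sub (fU k) => x /HA[].
Qed.

Lemma sm_row_mx (V : normedModType R) n p (f : V -> 'rV[R]_n) (g : V -> 'rV[R]_p) a :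
  sm f a -> sm g a -> sm (fun x => row_mx (f x) (g x)) a.
Proof.
move=> /sm_mxP sf /sm_mxP sg; apply/sm_mxP => i j.
rewrite -(splitK j); case: (fintype.split j) => j' /=.
  by apply: sm_eq (sf i j') => x; rewrite row_mxEl.
by apply: sm_eq (sg i j') => x; rewrite row_mxEr.
Qed.

Lemma sm_lsubmx n p (a : 'rV[R]_(n + p)) : sm (fun x : 'rV[R]_(n + p) => lsubmx x) a.
Proof.
apply/sm_mxP => i j; apply: sm_eq (sm_coord a i (lshift p j)) => x.
by rewrite mxE.
Qed.

Lemma sm_rsubmx n p (a : 'rV[R]_(n + p)) : sm (fun x : 'rV[R]_(n + p) => rsubmx x) a.
Proof.
apply/sm_mxP => i j; apply: sm_eq (sm_coord a i (rshift n j)) => x.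
by rewrite mxE.
Qed.

Lemma smZr (V : normedModType R) m n (c : R) (f : V -> 'M[R]_(m, n)) a :
  sm f a -> sm (fun x => c *: f x) a.
Proof.
move=> /sm_mxP H; apply/sm_mxP => i j.
apply: sm_eq (smM (sm_cst c a) (H i j)) => x.
by rewrite mxE.
Qed.

Lemma smB (V : normedModType R) m n (f g : V -> 'M[R]_(m, n)) a :
  sm f a -> sm g a -> sm (fun x => f x - g x) a.
Proof.
move=> sf sg; apply: sm_eq (smD sf (smZr (-1) sg)) => x.
by rewrite scaleN1r.
Qed.

(** * Symmetry of second derivatives *)

Lemma is_derive_line (V W : normedModType R) (f : V -> W) x v (t : R) :
  derivable f (x + t *: v) v ->
  is_derive t 1 (fun s : R => f (x + s *: v)) ('D_v f (x + t *: v)).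
Proof.
move=> df.
have E : (fun h : R => h^-1 *: (f (x + (h *: 1 + t) *: v) - f (x + t *: v))) =
         (fun h => h^-1 *: (f (h *: v + (x + t *: v)) - f (x + t *: v))).
  by apply/funext => h; rewrite [h%:A]mulr1 scalerDl addrCA.
by apply: DeriveDef; rewrite /derivable /derive E.
Qed.

Lemma MVT_line (V : normedModType R) (f : V -> R) x v (s : R) :
  0 < s -> (forall t, 0 <= t <= s -> differentiable f (x + t *: v)) ->
  exists2 t, 0 < t < s & f (x + s *: v) - f x = s * 'D_v f (x + t *: v).
Proof.
move=> s0 df.
have H t : 0 <= t <= s ->
    is_derive t 1 (fun s : R => f (x + s *: v)) ('D_v f (x + t *: v)).
  by move=> ts; apply/is_derive_line/diff_derivable/df.
have [||t] := @MVT R (fun s => f (x + s *: v)) (fun t => 'D_v f (x + t *: v)) 0 s s0.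
- by move=> t; rewrite in_itv /= => /andP[t0 t1]; apply: H; rewrite !ltW.
- apply: derivable_within_continuous => t; rewrite in_itv /= => ts.
  by have [] := H t ts.
- rewrite in_itv /= scale0r addr0 subr0 => ts E; exists t => //.
  by rewrite E mulrC.
Qed.

Lemma line2_near (V : normedModType R) (P : V -> Prop) (a v w : V) :
  (\forall y \near a, P y) ->
  exists2 d : R, 0 < d & forall s t : R, `|s| < d -> `|t| < d ->
    P (a + s *: v + t *: w).
Proof.
move=> /nbhs_ballP[e /= e0 H].
pose c := `|v| + `|w| + 1.
have c0 : 0 < c by rewrite ltr_wpDl// addr_ge0.
exists (e / c) => [|s t sd td]; first by rewrite divr_gt0.
apply: H; rewrite -ball_normE /= -addrA opprD addrA subrr add0r normrN.
apply: le_lt_trans (ler_normD _ _) _; rewrite !normrZ.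
have d0 : 0 < e / c by rewrite divr_gt0.
apply: (@le_lt_trans _ _ (e / c * `|v| + e / c * `|w|)).
  by apply: lerD; apply: ler_wpM2r => //; exact: ltW.
rewrite -mulrDr -[ltRHS](@divfK _ c) ?gt_eqF// ltr_pM2l//.
by rewrite ltrDl.
Qed.

(** The mean value theorem is applied twice: along v to x |-> f (x + s w) - f x, then along w to D_v
    f. The second difference is thus s^2 times D_w D_v f at a point of the parallelogram, where this
    derivative is e-close to its value at a. *)
Lemma second_difference (V : normedModType R) (f : V -> R) a v w (e : R) :
  sm f a -> 0 < e -> exists2 d, 0 < d & forall s, 0 < s < d ->
    `|f (a + s *: v + s *: w) - f (a + s *: v) - f (a + s *: w) + f a
      - s * s * 'D_w ('D_v f) a| <= e * (s * s).
Proof.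
move=> sf e0.
have N1 : \forall y \near a, differentiable f y /\ differentiable ('D_v f) y /\
    `|'D_w ('D_v f) a - 'D_w ('D_v f) y| < e.
  have := sm_continuous (sm_derive w (sm_derive v sf)).
  move=> /cvgrPdist_lt/(_ e e0); apply: filterS2 (sm_near sf) => y sy.
  split; first exact: sm_differentiable.
  by split=> //; apply/sm_differentiable/sm_derive.
have [d d0 H] := line2_near v w N1.
exists d => // s /andP[s0 sd].
have nd t : 0 <= t <= s -> `|t| < d.
  by move=> /andP[t0 ts]; rewrite ger0_norm// (le_lt_trans ts).
have ss : `|s| < d by rewrite gtr0_norm.
pose g x := f (x + s *: w) - f x.
have dg t : 0 <= t <= s -> is_derive t 1 (fun t => g (a + t *: v))
    ('D_v f (a + t *: v + s *: w) - 'D_v f (a + t *: v)).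
  move=> ts; rewrite /g; apply: is_deriveB.
    rewrite (_ : (fun x => f _) = fun t => f ((a + s *: w) + t *: v)); last first.
      by apply/funext => x; rewrite addrAC.
    rewrite [a + t *: v + s *: w]addrAC; apply/is_derive_line/diff_derivable.
    by rewrite addrAC; have [] := H t s (nd t ts) ss.
  apply/is_derive_line/diff_derivable.
  have n0 : `|0 : R| < d by rewrite normr0.
  by have [+ _] := H t 0 (nd t ts) n0; rewrite scale0r addr0.
have [||t] := @MVT R (fun s => g (a + s *: v))
    (fun t => 'D_v f (a + t *: v + s *: w) - 'D_v f (a + t *: v)) 0 s s0.
- by move=> t; rewrite in_itv /= => /andP[t0 t1]; apply: dg; rewrite !ltW.
- apply: derivable_within_continuous => t; rewrite in_itv /= => ts.
  by have [] := dg t ts.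
rewrite in_itv /= scale0r addr0 subr0 => /andP[t0 ts] E1.
have ts' : 0 <= t <= s by rewrite !ltW.
have [|r rs E2] := @MVT_line _ ('D_v f) (a + t *: v) w s s0.
  by move=> r rs; have [_ []] := H t r (nd t ts') (nd r rs).
have rs' : 0 <= r <= s by case/andP: rs => *; rewrite !ltW.
have [_ [_ /ltW He]] := H t r (nd t ts') (nd r rs').
rewrite E2 /g in E1.
have -> : f (a + s *: v + s *: w) - f (a + s *: v) - f (a + s *: w) + f a =
    s * 'D_w ('D_v f) (a + t *: v + r *: w) * s.
  by rewrite -E1 opprB addrA [RHS]addrAC.
rewrite mulrAC -mulrBr normrM distrC mulrC.
by rewrite [`|s * s|]gtr0_norm ?mulr_gt0// ler_wpM2r// mulr_ge0// ltW.
Qed.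

Lemma close_quotients (X A B q e : R) : 0 < q ->
  `|X - q * A| <= e / 2 * q -> `|X - q * B| <= e / 2 * q -> `|B - A| <= e.
Proof.
move=> q0 h1 h2; rewrite -(ler_pM2r q0) -{1}(gtr0_norm q0) -normrM.
have -> : (B - A) * q = (X - q * A) - (X - q * B) by ring.
by apply: le_trans (ler_normB _ _) _; rewrite [e]splitr mulrDl lerD.
Qed.

(** The second difference is symmetric in v and w, so its quotient by s^2 is within e / 2 of both
    mixed derivatives for small s. *)
Lemma derive_comm_scalar (V : normedModType R) (f : V -> R) a v w :
  sm f a -> 'D_v ('D_w f) a = 'D_w ('D_v f) a.
Proof.
move=> sf; apply/eqP; rewrite -subr_eq0 -normr_le0; apply/ler_addgt0Pr => e e0.
rewrite add0r.
have [d d0 H] := second_difference v w sf (divr_gt0 e0 (ltr0Sn R 1)).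
have [d' d'0 H'] := second_difference w v sf (divr_gt0 e0 (ltr0Sn R 1)).
pose m := Num.min d d'; have m0 : 0 < m by rewrite lt_min d0.
have /andP[sd sd'] : (m / 2 < d) && (m / 2 < d').
  by rewrite -lt_min ltr_pdivrMr// ltr_pMr// ltr1n.
have s0 : 0 < m / 2 by rewrite divr_gt0.
have h1 := H (m / 2); have h2 := H' (m / 2); rewrite s0 sd in h1; rewrite s0 sd' in h2.
have {}h1 := h1 isT; have {}h2 := h2 isT.
rewrite (addrAC a) (addrAC (f _)) in h2.
exact: (close_quotients (mulr_gt0 s0 s0) h1 h2).
Qed.

Lemma derive_comm (V : normedModType R) m n (f : V -> 'M[R]_(m, n)) a v w :
  sm f a -> 'D_v ('D_w f) a = 'D_w ('D_v f) a.
Proof.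
move=> sf; apply/matrixP => i j.
have E u u' : ('D_u ('D_u' f) a) i j = 'D_u ('D_u' (fun x => f x i j)) a.
  rewrite derive_mx ?mxE; last exact/diff_derivable/sm_differentiable/sm_derive.
  apply: near_eq_derive; apply: filterS (sm_near sf) => y sy.
  by rewrite derive_mx ?mxE//; apply/diff_derivable/sm_differentiable.
have C := derive_comm_scalar v w ((sm_mxP f a).1 sf i j).
exact: (etrans (E v w) (etrans C (esym (E w v)))).
Qed.

End GermTheory.

(** * Partial derivatives and jets in coordinates *)

Section EuclideanJets.
Context {R : realType}.

(* Equality of k-jets by iterated directional derivatives: contrary to [jet_eq],
   it turns the chain rule into an induction on k. *)
Fixpoint jeq (V W : normedModType R) (k : nat) (f g : V -> W) (a : V) : Prop :=
  f a = g a /\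
  if k is k'.+1 then forall v, jeq k' ('D_v f) ('D_v g) a else True.

Lemma jeq_refl (V W : normedModType R) k (f : V -> W) a : jeq k f f a.
Proof. by elim: k f => [|k IH] f //=; split. Qed.

Lemma jeq_sym (V W : normedModType R) k (f g : V -> W) a :
  jeq k f g a -> jeq k g f a.
Proof.
elim: k f g => [|k IH] f g [fg H]; split=> // v.
exact/IH/H.
Qed.

Lemma jeq_trans (V W : normedModType R) k (f g h : V -> W) a :
  jeq k f g a -> jeq k g h a -> jeq k f h a.
Proof.
elim: k f g h => [|k IH] f g h [fg H] [gh H']; split=> //; rewrite ?fg// => v.
exact: IH (H v) (H' v).
Qed.

Lemma jeq_pred (V W : normedModType R) k (f g : V -> W) a :
  jeq k.+1 f g a -> jeq k f g a.
Proof.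
elim: k f g => [|k IH] f g [fg H]; split=> // v.
exact/IH/H.
Qed.

Lemma jeq_near (V W : normedModType R) k (f g : V -> W) a :
  {near a, f =1 g} -> jeq k f g a.
Proof.
elim: k f g => [|k IH] f g fg; split; rewrite ?(nbhs_singleton fg)// => v.
apply: IH; move: fg => /near_join; apply: filterS => y fg.
exact: near_eq_derive.
Qed.

Lemma jeq_le (V W : normedModType R) k l (f g : V -> W) a :
  (l <= k)%N -> jeq k f g a -> jeq l f g a.
Proof.
move=> /subnK <-; elim: (k - l)%N => [|n IH] //.
by rewrite addSn => /jeq_pred.
Qed.

Lemma near_derive (V W : normedModType R) (f g : V -> W) (a v : V) :
  {near a, f =1 g} -> {near a, 'D_v f =1 'D_v g}.
Proof. by move=> /near_join; apply: filterS => y; apply: near_eq_derive. Qed.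

Lemma jeqD (V W : normedModType R) k (f f' g g' : V -> W) a :
  sm f a -> sm f' a -> sm g a -> sm g' a ->
  jeq k f f' a -> jeq k g g' a ->
  jeq k (fun x => f x + g x) (fun x => f' x + g' x) a.
Proof.
elim: k f f' g g' => [|k IH] f f' g g' sf sf' sg sg' [ff' Hf] [gg' Hg].
  by split=> //; rewrite ff' gg'.
split; first by rewrite ff' gg'.
have E (h h' : V -> W) v : sm h a -> sm h' a ->
    {near a, 'D_v (fun x => h x + h' x) =1 fun x => 'D_v h x + 'D_v h' x}.
  move=> sh sh'; apply: filterS2 (sm_near sh) (sm_near sh') => x sx sx'.
  by apply: deriveD; apply/diff_derivable/sm_differentiable.
move=> v; apply: jeq_trans (jeq_near _ (E _ _ v sf sg)) _.
apply: jeq_trans (jeq_sym (jeq_near _ (E _ _ v sf' sg'))).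
by apply: IH; [exact: sm_derive..|exact: Hf|exact: Hg].
Qed.

Lemma jeqM (V : normedModType R) k (f f' g g' : V -> R) a :
  sm f a -> sm f' a -> sm g a -> sm g' a ->
  jeq k f f' a -> jeq k g g' a ->
  jeq k (fun x => f x * g x) (fun x => f' x * g' x) a.
Proof.
elim: k f f' g g' => [|k IH] f f' g g' sf sf' sg sg' jf jg.
  by split=> //; rewrite jf.1 jg.1.
split; first by rewrite jf.1 jg.1.
have E (h h' : V -> R) v : sm h a -> sm h' a -> {near a, 'D_v (fun x => h x * h' x)
    =1 fun x => h x * 'D_v h' x + h' x * 'D_v h x}.
  move=> sh sh'; apply: filterS2 (sm_near sh) (sm_near sh') => x sx sx'.
  by apply: deriveM; apply/diff_derivable/sm_differentiable.
move=> v; apply: jeq_trans (jeq_near _ (E _ _ v sf sg)) _.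
apply: jeq_trans (jeq_sym (jeq_near _ (E _ _ v sf' sg'))).
apply: jeqD; [by apply: smM => //; exact: sm_derive..| |].
- apply: IH; [exact: sf|exact: sf'|exact: sm_derive|exact: sm_derive| |exact: jg.2].
  exact: jeq_pred.
- apply: IH; [exact: sg|exact: sg'|exact: sm_derive|exact: sm_derive| |exact: jf.2].
  exact: jeq_pred.
Qed.

Lemma jeq_sum (V W : normedModType R) k I (r : seq I) (f g : I -> V -> W) a :
  (forall i, sm (f i) a) -> (forall i, sm (g i) a) ->
  (forall i, jeq k (f i) (g i) a) ->
  jeq k (fun x => \sum_(i <- r) f i x) (fun x => \sum_(i <- r) g i x) a.
Proof.
move=> sf sg jfg; elim: r => [|i r IH].
  by apply: jeq_near; apply: nearW => x; rewrite !big_nil.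
have E (h : I -> V -> W) : (fun x => \sum_(i <- i :: r) h i x) =
    fun x => h i x + \sum_(i <- r) h i x.
  by apply/funext => x; rewrite big_cons.
by rewrite !E; apply: jeqD => //; exact: sm_sum.
Qed.

Lemma near_derive_mx (V : normedModType R) m n (f : V -> 'M[R]_(m, n)) (a v : V) i j :
  sm f a -> {near a, (fun x => 'D_v f x i j) =1 'D_v (fun x => f x i j)}.
Proof.
move=> sf; apply: filterS (sm_near sf) => x sx.
by rewrite derive_mx ?mxE//; exact/diff_derivable/sm_differentiable.
Qed.

Lemma jeq_mxP (V : normedModType R) k m n (f g : V -> 'M[R]_(m, n)) a :
  sm f a -> sm g a ->
  jeq k f g a <-> forall i j, jeq k (fun x => f x i j) (fun x => g x i j) a.
Proof.
elim: k f g => [|k IH] f g sf sg; split.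
- by move=> [E _] i j; split=> //; rewrite E.
- by move=> H; split=> //; apply/matrixP => i j; case: (H i j).
- move=> [E H] i j; split=> [|v]; first by rewrite E.
  apply: jeq_trans (jeq_sym (jeq_near _ (near_derive_mx v i j sf))) _.
  apply: jeq_trans (jeq_near _ (near_derive_mx v i j sg)).
  exact: ((IH _ _ (sm_derive v sf) (sm_derive v sg)).1 (H v)).
- move=> H; split=> [|v]; first by apply/matrixP => i j; case: (H i j).
  apply: (IH _ _ (sm_derive v sf) (sm_derive v sg)).2 => i j.
  apply: jeq_trans (jeq_near _ (near_derive_mx v i j sf)) _.
  apply: jeq_trans (jeq_sym (jeq_near _ (near_derive_mx v i j sg))).
  exact: (H i j).2.
Qed.

Lemma sm_comp_scalar (V : normedModType R) p (f : V -> 'rV[R]_p)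
    (g : 'rV[R]_p -> R) a :
  sm f a -> sm g (f a) -> sm (fun x => g (f x)) a.
Proof.
move=> sf sg.
(* [sm_comp] concerns matrix-valued maps, hence the detour through 1 x 1 matrices. *)
pose G y : 'rV[R]_1 := const_mx (g y).
have sG : sm G (f a).
  by apply/sm_mxP => i j; apply: sm_eq sg => x; rewrite mxE.
by have /sm_mxP/(_ 0 0) := sm_comp sf sG; apply: sm_eq => x; rewrite mxE.
Qed.

Lemma sm_near_pre (V W : normedModType R) (f : V -> W) (a : V) (P : W -> Prop) :
  sm f a -> (\forall y \near f a, P y) -> \forall x \near a, P (f x).
Proof. by move=> /sm_continuous cf; exact: cf. Qed.

Lemma near_derive_comp (V W : normedModType R) p (f : V -> 'rV[R]_p)
    (g : 'rV[R]_p -> W) (a v : V) : sm f a -> sm g (f a) ->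
  {near a, 'D_v (fun x => g (f x)) =1 fun x =>
    \sum_(i < p) ('D_v f x) 0 i *: 'D_(delta_mx 0 i) g (f x)}.
Proof.
move=> sf sg; have := sm_near_pre sf (sm_near sg).
apply: filterS2 (sm_near sf) => x sx sgx.
by apply: derive_comp_rV; exact: sm_differentiable.
Qed.

(** Chain rule for jets: D_v (g \o f) is a sum of products of the coordinates of D_v f with (D_i g)
    \o f, and the induction hypothesis applies to D_i g with the jet of f truncated by one order. *)
Lemma jeq_comp_scalar (V : normedModType R) p k (f f' : V -> 'rV[R]_p)
    (g g' : 'rV[R]_p -> R) a :
  sm f a -> sm f' a -> sm g (f a) -> sm g' (f a) ->
  jeq k f f' a -> jeq k g g' (f a) ->
  jeq k (fun x => g (f x)) (fun x => g' (f' x)) a.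
Proof.
elim: k g g' => [|k IH] g g' sf sf' sg sg' jf jg.
  by split=> //; rewrite -jf.1 jg.1.
have ff' : f a = f' a by case: jf.
have sg'' : sm g' (f' a) by rewrite -ff'.
split; first by rewrite -ff' jg.1.
move=> v; apply: jeq_trans (jeq_near _ (near_derive_comp v sf sg)) _.
apply: jeq_trans (jeq_sym (jeq_near _ (near_derive_comp v sf' sg''))).
apply: jeq_sum => i.
- apply: smM; first exact: (sm_mxP _ _).1 (sm_derive v sf) _ _.
  exact: sm_comp_scalar (sm_derive _ _).
- apply: smM; first exact: (sm_mxP _ _).1 (sm_derive v sf') _ _.
  exact: sm_comp_scalar (sm_derive _ _).
- apply: jeqM.
  + exact: (sm_mxP _ _).1 (sm_derive v sf) _ _.
  + exact: (sm_mxP _ _).1 (sm_derive v sf') _ _.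
  + exact: sm_comp_scalar (sm_derive _ _).
  + exact: sm_comp_scalar (sm_derive _ _).
  + exact: (jeq_mxP k (sm_derive v sf) (sm_derive v sf')).1 (jf.2 v) _ _.
  + exact: (IH _ _ sf sf' (sm_derive _ sg) (sm_derive _ sg') (jeq_pred jf) (jg.2 _)).
Qed.

Lemma jeq_comp (V : normedModType R) p m n k (f f' : V -> 'rV[R]_p)
    (g g' : 'rV[R]_p -> 'M[R]_(m, n)) a :
  sm f a -> sm f' a -> sm g (f a) -> sm g' (f a) ->
  jeq k f f' a -> jeq k g g' (f a) ->
  jeq k (fun x => g (f x)) (fun x => g' (f' x)) a.
Proof.
move=> sf sf' sg sg' jf jg; apply/jeq_mxP.
- exact: sm_comp.
- by apply: sm_comp => //; have [<- _] : f a = f' a /\ True; case: (k) jf => [|?] [].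
- move=> i j; apply: (@jeq_comp_scalar _ _ _ f f' (fun y => g y i j) (fun y => g' y i j)) => //.
  + exact: (sm_mxP _ _).1 sg _ _.
  + exact: (sm_mxP _ _).1 sg' _ _.
  + exact: (jeq_mxP k sg sg').1 jg i j.
Qed.

(** Words of directions mediate between the arbitrary directions of [jeq] and the multi-indices of
    [mpartial]: they can be concatenated, permuted and expanded in a basis. *)
Definition dlist (V W : normedModType R) (s : seq V) (f : V -> W) : V -> W :=
  foldr (fun v g => 'D_v g) f s.

Lemma sm_dlist (V W : normedModType R) (s : seq V) (f : V -> W) a :
  sm f a -> sm (dlist s f) a.
Proof. by move=> sf; elim: s => //= v s; exact: sm_derive. Qed.

Lemma dlist_cat (V W : normedModType R) (s t : seq V) (f : V -> W) :
  dlist (s ++ t) f = dlist s (dlist t f).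
Proof. by rewrite /dlist foldr_cat. Qed.

Lemma near_dlist (V W : normedModType R) (s : seq V) (f g : V -> W) (a : V) :
  {near a, f =1 g} -> {near a, dlist s f =1 dlist s g}.
Proof. by move=> fg; elim: s => //= v s; exact: near_derive. Qed.

Lemma near_derive_comm (V : normedModType R) m n (f : V -> 'M[R]_(m, n)) (a v w : V) :
  sm f a -> {near a, 'D_v ('D_w f) =1 'D_w ('D_v f)}.
Proof. by move=> /sm_near; apply: filterS => x; exact: derive_comm. Qed.

Lemma near_trans (T U : Type) (F : set_system T) {FF : Filter F} (f g h : T -> U) :
  {near F, f =1 g} -> {near F, g =1 h} -> {near F, f =1 h}.
Proof. by apply: filterS2 => x ->. Qed.

Lemma dlist_derive (V : normedModType R) m n (s : seq V) (f : V -> 'M[R]_(m, n)) (a v : V) :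
  sm f a -> {near a, dlist s ('D_v f) =1 'D_v (dlist s f)}.
Proof.
move=> sf; elim: s => [|w s IH] /=; first exact: nearW.
apply: near_trans (near_derive w IH) _.
exact/near_derive_comm/sm_dlist.
Qed.

Lemma dlist_comm (V : normedModType R) m n (s t : seq V) (f : V -> 'M[R]_(m, n)) (a : V) :
  sm f a -> {near a, dlist (s ++ t) f =1 dlist (t ++ s) f}.
Proof.
move=> sf; elim: s => [|v s IH] /=; first by rewrite cats0; exact: nearW.
apply: near_trans (near_derive v IH) _.
rewrite !dlist_cat /=; apply: filterS (dlist_derive t v (sm_dlist s sf)) => x.
exact: esym.
Qed.

(** Exchanges of consecutive blocks generate all permutations. Each exchange is proved near [a] and
    not only at [a], so that it can be differentiated further. *)
Lemma dlist_perm (V : normedModType R) m n (s t : seq V) (f : V -> 'M[R]_(m, n)) (a : V) :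
  sm f a -> perm_eq s t -> dlist s f a = dlist t f a.
Proof.
move=> sf st.
pose P u := {near a, dlist s f =1 dlist u f}.
suff : P t by move=> /nbhs_singleton.
apply: (@catCA_perm_ind _ P _ _ _ st); last exact: nearW.
move=> s1 s2 s3 H; apply: near_trans H _.
rewrite !catA ![in dlist (_ ++ s3) _]dlist_cat.
exact/dlist_comm/sm_dlist.
Qed.

Lemma derive_basis n m p (f : 'rV[R]_n -> 'M[R]_(m, p)) a v :
  sm f a -> 'D_v f a = \sum_(i < n) v 0 i *: 'D_(delta_mx 0 i) f a.
Proof.
move=> /sm_differentiable df; rewrite {1}deriveE// diff_rV_sum//.
Qed.

Definition basis n (s : seq 'I_n) : seq 'rV[R]_n := [seq delta_mx 0 i | i <- s].

(** By symmetry the inner derivative D_v can be moved outside the word, where it expands in the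
    basis; words then grow by one basis letter at each order. *)
Lemma jeq_words n m p k (f g : 'rV[R]_n -> 'M[R]_(m, p)) a :
  sm f a -> sm g a ->
  (forall s, (size s <= k)%N -> dlist (basis s) f a = dlist (basis s) g a) ->
  jeq k f g a.
Proof.
elim: k f g => [|k IH] f g sf sg H; split=> //; try exact: (H [::]).
move=> v; apply: IH => [||s sk]; [exact: sm_derive|exact: sm_derive|].
rewrite (nbhs_singleton (dlist_derive _ _ sf)) (nbhs_singleton (dlist_derive _ _ sg)).
rewrite !derive_basis; [|exact: sm_dlist..].
by apply: eq_bigr => i _; congr (_ *: _); exact: (H (i :: s)).
Qed.

Lemma jeq_dlist (V W : normedModType R) k (f g : V -> W) a s :
  jeq k f g a -> (size s <= k)%N -> dlist s f a = dlist s g a.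
Proof.
elim: k f g s => [|k IH] f g s; first by case: s => // -[].
case/lastP: s => [|s v]; first by case.
rewrite size_rcons -cats1 !dlist_cat /= => -[_ H] sk.
exact: IH (H v) sk.
Qed.

Definition mword n lo k (b : mindex n lo k) : seq 'I_n :=
  flatten [seq nseq (val b i) i | i <- enum 'I_n].

Lemma mpartialE n p lo k (b : mindex n lo k) (f : 'rV[R]_n -> 'rV[R]_p) :
  mpartial b f = dlist (basis (mword b)) f.
Proof.
rewrite /mpartial /mword; elim: (enum 'I_n) => //= i s ->.
rewrite /basis map_cat dlist_cat map_nseq; set g := dlist _ f.
by elim: (nat_of_ord (sval b i)) => //= l ->.
Qed.

Lemma count_mword n lo k (b : mindex n lo k) i : count_mem i (mword b) = val b i.
Proof.
rewrite /mword count_flatten -map_comp sumnE big_map.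
rewrite (eq_bigr (fun j => ((j == i) * val b j)%N)) => [|j _]; last first.
  by rewrite /= count_nseq.
rewrite big_enum /= (bigD1 i)//= eqxx mul1n big1 ?addn0// => j /negbTE ->.
by rewrite mul0n.
Qed.

Lemma size_mword n lo k (b : mindex n lo k) : size (mword b) = (\sum_i val b i)%N.
Proof.
rewrite /mword size_flatten /shape -map_comp sumnE big_map big_enum /=.
by apply: eq_bigr => i _; rewrite size_nseq.
Qed.

Lemma mword_perm n k (s : seq 'I_n) : (size s <= k)%N ->
  exists b : mindex n 0 k, perm_eq s (mword b).
Proof.
move=> sk.
have ck i : (count_mem i s < k.+1)%N by rewrite ltnS (leq_trans (count_size _ _)).
pose b : {ffun 'I_n -> 'I_k.+1} := [ffun i => Ordinal (ck i)].
have Hb : (0 <= \sum_i b i <= k)%N.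
  rewrite leq0n /= (leq_trans _ sk)//.
  rewrite (eq_bigr (fun i => count_mem i s)) => [|i _]; last by rewrite ffunE.
  elim: s {sk ck b} => [|x s IH]; first by rewrite big1.
  rewrite /= big_split /= -add1n leq_add//.
  by rewrite (bigD1 x)//= eqxx big1 // => i; rewrite eq_sym => /negbTE ->.
exists (exist _ b Hb); apply/allP => i _ /=.
by rewrite count_mword /= ffunE.
Qed.

(** A multi-index is the sorted word of its letters. Conversely, a word of basis directions is a
    permutation of the word of the multi-index counting its letters. *)
Lemma jeqP n p k (f g : 'rV[R]_n -> 'rV[R]_p) a : sm f a -> sm g a ->
  jeq k f g a <-> forall b : mindex n 0 k, mpartial b f a = mpartial b g a.
Proof.
move=> sf sg; split=> [H b|H].
  rewrite !mpartialE; apply: jeq_dlist H _.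
  by rewrite size_map size_mword; have /andP[_ ->] := svalP b.
apply: jeq_words => // s sk; have [b sb] := mword_perm sk.
rewrite (dlist_perm sf (perm_map _ sb)) (dlist_perm sg (perm_map _ sb)).
by rewrite -!mpartialE.
Qed.

(** Deriving a slice of G amounts to deriving G along vectors (0, v); the result then depends
    smoothly on the parameter x as soon as G is smooth in both variables. *)
Lemma dlist_slice n p m q (s : seq 'rV[R]_p) (G : 'rV[R]_(n + p) -> 'M[R]_(m, q)) x y :
  dlist s (fun y => G (row_mx x y)) y =
  dlist [seq row_mx 0 v | v <- s] G (row_mx x y).
Proof.
elim: s y => //= v s IH y.
rewrite /derive; set F := (fun _ => _); set F' := (fun _ => _).
suff -> : F = F' by [].
apply/funext => h; rewrite /F /F' /=.
by rewrite !IH scale_row_mx scaler0 add_row_mx add0r.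
Qed.

End EuclideanJets.

(** * Smooth maps between charted sets *)

Section Atlases.
Context {R : realType}.

(** The base point of [g] is given up to an equation, since charts cancel only propositionally. *)
Lemma sm_comp_at (V : normedModType R) p m n (f : V -> 'rV[R]_p)
    (g : 'rV[R]_p -> 'M[R]_(m, n)) a b :
  sm f a -> f a = b -> sm g b -> sm (fun x => g (f x)) a.
Proof. by move=> sf <-; exact: sm_comp. Qed.

(* The part of [is_manifold] shared by the charted sets [line], [euclid] and
   [prod_charted]. *)
Class atlas (X : charted R) : Prop := Atlas {
  atlas_cover : forall x : X, exists c, charts c /\ cdom c x;
  atlas_cmapK : forall (c : chart R X (sdim X)) x, charts c -> cdom c x ->
    cinv c (cmap c x) = x;
  atlas_open : forall c : chart R X (sdim X), charts c -> open (cimg c);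
  atlas_compat : forall c d : chart R X (sdim X), charts c -> charts d ->
    open (cmap c @` (cdom c `&` cdom d)) /\
    smooth_on (cmap c @` (cdom c `&` cdom d)) (cmap d \o cinv c) }.

Global Instance manifold_atlas (M : manifold R) : atlas M.
Proof.
have HM := manifoldP M.
split=> [x|c x hc cx|c hc|c d hc hd].
- by exists (chart_at x); exact: (chart_atP HM).
- by apply: (cmapK HM hc); rewrite inE.
- exact: (cimg_open HM hc).
- exact: (chart_compat HM hc hd).
Qed.

Lemma chart_near_dom (X : charted R) (aX : atlas X) (c d : chart R X (sdim X)) x :
  charts c -> charts d -> cdom c x -> cdom d x ->
  \forall v \near cmap c x,
    [/\ cdom c (cinv c v), cdom d (cinv c v) & cmap c (cinv c v) = v].
Proof.
move=> hc hd cx dx; have [oU _] := atlas_compat hc hd.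
apply: (open_near oU); first by exists x.
by move=> _ [y [cy dy] <-]; rewrite atlas_cmapK.
Qed.

Lemma chart_near (X : charted R) (aX : atlas X) (c : chart R X (sdim X)) x :
  charts c -> cdom c x ->
  \forall v \near cmap c x, cdom c (cinv c v) /\ cmap c (cinv c v) = v.
Proof.
move=> hc cx; have := chart_near_dom aX hc hc cx cx.
by apply: filterS => v [].
Qed.

Lemma chart_change_sm (X : charted R) (aX : atlas X) (c d : chart R X (sdim X)) x :
  charts c -> charts d -> cdom c x -> cdom d x ->
  sm (fun v => cmap d (cinv c v)) (cmap c x).
Proof.
move=> hc hd cx dx; have [oU sU] := atlas_compat hc hd.
by apply/smP; eexists; split; [exact: oU|exists x|exact: sU].
Qed.

(** [sopen] refers to all charts, but one chart is enough: the preimage of an open set under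
    [cmap c] is open in any other chart, the change of charts being continuous. *)
Lemma near_ptP (X : charted R) (aX : atlas X) (c : chart R X (sdim X)) x
    (P : X -> Prop) : charts c -> cdom c x ->
  near_pt x P <-> \forall v \near cmap c x, P (cinv c v).
Proof.
move=> hc cx; split.
  move=> [U [oU Ux UP]]; apply: (open_near (oU c hc)); first by exists x.
  by move=> _ [y [Uy cy] <-]; apply: UP; rewrite atlas_cmapK.
move=> /near_open[V [oV Vx VP]].
exists (cdom c `&` (cmap c @^-1` V)); split=> //; last first.
  by move=> y [cy Vy]; rewrite -(atlas_cmapK hc cy); exact: VP.
move=> d hd; rewrite openE => _ [y [[cy Vy] dy] <-]; rewrite /interior.
have N := chart_near_dom aX hd hc dy cy.
have C := sm_continuous (chart_change_sm aX hd hc dy cy).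
have VN : \forall v \near cmap d y, V (cmap c (cinv d v)).
  apply: C; apply: open_nbhs_nbhs; split=> //.
  by rewrite /= atlas_cmapK.
apply: filterS2 N VN => v [dv cv E] Vv.
by exists (cinv d v).
Qed.

Lemma near_pt_self (X : charted R) (x : X) P : near_pt x P -> P x.
Proof. by move=> [U [_ Ux UP]]; exact: UP. Qed.

Lemma near_pt_join (X : charted R) (x : X) P :
  near_pt x P -> near_pt x (fun y => near_pt y P).
Proof. by move=> [U [oU Ux UP]]; exists U; split=> // y Uy; exists U. Qed.

(** As a filter, [near_pt x] supports the same [filterS] reasoning as topological neighbourhoods. *)
Global Instance near_pt_filter (X : charted R) (aX : atlas X) (x : X) :
  ProperFilter (near_pt x).
Proof.
have [c [hc cx]] := atlas_cover x.
split; first by move=> /near_pt_self.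
split.
- by apply/(near_ptP aX _ hc cx); exact: filterS filterT.
- move=> P Q /(near_ptP aX _ hc cx) hP /(near_ptP aX _ hc cx) hQ.
  by apply/(near_ptP aX _ hc cx); apply: filterS2 hP hQ => v; split.
- move=> P Q PQ /(near_ptP aX _ hc cx) hP; apply/(near_ptP aX _ hc cx).
  by apply: filterS hP => v; exact: PQ.
Qed.

Lemma near_ptW (X : charted R) (aX : atlas X) (x : X) (P : X -> Prop) :
  (forall y, P y) -> near_pt x P.
Proof. by move=> H; apply: (@filterS _ (near_pt x) _ setT) => //; exact: filterT. Qed.

Lemma near_chart_dom (X : charted R) (aX : atlas X) (c : chart R X (sdim X)) x :
  charts c -> cdom c x -> near_pt x (cdom c).
Proof.
move=> hc cx; apply/(near_ptP aX _ hc cx).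
by have := chart_near aX hc cx; apply: filterS => v [].
Qed.

(** The charts are existential in [smooth_at]; composing with smooth changes of charts on both sides
    allows any pair of charts around x and f x. *)
Lemma smooth_atP (X Y : charted R) (aX : atlas X) (aY : atlas Y) (f : X -> Y) x
    (c : chart R X (sdim X)) (d : chart R Y (sdim Y)) :
  charts c -> cdom c x -> charts d -> cdom d (f x) ->
  smooth_at f x <->
  near_pt x (fun y => cdom d (f y)) /\
  sm (fun v => cmap d (f (cinv c v))) (cmap c x).
Proof.
move=> hc cx hd dfx; split; last first.
  move=> [/(near_ptP aX _ hc cx) N /smP[U [oU Ux sU]]].
  have : \forall v \near cmap c x, [/\ U v, cdom d (f (cinv c v)) & cimg c v].
    have nU : \forall v \near cmap c x, U v by exact: (open_near oU Ux).
    have nI : \forall v \near cmap c x, cimg c v.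
      by apply: (open_near (atlas_open hc)) => //; exists x.
    by apply: filterS3 nU N nI => v; split.
  move=> /near_open[V [oV Vx HV]].
  exists c, d, V; split=> //.
  - by split=> // v /HV[].
  - by move=> v /HV[].
  - by move=> k; apply: Ck_sub (sU k) => v /HV[].
move=> [c' [d' [U [[hc' c'x] hd' [oU Ux Uimg] Ud' sU]]]].
have s' : sm (fun v => cmap d' (f (cinv c' v))) (cmap c' x).
  by apply/smP; exists U.
have d'fx : cdom d' (f x) by rewrite -(atlas_cmapK hc' c'x); exact: Ud'.
have nUd : \forall v \near cmap c' x, U v by exact: (open_near oU Ux).
have N : \forall v \near cmap c' x, cdom d (f (cinv c' v)).
  have D : \forall w \near cmap d' (f (cinv c' (cmap c' x))), cdom d (cinv d' w).
    rewrite atlas_cmapK//.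
    by have := chart_near_dom aY hd' hd d'fx dfx; apply: filterS => v [].
  have := sm_near_pre s' D; apply: filterS2 nUd => v Uv.
  by rewrite atlas_cmapK//; exact: Ud'.
split; first exact/(near_ptP aX _ hc' c'x).
have s1 := chart_change_sm aX hc hc' cx c'x.
have s2 := chart_change_sm aY hd' hd d'fx dfx.
have E : cmap c' (cinv c (cmap c x)) = cmap c' x by rewrite atlas_cmapK.
have s3 : sm (fun v => cmap d' (f (cinv c' (cmap c' (cinv c v))))) (cmap c x).
  exact: (sm_comp_at s1 E s').
have s4 : sm (fun v => cmap d (cinv d' (cmap d' (f (cinv c' (cmap c' (cinv c v))))))) (cmap c x).
  by apply: (sm_comp_at s3 _ s2); rewrite E atlas_cmapK.
apply: sm_ext s4.
have : \forall v \near cmap c x, U (cmap c' (cinv c v)).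
  have nUE : \forall w \near cmap c' (cinv c (cmap c x)), U w by rewrite E.
  exact: (sm_near_pre s1 nUE).
apply: filterS2 (chart_near_dom aX hc hc' cx c'x) => v [cv c'v _] Uv.
have := Ud' _ Uv; rewrite atlas_cmapK// => d'v.
by rewrite atlas_cmapK.
Qed.

Lemma smooth_at_pre (X Y : charted R) (aX : atlas X) (aY : atlas Y) (f : X -> Y) x P :
  smooth_at f x -> near_pt (f x) P -> near_pt x (fun y => P (f y)).
Proof.
move=> sf; have [c [hc cx]] := atlas_cover x; have [d [hd dx]] := atlas_cover (f x).
move: sf => /(smooth_atP aX aY hc cx hd dx)[N sf].
move=> /(near_ptP aY _ hd dx) H; apply/(near_ptP aX _ hc cx).
have H' : \forall v \near cmap d (f (cinv c (cmap c x))), P (cinv d v).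
  by rewrite atlas_cmapK.
have := sm_near_pre sf H'; move: N => /(near_ptP aX _ hc cx).
by apply: filterS2 => v dv; rewrite atlas_cmapK.
Qed.

Lemma smooth_at_comp (X Y Z : charted R) (aX : atlas X) (aY : atlas Y)
    (aZ : atlas Z) (f : X -> Y) (g : Y -> Z) x :
  smooth_at f x -> smooth_at g (f x) -> smooth_at (fun y => g (f y)) x.
Proof.
move=> sf sg; have [c [hc cx]] := atlas_cover x.
have [d [hd dx]] := atlas_cover (f x); have [e [he ex]] := atlas_cover (g (f x)).
have [N1 s1] := (smooth_atP aX aY hc cx hd dx).1 sf.
have [N2 s2] := (smooth_atP aY aZ hd dx he ex).1 sg.
apply/(smooth_atP aX aZ hc cx he ex); split.
  exact: (smooth_at_pre (P := fun y => cdom e (g y)) aX aY sf N2).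
have s3 : sm (fun v => cmap e (g (cinv d (cmap d (f (cinv c v)))))) (cmap c x).
  by apply: (sm_comp_at s1 _ s2); rewrite atlas_cmapK.
apply: sm_ext s3; move: N1 => /(near_ptP aX _ hc cx).
by apply: filterS => v dv; rewrite atlas_cmapK.
Qed.

Lemma smooth_at_ext (X Y : charted R) (aX : atlas X) (aY : atlas Y) (f g : X -> Y) x :
  near_pt x (fun y => f y = g y) -> smooth_at f x -> smooth_at g x.
Proof.
move=> fg sf; have E := near_pt_self fg.
have [c [hc cx]] := atlas_cover x; have [d [hd dx]] := atlas_cover (f x).
have dx' : cdom d (g x) by rewrite -E.
have [N1 s1] := (smooth_atP aX aY hc cx hd dx).1 sf.
apply/(smooth_atP aX aY hc cx hd dx'); split.
  by apply: filterS2 fg N1 => y ->.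
by apply: sm_ext s1; move: fg => /(near_ptP aX _ hc cx); apply: filterS => v ->.
Qed.

Lemma smooth_at_id (X : charted R) (aX : atlas X) (x : X) : smooth_at id x.
Proof.
have [c [hc cx]] := atlas_cover x; apply/(smooth_atP aX aX hc cx hc cx).
split; first exact: near_chart_dom.
exact: chart_change_sm.
Qed.

Lemma smooth_at_cst (X Y : charted R) (aX : atlas X) (aY : atlas Y) (x : X) (y : Y) :
  smooth_at (fun=> y) x.
Proof.
have [c [hc cx]] := atlas_cover x; have [d [hd dy]] := atlas_cover y.
apply/(smooth_atP aX aY hc cx hd dy); split; last exact: sm_cst.
exact: near_ptW.
Qed.

(** * Model spaces, products and their smooth maps *)

Global Instance euclid_atlas n : atlas (euclid R n).
Proof.
split=> [x|c x|c|c d]; first by eexists; split; [reflexivity|].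
- by move=> ->.
- move=> ->; suff -> : cimg (Chart setT id id : chart R 'rV[R]_n n) = setT by exact: openT.
  by apply/seteqP; split=> // v _; exists v.
- move=> -> ->; split=> /=.
    rewrite (_ : _ @` _ = setT); first exact: openT.
    by apply/seteqP; split=> // v _; exists v.
  by move=> k; apply: (@Ck_sub _ _ _ _ _ setT) => //;
    exact: (Ck_linear k (idfun : {linear 'rV[R]_n -> 'rV[R]_n}) openT).
Qed.

Global Instance line_atlas : atlas (line R).
Proof.
have K (v : 'rV[R]_1) : const_mx (v 0 0) = v.
  by apply/rowP => i; rewrite mxE (ord1 i).
split=> [x|c x|c|c d]; first by eexists; split; [reflexivity|].
- by move=> -> _; rewrite /= mxE.
- move=> ->; rewrite (_ : cimg _ = setT); first exact: openT.
  by apply/seteqP; split=> // v _; exists (v 0 0) => //=; rewrite K.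
- move=> -> ->; split=> /=.
    rewrite (_ : _ @` _ = setT); first exact: openT.
    by apply/seteqP; split=> // v _; exists (v 0 0) => //=; rewrite K.
  rewrite (_ : _ \o _ = id); last by apply/funext => v /=; rewrite K.
  by move=> k; apply: (@Ck_sub _ _ _ _ _ setT) => //;
    exact: (Ck_linear k (idfun : {linear 'rV[R]_1 -> 'rV[R]_1}) openT).
Qed.

Lemma cimg_prod S T n p (c : chart R S n) (d : chart R T p) :
  cimg (prod_chart c d) = lsubmx @^-1` (cimg c) `&` rsubmx @^-1` (cimg d).
Proof.
apply/seteqP; split=> [_ [[x y] [/= cx dy] <-]|v [[x cx E] [y dy E']]].
  by split; rewrite /= ?row_mxKl ?row_mxKr; [exists x|exists y].
by exists (x, y) => //=; rewrite E E' hsubmxK.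
Qed.

Global Instance prod_atlas (X Y : charted R) (aX : atlas X) (aY : atlas Y) :
  atlas (prod_charted X Y).
Proof.
split=> [[x y]|_ [x y] [c [d [hc hd ->]]]|_ [c [d [hc hd ->]]]|].
- have [c [hc cx]] := atlas_cover x; have [d [hd dy]] := atlas_cover y.
  by exists (prod_chart c d); split=> //; exists c, d.
- by move=> [/= cx dy]; rewrite row_mxKl row_mxKr !atlas_cmapK.
- rewrite cimg_prod; apply: openI; apply: open_comp; try exact: atlas_open.
    by move=> v _; exact: continuous_lsubmx.
  by move=> v _; exact: continuous_rsubmx.
move=> _ _ [c [d [hc hd ->]]] [c' [d' [hc' hd' ->]]].
have [oc sc] := atlas_compat hc hc'; have [od sd] := atlas_compat hd hd'.
have E : cmap (prod_chart c d) @`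
    (cdom (prod_chart c d) `&` cdom (prod_chart c' d')) =
    lsubmx @^-1` (cmap c @` (cdom c `&` cdom c')) `&`
    rsubmx @^-1` (cmap d @` (cdom d `&` cdom d')).
  apply/seteqP; split.
    move=> _ [[x y] [[/= cx dy] [/= cx' dy']] <-].
    by split; rewrite /= ?row_mxKl ?row_mxKr; [exists x|exists y].
  move=> v [[x [cx cx'] Ex] [y [dy dy'] Ey]].
  by exists (x, y) => //=; rewrite Ex Ey hsubmxK.
have oP : open (lsubmx @^-1` (cmap c @` (cdom c `&` cdom c')) `&`
    rsubmx @^-1` (cmap d @` (cdom d `&` cdom d'))).
  apply: openI; apply: open_comp => //.
    by move=> v _; exact: continuous_lsubmx.
  by move=> v _; exact: continuous_rsubmx.
rewrite E; split=> // k.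
apply: Ck_pointwise => v [Hl Hr].
have sl : sm (cmap c' \o cinv c) (lsubmx v).
  by apply/smP; eexists; split; [exact: oc|exact: Hl|exact: sc].
have sr : sm (cmap d' \o cinv d) (rsubmx v).
  by apply/smP; eexists; split; [exact: od|exact: Hr|exact: sd].
have sv : sm (cmap (prod_chart c' d') \o cinv (prod_chart c d)) v.
  apply: sm_row_mx.
    exact: (sm_comp_at (sm_lsubmx _) erefl sl).
  exact: (sm_comp_at (sm_rsubmx _) erefl sr).
exact: (nbhs_singleton sv k).
Qed.

Lemma prod_chartP (X Y : charted R) c d : charts c -> charts d ->
  @charts R (prod_charted X Y) (prod_chart c d).
Proof. by move=> hc hd; exists c, d. Qed.

Lemma smooth_at_fst (X Y : charted R) (aX : atlas X) (aY : atlas Y) (z : X * Y) :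
  @smooth_at R (prod_charted X Y) X fst z.
Proof.
have [c [hc cx]] := atlas_cover z.1; have [d [hd dy]] := atlas_cover z.2.
have cz : @cdom R (prod_charted X Y) _ (prod_chart c d) z by [].
have hcd := prod_chartP hc hd.
apply/(smooth_atP _ _ hcd cz hc cx); split.
  by apply: filterS (near_chart_dom _ hcd cz) => y [].
have s : sm (fun v : 'rV[R]_(sdim X + sdim Y) => cmap c (cinv c (lsubmx v)))
    (cmap (prod_chart c d) z).
  apply: (sm_comp_at (sm_lsubmx _) _ (chart_change_sm aX hc hc cx cx)).
  by rewrite /= row_mxKl.
exact: s.
Qed.

Lemma smooth_at_snd (X Y : charted R) (aX : atlas X) (aY : atlas Y) (z : X * Y) :
  @smooth_at R (prod_charted X Y) Y snd z.
Proof.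
have [c [hc cx]] := atlas_cover z.1; have [d [hd dy]] := atlas_cover z.2.
have cz : @cdom R (prod_charted X Y) _ (prod_chart c d) z by [].
have hcd := prod_chartP hc hd.
apply/(smooth_atP _ _ hcd cz hd dy); split.
  by apply: filterS (near_chart_dom _ hcd cz) => y [].
have s : sm (fun v : 'rV[R]_(sdim X + sdim Y) => cmap d (cinv d (rsubmx v)))
    (cmap (prod_chart c d) z).
  apply: (sm_comp_at (sm_rsubmx _) _ (chart_change_sm aY hd hd dy dy)).
  by rewrite /= row_mxKr.
exact: s.
Qed.

Lemma smooth_at_pair (X Y Z : charted R) (aX : atlas X) (aY : atlas Y)
    (aZ : atlas Z) (f : X -> Y) (g : X -> Z) x :
  smooth_at f x -> smooth_at g x ->
  @smooth_at R X (prod_charted Y Z) (fun x => (f x, g x)) x.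
Proof.
move=> sf sg; have [c [hc cx]] := atlas_cover x.
have [d [hd dx]] := atlas_cover (f x); have [e [he ex]] := atlas_cover (g x).
have [N1 s1] := (smooth_atP aX aY hc cx hd dx).1 sf.
have [N2 s2] := (smooth_atP aX aZ hc cx he ex).1 sg.
have cz : @cdom R (prod_charted Y Z) _ (prod_chart d e) (f x, g x) by [].
apply/(smooth_atP _ _ hc cx (prod_chartP hd he) cz); split.
  by apply: filterS2 N1 N2 => y.
exact: sm_row_mx.
Qed.

Definition eucl_chart n : chart R (euclid R n) (sdim (euclid R n)) :=
  Chart setT id id.

Definition line_chart : chart R (line R) (sdim (line R)) :=
  Chart setT (fun t => const_mx t) (fun v => v 0 0).

Lemma smooth_at_cmap (X : charted R) (aX : atlas X) (c : chart R X (sdim X)) x :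
  charts c -> cdom c x -> @smooth_at R X (euclid R (sdim X)) (cmap c) x.
Proof.
move=> hc cx.
apply/(@smooth_atP X (euclid R _) _ _ _ _ c (eucl_chart _)) => //.
split; first exact: near_ptW.
exact: chart_change_sm.
Qed.

Lemma smooth_at_cinv (X : charted R) (aX : atlas X) (c : chart R X (sdim X)) v :
  charts c -> cimg c v -> @smooth_at R (euclid R (sdim X)) X (cinv c) v.
Proof.
move=> hc [x cx <-].
have dx : cdom c (cinv c (cmap c x)) by rewrite atlas_cmapK.
apply/(@smooth_atP (euclid R _) X _ _ _ _ (eucl_chart _) c) => //; split.
  apply/(@near_ptP (euclid R _) _ (eucl_chart _)) => //=.
  by have := chart_near aX hc cx; apply: filterS => w [].
exact: chart_change_sm.
Qed.

Lemma smooth_at_euclid n p (f : euclid R n -> euclid R p) a :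
  smooth_at f a <-> sm f a.
Proof.
have P := @smooth_atP _ _ _ _ f a (eucl_chart n) (eucl_chart p) erefl I erefl I.
split; first by move=> /P[].
by move=> sf; apply/P; split=> //; exact: near_ptW.
Qed.

Lemma near_pt_euclid n (a : euclid R n) P :
  near_pt a P <-> \forall y \near (a : 'rV[R]_n), P y.
Proof. exact: (@near_ptP (euclid R n) _ (eucl_chart n)). Qed.

Lemma near_const_mx (t : R) (P : R -> Prop) :
  nbhs (const_mx t : 'rV[R]_1) [set v : 'rV[R]_1 | P (v 0 0)] <-> \forall s \near t, P s.
Proof.
split=> H.
  have c : (const_mx s : 'rV[R]_1) @[s --> t] --> (const_mx t : 'rV[R]_1).
    apply/cvgrPdist_lt => e e0; near=> s.
    rewrite /Num.Def.normr/= mx_normrE; apply/bigmax_ltP; split=> // i _.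
    by rewrite !mxE; near: s; exact: cvgr_dist_lt.
  have {}H : \forall s \near t, P ((const_mx s : 'rV[R]_1) 0 0) by exact: c _ H.
  by apply: filterS H => s; rewrite mxE.
have c : (v : 'rV[R]_1) 0 0 @[v --> (const_mx t : 'rV[R]_1)] --> (const_mx t : 'rV[R]_1) 0 0.
  exact: coord_continuous.
by apply: c; rewrite mxE.
Unshelve. all: by end_near. Qed.

Lemma near_pt_line (t : line R) P : near_pt t P <-> \forall s \near (t : R), P s.
Proof.
apply: iff_trans (near_const_mx t P).
exact: (@near_ptP (line R) _ line_chart).
Qed.

End Atlases.

(** * Jets *)

Section Jets.
Context {R : realType}.

Lemma jet_eq_refl (X Y : charted R) k (x : X) (f : X -> Y) : jet_eq k x f f.
Proof. by split. Qed.

Lemma jet_eq_sym (X Y : charted R) k (x : X) (f g : X -> Y) :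
  jet_eq k x f g -> jet_eq k x g f.
Proof.
by move=> [E H]; split=> // b c hb bx hc cx i; rewrite H// E.
Qed.

Lemma jet_eq_trans (X Y : charted R) k (x : X) (f g l : X -> Y) :
  jet_eq k x f g -> jet_eq k x g l -> jet_eq k x f l.
Proof.
move=> [E H] [E' H']; split=> [|b c hb bx hc cx i]; first by rewrite E.
by rewrite H// H'// -E.
Qed.

Lemma jet_eq_near (X Y : charted R) (aX : atlas X) k (x : X) (f g : X -> Y) :
  near_pt x (fun y => f y = g y) -> jet_eq k x f g.
Proof.
move=> fg; split=> [|b c hb bx hc cx i]; first exact: near_pt_self fg.
rewrite !mpartialE.
suff N : {near cmap b x, cmap c \o f \o cinv b =1 cmap c \o g \o cinv b}.
  exact: (nbhs_singleton (near_dlist (basis (mword i)) N)).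
by move: fg => /(near_ptP aX _ hb bx); apply: filterS => v /= ->.
Qed.

(** One pair of charts decides for all of them: changes of charts on both sides preserve equality of
    jets, by the chain rule [jeq_comp]. *)
Lemma jet_eqP (X Y : charted R) (aX : atlas X) (aY : atlas Y) k (x : X)
    (f g : X -> Y) b c :
  smooth_at f x -> smooth_at g x ->
  charts b -> cdom b x -> charts c -> cdom c (f x) ->
  jet_eq k x f g <-> f x = g x /\
    jeq k (fun v => cmap c (f (cinv b v))) (fun v => cmap c (g (cinv b v))) (cmap b x).
Proof.
move=> sf sg hb bx hc cfx; split=> [[E H]|[E H]]; (split=> //; have cgx : cdom c (g x) by rewrite -E).
  have [_ s1] := (smooth_atP aX aY hb bx hc cfx).1 sf.
  have [_ s2] := (smooth_atP aX aY hb bx hc cgx).1 sg.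
  by apply/(jeqP _ s1 s2) => i; exact: H.
move=> b' c' hb' b'x hc' c'fx; have c'gx : cdom c' (g x) by rewrite -E.
have [_ s1] := (smooth_atP aX aY hb' b'x hc' c'fx).1 sf.
have [_ s2] := (smooth_atP aX aY hb' b'x hc' c'gx).1 sg.
apply: (jeqP k s1 s2).1.
have [N1 t1] := (smooth_atP aX aY hb bx hc cfx).1 sf.
have [N2 t2] := (smooth_atP aX aY hb bx hc cgx).1 sg.
have sb := chart_change_sm aX hb' hb b'x bx.
have sc := chart_change_sm aY hc hc' cfx c'fx.
have Eb : cmap b (cinv b' (cmap b' x)) = cmap b x by rewrite atlas_cmapK.
have N (l : X -> Y) : near_pt x (fun y => cdom c (l y)) ->
    {near cmap b' x, (fun v => cmap c' (cinv c (cmap c (l (cinv b (cmap b (cinv b' v)))))))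
       =1 (fun v => cmap c' (l (cinv b' v)))}.
  move=> /(near_ptP aX _ hb' b'x).
  apply: filterS2 (chart_near_dom aX hb' hb b'x bx) => v [_ bv _] cv.
  by rewrite (atlas_cmapK hb bv) atlas_cmapK.
have jf : jeq k (fun v => cmap c (f (cinv b (cmap b (cinv b' v)))))
                (fun v => cmap c (g (cinv b (cmap b (cinv b' v))))) (cmap b' x).
  have t1' : sm (fun v => cmap c (f (cinv b v))) (cmap b (cinv b' (cmap b' x))).
    by rewrite Eb.
  have t2' : sm (fun v => cmap c (g (cinv b v))) (cmap b (cinv b' (cmap b' x))).
    by rewrite Eb.
  have H' : jeq k (fun v => cmap c (f (cinv b v))) (fun v => cmap c (g (cinv b v)))
      (cmap b (cinv b' (cmap b' x))) by rewrite Eb.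
  exact: (jeq_comp sb sb t1' t2' (jeq_refl _ _ _) H').
have u1 : sm (fun v => cmap c (f (cinv b (cmap b (cinv b' v))))) (cmap b' x).
  exact: (sm_comp_at sb Eb t1).
have u2 : sm (fun v => cmap c (g (cinv b (cmap b (cinv b' v))))) (cmap b' x).
  exact: (sm_comp_at sb Eb t2).
apply: jeq_trans (jeq_sym (jeq_near k (N f N1))) _.
apply: jeq_trans (jeq_near k (N g N2)).
have Ef : cmap c (f (cinv b (cmap b (cinv b' (cmap b' x))))) = cmap c (f x).
  by rewrite Eb atlas_cmapK.
have sc' : sm (fun v => cmap c' (cinv c v))
    (cmap c (f (cinv b (cmap b (cinv b' (cmap b' x)))))) by rewrite Ef.
exact: (jeq_comp u1 u2 sc' sc' jf (jeq_refl _ _ _)).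
Qed.

Lemma jet_eq_le (X Y : charted R) (aX : atlas X) (aY : atlas Y) k l (x : X)
    (f g : X -> Y) : smooth_at f x -> smooth_at g x ->
  (l <= k)%N -> jet_eq k x f g -> jet_eq l x f g.
Proof.
move=> sf sg lk; have [b [hb bx]] := atlas_cover x.
have [c [hc cx]] := atlas_cover (f x).
move=> /(jet_eqP aX aY k sf sg hb bx hc cx)[E H].
by apply/(jet_eqP aX aY l sf sg hb bx hc cx); split=> //; exact: jeq_le H.
Qed.

Lemma jet_eq_comp (X Y Z : charted R) (aX : atlas X) (aY : atlas Y)
    (aZ : atlas Z) k (x : X) (f f' : X -> Y) (g g' : Y -> Z) :
  smooth_at f x -> smooth_at f' x -> smooth_at g (f x) -> smooth_at g' (f x) ->
  jet_eq k x f f' -> jet_eq k (f x) g g' ->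
  jet_eq k x (fun y => g (f y)) (fun y => g' (f' y)).
Proof.
move=> sf sf' sg sg' jf jg; have E : f x = f' x by case: jf.
have [b [hb bx]] := atlas_cover x; have [c [hc cx]] := atlas_cover (f x).
have [d [hd dx]] := atlas_cover (g (f x)).
have E' : g (f x) = g' (f x) by case: jg.
have sgf := smooth_at_comp aX aY aZ sf sg.
have sg'' := sg'; rewrite E in sg''.
have sg'f' := smooth_at_comp aX aY aZ sf' sg''.
apply/(jet_eqP aX aZ k sgf sg'f' hb bx hd dx); split; first by rewrite -E.
have [_ jf'] := (jet_eqP aX aY k sf sf' hb bx hc cx).1 jf.
have [_ jg'] := (jet_eqP aY aZ k sg sg' hc cx hd dx).1 jg.
have dx' : cdom d (g' (f x)) by rewrite -E'.
have cx' : cdom c (f' x) by rewrite -E.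
have [N1 s1] := (smooth_atP aX aY hb bx hc cx).1 sf.
have [N2 s2] := (smooth_atP aX aY hb bx hc cx').1 sf'.
have [_ s3] := (smooth_atP aY aZ hc cx hd dx).1 sg.
have [_ s4] := (smooth_atP aY aZ hc cx hd dx').1 sg'.
have N (l : X -> Y) (l' : Y -> Z) : near_pt x (fun y => cdom c (l y)) ->
   {near cmap b x, (fun v => cmap d (l' (cinv c (cmap c (l (cinv b v))))))
     =1 (fun v => cmap d (l' (l (cinv b v))))}.
  by move=> /(near_ptP aX _ hb bx); apply: filterS => v cv; rewrite atlas_cmapK.
apply: jeq_trans (jeq_sym (jeq_near k (N f g N1))) _.
apply: jeq_trans (jeq_near k (N f' g' N2)).
have Eb : cmap c (f (cinv b (cmap b x))) = cmap c (f x) by rewrite atlas_cmapK.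
have s3' : sm (fun v => cmap d (g (cinv c v))) (cmap c (f (cinv b (cmap b x)))).
  by rewrite Eb.
have s4' : sm (fun v => cmap d (g' (cinv c v))) (cmap c (f (cinv b (cmap b x)))).
  by rewrite Eb.
have jg'' : jeq k (fun v => cmap d (g (cinv c v))) (fun v => cmap d (g' (cinv c v)))
    (cmap c (f (cinv b (cmap b x)))) by rewrite Eb.
exact: (jeq_comp s1 s2 s3' s4' jf' jg'').
Qed.

Lemma jet_eq_pair (X Y Z : charted R) (aX : atlas X) (aY : atlas Y)
    (aZ : atlas Z) k (x : X) (f f' : X -> Y) (g g' : X -> Z) :
  smooth_at f x -> smooth_at f' x -> smooth_at g x -> smooth_at g' x ->
  jet_eq k x f f' -> jet_eq k x g g' ->
  @jet_eq R X (prod_charted Y Z) k x (fun y => (f y, g y)) (fun y => (f' y, g' y)).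
Proof.
move=> sf sf' sg sg' jf jg.
have E : f x = f' x by case: jf.
have E' : g x = g' x by case: jg.
have [b [hb bx]] := atlas_cover x; have [c [hc cx]] := atlas_cover (f x).
have [d [hd dx]] := atlas_cover (g x).
have [_ jf'] := (jet_eqP aX aY k sf sf' hb bx hc cx).1 jf.
have [_ jg'] := (jet_eqP aX aZ k sg sg' hb bx hd dx).1 jg.
have sfg := smooth_at_pair aX aY aZ sf sg.
have sfg' := smooth_at_pair aX aY aZ sf' sg'.
have dx' : cdom d (g' x) by rewrite -E'.
have cx' : cdom c (f' x) by rewrite -E.
have [_ s1] := (smooth_atP aX aY hb bx hc cx).1 sf.
have [_ s2] := (smooth_atP aX aY hb bx hc cx').1 sf'.
have [_ s3] := (smooth_atP aX aZ hb bx hd dx).1 sg.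
have [_ s4] := (smooth_atP aX aZ hb bx hd dx').1 sg'.
have cdx : @cdom R (prod_charted Y Z) _ (prod_chart c d) (f x, g x) by [].
apply/(jet_eqP aX (prod_atlas aY aZ) k sfg sfg' hb bx (prod_chartP hc hd) cdx).
split; first by rewrite E E'.
apply/(jeq_mxP k (sm_row_mx s1 s3) (sm_row_mx s2 s4)) => i j.
rewrite -(splitK j); case: (fintype.split j) => j' /=.
  have := (jeq_mxP k s1 s2).1 jf' i j'; congr jeq; apply/funext => v.
    by rewrite row_mxEl.
  by rewrite row_mxEl.
have := (jeq_mxP k s3 s4).1 jg' i j'; congr jeq; apply/funext => v.
  by rewrite row_mxEr.
by rewrite row_mxEr.
Qed.

Lemma jet_eq_comp2 (X Y Z T : charted R) (aX : atlas X) (aY : atlas Y)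
    (aZ : atlas Z) (aT : atlas T) k (x : X) (f f' : X -> Y) (g g' : X -> Z)
    (op : Y -> Z -> T) :
  @smooth R (prod_charted Y Z) T (fun z => op z.1 z.2) ->
  smooth_at f x -> smooth_at f' x -> smooth_at g x -> smooth_at g' x ->
  jet_eq k x f f' -> jet_eq k x g g' ->
  jet_eq k x (fun y => op (f y) (g y)) (fun y => op (f' y) (g' y)).
Proof.
move=> sop sf sf' sg sg' jf jg.
have sp := smooth_at_pair aX aY aZ sf sg.
have sp' := smooth_at_pair aX aY aZ sf' sg'.
have := @jet_eq_comp _ _ _ aX (prod_atlas aY aZ) aT k x _ _
  (fun z => op z.1 z.2) (fun z => op z.1 z.2) sp sp' (sop _) (sop _)
  (jet_eq_pair aX aY aZ sf sf' sg sg' jf jg) (jet_eq_refl _ _ _).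
by [].
Qed.

Lemma smooth_at_comp2 (X Y Z T : charted R) (aX : atlas X) (aY : atlas Y)
    (aZ : atlas Z) (aT : atlas T) (x : X) (f : X -> Y) (g : X -> Z)
    (op : Y -> Z -> T) :
  @smooth_at R (prod_charted Y Z) T (fun z => op z.1 z.2) (f x, g x) ->
  smooth_at f x -> smooth_at g x -> smooth_at (fun y => op (f y) (g y)) x.
Proof.
move=> sop sf sg.
exact: (@smooth_at_comp _ _ _ _ aX (prod_atlas aY aZ) aT (fun y => (f y, g y))
  (fun z => op z.1 z.2) x (smooth_at_pair aX aY aZ sf sg) sop).
Qed.

Lemma jet_inj (X Y : charted R) k (x : X) (f g : X -> Y) :
  smooth_at g x -> jet k x f = jet k x g -> jet_eq k x f g.
Proof.
move=> sg E; suff : jet k x f g by case.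
by rewrite E; split=> //; exact: jet_eq_refl.
Qed.

Lemma jet_congr (X Y : charted R) k (x : X) (f g : X -> Y) :
  jet_eq k x f g -> jet k x f = jet k x g.
Proof.
move=> fg; apply/seteqP; split=> l [sl jl]; split=> //.
  exact: jet_eq_trans (jet_eq_sym fg) jl.
exact: jet_eq_trans fg jl.
Qed.

Lemma local_inverse_smooth (X Y : charted R) (f : X -> Y) x g :
  local_inverse f x g -> smooth_at g (f x).
Proof. by case. Qed.

Lemma local_inverse_at (X Y : charted R) (f : X -> Y) x g :
  local_inverse f x g -> g (f x) = x.
Proof. by case=> _ /near_pt_self. Qed.

Lemma local_inverse_comp (X Y Z : charted R) (aX : atlas X) (aY : atlas Y)
    (aZ : atlas Z) (f : X -> Y) (g : Y -> Z) x fV gV :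
  smooth_at f x -> local_inverse f x fV -> local_inverse g (f x) gV ->
  local_inverse (g \o f) x (fV \o gV).
Proof.
move=> sf [sfV fVf ffV] [sgV gVg ggV].
have gVfx : gV (g (f x)) = f x by exact: near_pt_self gVg.
have sfV' : smooth_at fV (gV (g (f x))) by rewrite gVfx.
split.
- exact: (smooth_at_comp aZ aY aX sgV sfV').
- by apply: filterS2 fVf (smooth_at_pre aX aY sf gVg) => y E E' /=; rewrite E'.
- have ffV' : near_pt (gV (g (f x))) (fun y => f (fV y) = y) by rewrite gVfx.
  by apply: filterS2 ggV (smooth_at_pre aZ aY sgV ffV') => z E E' /=; rewrite E'.
Qed.

Lemma local_diffeo_comp (X Y Z : charted R) (aX : atlas X) (aY : atlas Y)
    (aZ : atlas Z) (f : X -> Y) (g : Y -> Z) x :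
  local_diffeo_at f x -> local_diffeo_at g (f x) -> local_diffeo_at (g \o f) x.
Proof.
move=> [sf [fV lf]] [sg [gV lg]]; split; first exact: (smooth_at_comp aX aY aZ sf sg).
by exists (fV \o gV); exact: local_inverse_comp.
Qed.

Lemma local_inverse_sym (X Y : charted R) (f : X -> Y) x g :
  smooth_at f x -> local_inverse f x g -> local_inverse g (f x) f.
Proof.
move=> sf l; have E := local_inverse_at l; case: l => sg gf fg.
by split; rewrite ?E.
Qed.

(** Near f x one has g = g \o f' \o g' and g' = g \o f \o g', and the right-hand sides have the same
    jet because f and f' do. *)
Lemma jet_eq_inverse (X Y : charted R) (aX : atlas X) (aY : atlas Y) k x
    (f f' : X -> Y) g g' :
  smooth_at f x -> smooth_at f' x -> local_inverse f x g -> local_inverse f' x g' ->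
  jet_eq k x f f' -> jet_eq k (f x) g g'.
Proof.
move=> sf sf' lg lg' jf; have E : f x = f' x by case: jf.
have gfx := local_inverse_at lg; have gfx' := local_inverse_at lg'.
case: lg => sg gf fg; case: lg' => sg' gf' fg'.
have sg'' : smooth_at g' (f x) by rewrite E.
have g'fx : g' (f x) = x by rewrite E.
have s1 : smooth_at f' (g' (f x)) by rewrite g'fx.
have s2 : smooth_at f (g' (f x)) by rewrite g'fx.
have j1 : jet_eq k (f x) (fun y => f' (g' y)) (fun y => f (g' y)).
  apply: (jet_eq_comp aY aX aY sg'' sg'' s1 s2 (jet_eq_refl _ _ _)).
  by rewrite g'fx; exact: jet_eq_sym.
have s3 := smooth_at_comp aY aX aY sg'' s1.
have s4 := smooth_at_comp aY aX aY sg'' s2.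
have f'g'fx : f' (g' (f x)) = f x by rewrite g'fx.
have s5 : smooth_at g (f' (g' (f x))) by rewrite f'g'fx.
have j2 : jet_eq k (f x) (fun y => g (f' (g' y))) (fun y => g (f (g' y))).
  exact: (jet_eq_comp aY aY aX s3 s4 s5 s5 j1 (jet_eq_refl _ _ _)).
apply: jet_eq_trans (jet_eq_trans _ j2) _; apply: jet_eq_near.
  by rewrite E; apply: filterS fg' => y ->.
have gf'' : near_pt (g' (f x)) (fun y => g (f y) = y) by rewrite g'fx.
exact: (smooth_at_pre aY aX sg'' gf'').
Qed.

End Jets.

(** * Principal bundles *)

Arguments smooth_at_pre {R X Y aX aY f x P}.
Arguments smooth_at_comp {R X Y Z aX aY aZ f g x}.
Arguments smooth_at_ext {R X Y aX aY f g x}.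
Arguments smooth_at_id {R X aX x}.
Arguments smooth_at_cst {R X Y aX aY x y}.
Arguments smooth_at_fst {R X Y aX aY z}.
Arguments smooth_at_snd {R X Y aX aY z}.
Arguments smooth_at_pair {R X Y Z aX aY aZ f g x}.
Arguments smooth_at_comp2 {R X Y Z T aX aY aZ aT x f g op}.
Arguments near_ptP {R X aX c x P}.
Arguments near_ptW {R X aX x P}.
Arguments smooth_atP {R X Y aX aY f x c d}.
Arguments chart_change_sm {R X aX c d x}.
Arguments chart_near_dom {R X aX c d x}.
Arguments chart_near {R X aX c x}.
Arguments near_chart_dom {R X aX c x}.
Arguments smooth_at_cmap {R X aX c x}.
Arguments smooth_at_cinv {R X aX c v}.
Arguments jet_eq_refl {R X Y k x f}.
Arguments jet_eq_near {R X Y aX k x f g}.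
Arguments jet_eqP {R X Y aX aY k x f g b c}.
Arguments jet_eq_le {R X Y aX aY k l x f g}.
Arguments jet_eq_comp {R X Y Z aX aY aZ k x f f' g g'}.
Arguments jet_eq_comp2 {R X Y Z T aX aY aZ aT k x f f' g g' op}.
Arguments local_inverse_comp {R X Y Z aX aY aZ f g x fV gV}.
Arguments local_diffeo_comp {R X Y Z aX aY aZ f g x}.
Arguments jet_eq_inverse {R X Y aX aY k x f f' g g'}.

(* Unlike [have], resolves the [atlas] instances left implicit in [t]. *)
Tactic Notation "note" simple_intropattern(p) ":=" constr(t) := pose proof t as p.

Section Bundles.
Context {R : realType}.

Section Groups.
Variable H : lie_group R.
Implicit Types a b : H.

Lemma gmul_inj a : injective (gmul a).
Proof. by move=> b c E; rewrite -(gmul1 b) -(gmul1 c) -(gmulV a) -!gmulA E. Qed.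

Lemma gmulg1 a : gmul a (gone H) = a.
Proof. by apply: (@gmul_inj (ginv a)); rewrite gmulA gmulV gmul1. Qed.

Lemma gmulgV a : gmul a (ginv a) = gone H.
Proof. by apply: (@gmul_inj (ginv a)); rewrite gmulA gmulV gmul1 gmulg1. Qed.

Lemma gmulVK a b : gmul (ginv a) (gmul a b) = b.
Proof. by rewrite gmulA gmulV gmul1. Qed.

Lemma gmulKV a b : gmul a (gmul (ginv a) b) = b.
Proof. by rewrite gmulA gmulgV gmul1. Qed.

Lemma ginv_uniq a b : gmul a b = gone H -> b = ginv a.
Proof. by move=> E; rewrite -(gmulVK a b) E gmulg1. Qed.

Lemma ginvK a : ginv (ginv a) = a.
Proof. by apply/esym/ginv_uniq; exact: gmulV. Qed.

Lemma smooth_at_gmul (X : charted R) {aX : atlas X} (f g : X -> H) x :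
  smooth_at f x -> smooth_at g x -> smooth_at (fun y => gmul (f y) (g y)) x.
Proof. by move=> sf sg; apply: smooth_at_comp2 => //; exact: (@gmul_smooth R H). Qed.

Lemma smooth_at_ginv (X : charted R) {aX : atlas X} (f : X -> H) x :
  smooth_at f x -> smooth_at (fun y => ginv (f y)) x.
Proof.
move=> sf.
exact: (@smooth_at_comp _ _ _ _ _ _ _ f (@ginv R H) x sf (@ginv_smooth R H _)).
Qed.

End Groups.

Section Principal.
Variables (M : manifold R) (H : lie_group R) (Q : principal_bundle M H).
Implicit Types (u v : Q) (a b : H).

(** An equivariant function to H turns division in a fibre into division in the group: if v = u.a,
    then a = psi(u)^-1 psi(v). This gives freeness, and later the smoothness and the jets of
    quotients. *)
Lemma local_psi (x : M) : exists psi : Q -> H, near_pt x (fun y => forall u,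
  bproj Q u = y -> smooth_at psi u /\
    forall a, psi (bact Q u a) = gmul (psi u) a).
Proof.
have [U [tau [psi [[oU Ux] H1 H2 H3 H4]]]] := local_triviality Q x.
exists psi, U; split=> // y Uy u uy.
have Uu : U (bproj Q u) by rewrite uy.
have [s E] := H3 u Uu; split=> // a.
by rewrite -{1}E -H2// H4.
Qed.

Lemma local_section (x : M) : exists sigma : M -> Q, near_pt x (fun y =>
  smooth_at sigma y /\ bproj Q (sigma y) = y).
Proof.
have [U [tau [psi [[oU Ux] H1 H2 H3 H4]]]] := local_triviality Q x.
exists (fun y => tau (y, gone H)), U; split=> // y Uy.
have [s E] := H1 y (gone H) Uy; split=> //.
have sp : @smooth_at R M (prod_charted M H) (fun y => (y, gone H)) y.
  by apply: smooth_at_pair; [exact: smooth_at_id|exact: smooth_at_cst].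
exact: (smooth_at_comp sp s).
Qed.

Lemma bproj_surj (x : M) : exists u, bproj Q u = x.
Proof. by have [s /near_pt_self[_ E]] := local_section x; exists (s x). Qed.

Lemma bact_free u a b : bact Q u a = bact Q u b -> a = b.
Proof.
have [psi /near_pt_self/(_ u erefl)[_ E]] := local_psi (bproj Q u).
by move=> /(congr1 psi); rewrite !E => /gmul_inj.
Qed.

Lemma bact_trans u v : bproj Q u = bproj Q v -> exists a, bact Q u a = v.
Proof.
move=> E; have [U [tau [psi [[oU Ux] H1 H2 H3 H4]]]] := local_triviality Q (bproj Q u).
have [_ Eu] := H3 u Ux.
have [_ Ev] : smooth_at psi v /\ tau (bproj Q v, psi v) = v by apply: H3; rewrite -E.
exists (gmul (ginv (psi u)) (psi v)).
by rewrite -{1}Eu -H2// gmulKV E Ev.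
Qed.

Lemma bactK u a : bact Q (bact Q u a) (ginv a) = u.
Proof. by rewrite -bactM gmulgV bact1. Qed.

Lemma smooth_at_bact (X : charted R) {aX : atlas X} (f : X -> Q) (g : X -> H) x :
  smooth_at f x -> smooth_at g x -> smooth_at (fun y => bact Q (f y) (g y)) x.
Proof. by move=> sf sg; apply: smooth_at_comp2 => //; exact: (@bact_smooth R M H Q). Qed.

Lemma smooth_bactr a : @smooth R Q Q (fun u => bact Q u a).
Proof.
by move=> u; apply: smooth_at_bact; [exact: smooth_at_id|exact: smooth_at_cst].
Qed.

Lemma smooth_at_bproj (X : charted R) {aX : atlas X} (f : X -> Q) x :
  smooth_at f x -> smooth_at (fun y => bproj Q (f y)) x.
Proof.
move=> sf.
exact: (@smooth_at_comp _ _ _ _ _ _ _ f (bproj Q) x sf (@bproj_smooth R M H Q _)).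
Qed.

Lemma near_psi (X : charted R) {aX : atlas X} (f : X -> Q) x :
  smooth_at f x -> exists psi : Q -> H,
    near_pt x (fun y => forall u, bproj Q u = bproj Q (f y) -> smooth_at psi u /\
      forall a, psi (bact Q u a) = gmul (psi u) a).
Proof.
move=> sf; have [psi N] := local_psi (bproj Q (f x)); exists psi.
exact: (smooth_at_pre (smooth_at_bproj sf) N).
Qed.

(** Locally [a] equals psi(f)^-1 psi(g) for the equivariant function psi of [local_psi]. *)
Lemma smooth_division (X : charted R) {aX : atlas X} (f g : X -> Q) (a : X -> H) x :
  smooth_at f x -> smooth_at g x -> near_pt x (fun y => bact Q (f y) (a y) = g y) ->
  smooth_at a x.
Proof.
move=> sf sg N; have [psi Np] := near_psi sf.
have E : near_pt x (fun y => gmul (ginv (psi (f y))) (psi (g y)) = a y).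
  apply: filterS2 N Np => y <- /(_ _ erefl)[_ ->].
  by rewrite gmulVK.
have [spf _] := near_pt_self Np _ erefl.
have [spg _] : smooth_at psi (g x) /\ forall a, psi (bact Q (g x) a) = gmul (psi (g x)) a.
  by apply: (near_pt_self Np); rewrite -(near_pt_self N) bproj_act.
apply: (smooth_at_ext E); apply: smooth_at_gmul.
  exact/smooth_at_ginv/(smooth_at_comp sf spf).
exact: (smooth_at_comp sg spg).
Qed.

(** The formula psi(f)^-1 psi(g) expresses both quotients with the same psi, so their jets agree by
    the chain rule. *)
Lemma jet_eq_division (X : charted R) {aX : atlas X} k (f f' g g' : X -> Q)
    (a a' : X -> H) x :
  smooth_at f x -> smooth_at f' x -> smooth_at g x -> smooth_at g' x ->
  near_pt x (fun y => bact Q (f y) (a y) = g y) ->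
  near_pt x (fun y => bact Q (f' y) (a' y) = g' y) ->
  jet_eq k x f f' -> jet_eq k x g g' -> jet_eq k x a a'.
Proof.
move=> sf sf' sg sg' N N' jf jg; have [psi Np] := local_psi (bproj Q (f x)).
have Ef : f x = f' x by case: jf.
note Nf := (smooth_at_pre (smooth_at_bproj sf) Np).
have Nf' : near_pt x (fun y => forall u, bproj Q u = bproj Q (f' y) ->
    smooth_at psi u /\ forall a, psi (bact Q u a) = gmul (psi u) a).
  by rewrite Ef in Np; exact: (smooth_at_pre (smooth_at_bproj sf') Np).
have spf := (near_pt_self Nf _ erefl).1.
have spf' := (near_pt_self Nf' _ erefl).1.
have spg : smooth_at psi (g x).
  by apply: (near_pt_self Nf _ _).1; rewrite -(near_pt_self N) bproj_act.
have spg' : smooth_at psi (g' x) by case: jg => <-.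
have E : near_pt x (fun y => gmul (ginv (psi (f y))) (psi (g y)) = a y).
  by apply: filterS2 N Nf => y <- /(_ _ erefl)[_ ->]; rewrite gmulVK.
have E' : near_pt x (fun y => gmul (ginv (psi (f' y))) (psi (g' y)) = a' y).
  by apply: filterS2 N' Nf' => y <- /(_ _ erefl)[_ ->]; rewrite gmulVK.
apply: jet_eq_trans (jet_eq_sym (jet_eq_near E)) _.
apply: jet_eq_trans (jet_eq_near E').
note s1 := (smooth_at_comp sf spf).
note s2 := (smooth_at_comp sf' spf').
note s3 := (smooth_at_comp sg spg).
note s4 := (smooth_at_comp sg' spg').
note j1 := (jet_eq_comp sf sf' spf spf jf jet_eq_refl).
note j2 := (jet_eq_comp sg sg' spg spg jg jet_eq_refl).
note j3 := (jet_eq_comp s1 s2 (@ginv_smooth R H _) (@ginv_smooth R H _) j1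
  jet_eq_refl).
exact: (jet_eq_comp2 (@gmul_smooth R H) (smooth_at_ginv s1)
  (smooth_at_ginv s2) s3 s4 j3 j2).
Qed.

End Principal.
End Bundles.

(** * The group W^{k,h}_m H and its action on W^{k,h}Q *)

Lemma sig_inj (T : Type) (P : T -> Prop) (x y : {x | P x}) :
  sval x = sval y -> x = y.
Proof.
case: x y => [x px] [y py] /= E; subst y; congr exist.
exact: Prop_irrelevance.
Qed.

Section JetGroup.
Context {R : realType}.
Variables (m : nat) (H : lie_group R) (k h : nat).
Implicit Types (w : Wgroup m H k h) (alpha beta : euclid R m -> euclid R m).
Implicit Types (a b : euclid R m -> H).

Lemma Wrep_ex alpha a : germ_rep alpha a -> exists w, Wrep w alpha a.
Proof.
move=> g.
have W : exists alpha' a', germ_rep alpha' a' /\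
  (jet k origin alpha, jet h origin a) = (jet k origin alpha', jet h origin a').
  by exists alpha, a.
pose w : Wgroup m H k h := exist _ (jet k origin alpha, jet h origin a) W.
by exists w.
Qed.

Lemma Wrep_jets w alpha a alpha' a' : Wrep w alpha a -> Wrep w alpha' a' ->
  jet_eq k origin alpha alpha' /\ jet_eq h origin a a'.
Proof.
move=> [_ E] [[[s _] _ s'] E']; move: E'; rewrite E => -[E1 E2].
by split; apply: jet_inj.
Qed.

Lemma Wrep_congr w alpha a alpha' a' : Wrep w alpha a -> germ_rep alpha' a' ->
  jet_eq k origin alpha alpha' -> jet_eq h origin a a' -> Wrep w alpha' a'.
Proof.
by move=> [_ E] g j1 j2; split=> //; rewrite E (jet_congr j1) (jet_congr j2).
Qed.

Lemma germ_id : germ_rep (id : euclid R m -> euclid R m) (fun=> gone H).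
Proof.
split=> //; last exact: smooth_at_cst.
split; first exact: smooth_at_id.
by exists id; split; [exact: smooth_at_id|exact: near_ptW|exact: near_ptW].
Qed.

Lemma Wone_ex : exists w, Wone w.
Proof. exact: Wrep_ex germ_id. Qed.

Lemma germ_mul alpha a beta b : germ_rep alpha a -> germ_rep beta b ->
  germ_rep (alpha \o beta) (fun y => gmul (a (beta y)) (b y)).
Proof.
move=> [d1 o1 s1] [d2 o2 s2]; split; first last.
- apply: smooth_at_gmul => //; have sb := d2.1.
  by apply: (smooth_at_comp sb); rewrite o2.
- by rewrite /= o2.
- by apply: local_diffeo_comp => //; rewrite o2.
Qed.

Lemma germ_inv alpha a alphaV : germ_rep alpha a ->
  local_inverse alpha origin alphaV ->
  germ_rep alphaV (fun y => ginv (a (alphaV y))).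
Proof.
move=> [[sa da] o s] l; have E := local_inverse_at l; rewrite o in E.
have sV := local_inverse_smooth l; rewrite o in sV.
split=> //; first split=> //.
  by exists alpha; have := local_inverse_sym sa l; rewrite o.
by apply: smooth_at_ginv; apply: (smooth_at_comp sV); rewrite E.
Qed.

End JetGroup.

(** * Representatives of the points of W^{k,h}Q *)

Section JetFrames.
Context {R : realType}.
Variables (M : manifold R) (H : lie_group R) (Q : principal_bundle M H).
Variables (k h : nat).
Hypothesis hk : (h <= k)%N.
Let m := sdim M.
Implicit Types (w : WQ Q k h) (g : Wgroup m H k h).
Implicit Types (eps : euclid R m -> M) (sigma : M -> Q).
Implicit Types (alpha beta : euclid R m -> euclid R m) (a b : euclid R m -> H).

Lemma WQrep_ex eps sigma : frame_rep eps sigma -> exists w, WQrep w eps sigma.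
Proof.
move=> f.
have W : exists eps' sigma', frame_rep eps' sigma' /\
  (jet k origin eps, jet h (eps origin) sigma) =
  (jet k origin eps', jet h (eps' origin) sigma').
  by exists eps, sigma.
pose w : WQ Q k h := exist _ (jet k origin eps, jet h (eps origin) sigma) W.
by exists w.
Qed.

Lemma WQrep_rep w : exists eps sigma, WQrep w eps sigma.
Proof. by case: (svalP w) => eps [sigma [f E]]; exists eps, sigma. Qed.

Lemma WQrep_jets w eps sigma eps' sigma' :
  WQrep w eps sigma -> WQrep w eps' sigma' ->
  jet_eq k origin eps eps' /\ jet_eq h (eps origin) sigma sigma'.
Proof.
move=> [_ E] [[[s _] s' _] E']; move: E'; rewrite E => -[E1 E2].
have j := jet_inj s E1; split=> //.
have e : eps origin = eps' origin by case: j.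
by rewrite e in E2 *; exact: jet_inj s' E2.
Qed.

Lemma WQrep_congr w eps sigma eps' sigma' :
  WQrep w eps sigma -> frame_rep eps' sigma' ->
  jet_eq k origin eps eps' -> jet_eq h (eps origin) sigma sigma' ->
  WQrep w eps' sigma'.
Proof.
move=> [_ E] f j1 j2; split=> //; rewrite E (jet_congr j1) (jet_congr j2).
by case: j1 => ->.
Qed.

Lemma WQrep_inj w w' eps sigma : WQrep w eps sigma -> WQrep w' eps sigma -> w = w'.
Proof. by move=> [_ E] [_ E']; apply: sig_inj; rewrite E E'. Qed.

Lemma frame_congr eps sigma eps' sigma' : frame_rep eps sigma ->
  near_pt origin (fun y => eps y = eps' y) ->
  near_pt (eps origin) (fun y => sigma y = sigma' y) -> frame_rep eps' sigma'.
Proof.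
move=> [[se [epsV le]] ss sec] Ne Ns; have E := near_pt_self Ne.
note se' := (smooth_at_ext Ne se).
split.
- split=> //; exists epsV; case: le => sV l1 l2; split; rewrite -?E //.
    by apply: filterS2 Ne l1 => y ->.
  have E0 : epsV (eps origin) = origin by exact: near_pt_self l1.
  have Ne' : near_pt (epsV (eps origin)) (fun y => eps y = eps' y) by rewrite E0.
  by apply: filterS2 l2 (smooth_at_pre sV Ne') => y + <-.
- by rewrite -E; exact: smooth_at_ext ss.
- by rewrite -E; apply: filterS2 Ns sec => y ->.
Qed.

Lemma WQrep_near w eps sigma eps' sigma' : WQrep w eps sigma ->
  near_pt origin (fun y => eps y = eps' y) ->
  near_pt (eps origin) (fun y => sigma y = sigma' y) -> WQrep w eps' sigma'.
Proof.
move=> W N1 N2; apply: (WQrep_congr W); [|exact: jet_eq_near|exact: jet_eq_near].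
by apply: frame_congr N1 N2; case: W.
Qed.

Lemma smooth_at_transport eps alpha a epsV alphaV :
  local_inverse eps origin epsV -> local_inverse alpha origin alphaV ->
  alpha origin = origin -> smooth_at a origin ->
  [/\ smooth_at (fun y => alphaV (epsV y)) (eps origin),
      alphaV (epsV (eps origin)) = origin &
      smooth_at (fun y => a (alphaV (epsV y))) (eps origin)].
Proof.
move=> le la o sa; have E1 := local_inverse_at le; have E2 := local_inverse_at la.
have s1 := local_inverse_smooth le; have s2 := local_inverse_smooth la.
rewrite o in E2 s2.
have E : alphaV (epsV (eps origin)) = origin by rewrite E1.
have s3 : smooth_at (fun y => alphaV (epsV y)) (eps origin).
  by apply: (smooth_at_comp s1); rewrite E1.
by split=> //; apply: (smooth_at_comp s3); rewrite E.
Qed.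

Lemma frame_act eps sigma alpha a epsV alphaV :
  frame_rep eps sigma -> germ_rep alpha a ->
  local_inverse eps origin epsV -> local_inverse alpha origin alphaV ->
  frame_rep (eps \o alpha) (fun y => bact Q (sigma y) (a (alphaV (epsV y)))).
Proof.
move=> [de ss sec] [da o sa] le la.
have [_ _ sb] := smooth_at_transport le la o sa.
split.
- by apply: local_diffeo_comp => //; rewrite o.
- by rewrite /= o; exact: smooth_at_bact.
- by rewrite /= o; apply: filterS sec => y E; rewrite bproj_act.
Qed.

(** [WQact] provides some representatives; this lemma makes any others as good. The h-jet of a \o
    alpha^-1 \o eps^-1 involves the h-jets of the two inverses, which are determined by the k-jets
    of alpha and eps because [h <= k]. *)
Lemma WQact_rep w g w' eps sigma alpha a epsV alphaV :
  WQact w g w' -> WQrep w eps sigma -> Wrep g alpha a ->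
  local_inverse eps origin epsV -> local_inverse alpha origin alphaV ->
  WQrep w' (eps \o alpha) (fun y => bact Q (sigma y) (a (alphaV (epsV y)))).
Proof.
move=> [e [s [al [b [eV [alV [W1 W2 le la W3]]]]]]] V1 V2 le' la'.
have [je js] := WQrep_jets W1 V1; have [ja jb] := Wrep_jets W2 V2.
have [[[se de] ss sec] _] := W1; have [[[se' de'] ss' sec'] _] := V1.
have [[[sal dal] o sb] _] := W2; have [[[sal' dal'] o' sb'] _] := V2.
have e0 : e origin = eps origin by case: je.
have f : frame_rep (eps \o alpha) (fun y => bact Q (sigma y) (a (alphaV (epsV y)))).
  exact: (frame_act V1.1 V2.1 le' la').
have se2 : smooth_at e (al origin) by rewrite o.
have se2' : smooth_at eps (al origin) by rewrite o.
have je' : jet_eq k (al origin) e eps by rewrite o.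
apply: (WQrep_congr W3 f); first exact: (jet_eq_comp sal sal' se2 se2' ja je').
rewrite /= o.
have [s1 E1 t1] := smooth_at_transport le la o sb.
have [s2 E2 t2] := smooth_at_transport le' la' o' sb'.
rewrite -e0 in s2 E2 t2 ss'.
have sepsV := local_inverse_smooth le'; rewrite -e0 in sepsV.
have seV := local_inverse_smooth le.
note jeV' := (jet_eq_le seV sepsV hk (jet_eq_inverse se se' le le' je)).
note jaV := (jet_eq_inverse sal sal' la la' ja); rewrite o in jaV.
have salV := local_inverse_smooth la; rewrite o in salV.
have salV' := local_inverse_smooth la'; rewrite o' in salV'.
note jaV' := (jet_eq_le salV salV' hk jaV).
have E3 := local_inverse_at le; rewrite -E3 in jaV' salV salV'.
note j1 := (jet_eq_comp seV sepsV salV salV' jeV' jaV').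
rewrite -E1 in jb sb sb'.
note j2 := (jet_eq_comp s1 s2 sb sb' j1 jb).
exact: (jet_eq_comp2 (@bact_smooth R M H Q) ss ss' t1 t2 js j2).
Qed.

End JetFrames.

(** * The right action on W^{k,h}Q, free on the fibres, and lifts *)

Section JetAction.
Context {R : realType}.
Variables (M : manifold R) (H : lie_group R) (Q : principal_bundle M H).
Variables (k h : nat).
Hypothesis hk : (h <= k)%N.
Let m := sdim M.
Implicit Types (w : WQ Q k h) (g : Wgroup m H k h).
Implicit Types (eps : euclid R m -> M) (sigma : M -> Q).
Implicit Types (alpha beta : euclid R m -> euclid R m) (a b : euclid R m -> H).

Lemma near_local_inverse_right eps alpha epsV alphaV P :
  local_inverse eps origin epsV -> local_inverse alpha origin alphaV ->
  alpha origin = origin -> near_pt (origin : euclid R m) P ->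
  near_pt (eps origin) (fun y => P (alphaV (epsV y))).
Proof.
move=> le la o NP.
have [s E _] := smooth_at_transport le la o (smooth_at_cst (y := gone H)).
by apply: (smooth_at_pre s); rewrite E.
Qed.

(** With z = alpha^-1 (eps^-1 y), acting twice gives sigma(y).a(z).b(beta^-1 z). This is the action
    of the product germ evaluated at beta^-1 z, since beta (beta^-1 z) = z near the origin. *)
Lemma WQact_assoc w g1 w1 g2 w2 : WQact w g1 w1 -> WQact w1 g2 w2 ->
  exists g3, Wmul g1 g2 g3 /\ WQact w g3 w2.
Proof.
move=> [e [s [al [a [eV [alV [W1 W2 le la W3]]]]]]] A2.
have [_ [_ [be [b [_ [beV [_ V2 _ lb _]]]]]]] := A2.
have [[[se _] ss sec] _] := W1; have [[[sal dal] o sa] _] := W2.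
have [[[sbe dbe] o' sb] _] := V2.
have le' : local_inverse (e \o al) origin (alV \o eV).
  by apply: local_inverse_comp => //; rewrite o.
have W4 := WQact_rep hk A2 W3 V2 le' lb.
have [g3 G3] := Wrep_ex k h (germ_mul W2.1 V2.1).
exists g3; split; first by exists al, a, be, b.
exists e, s, (al \o be), (fun y => gmul (a (be y)) (b y)), eV, (beV \o alV).
have lab : local_inverse (al \o be) origin (beV \o alV).
  by apply: local_inverse_comp => //; rewrite o'.
split=> //.
apply: (WQrep_near W4); first exact: near_ptW.
rewrite /= o' o.
have N : near_pt (origin : euclid R m) (fun z => be (beV z) = z).
  by case: lb; rewrite o'.
have := near_local_inverse_right le la o N.
by apply: filterS => y /= E; rewrite bactM E.
Qed.

Lemma WQact_inv w g w' : WQact w g w' ->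
  exists gi one, [/\ Wone one, Wmul gi g one & WQact w' gi w].
Proof.
move=> [e [s [al [a [eV [alV [W1 W2 le la W3]]]]]]].
have [[[se _] ss sec] _] := W1; have [[[sal dal] o sa] _] := W2.
have [one O] := Wone_ex m H k h.
have gi := germ_inv W2.1 la.
have [g' G'] := Wrep_ex k h gi.
have N1 : near_pt (origin : euclid R m) (fun z => alV (al z) = z) by case: la.
exists g', one; split=> //.
  exists alV, (fun y => ginv (a (alV y))), al, a; split=> //.
  apply: (Wrep_congr O (germ_mul gi W2.1)); apply: jet_eq_near.
    by apply: filterS N1 => z.
  by apply: filterS N1 => z ->; rewrite gmulV.
have le' : local_inverse (e \o al) origin (alV \o eV).
  by apply: local_inverse_comp => //; rewrite o.
have la' := local_inverse_sym sal la; rewrite o in la'.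
exists (e \o al), (fun y => bact Q (s y) (a (alV (eV y)))), alV,
  (fun y => ginv (a (alV y))), (alV \o eV), al; split=> //.
have N2 : near_pt (origin : euclid R m) (fun z => al (alV z) = z).
  by case: la; rewrite o.
apply: (WQrep_near W1); first by apply: filterS N2 => z /= ->.
apply: filterS (near_local_inverse_right le la o N1) => y /= ->.
by rewrite bactK.
Qed.

Lemma WQact_one w g : Wone g -> WQact w g w.
Proof.
move=> O; have [e [s W]] := WQrep_rep w; have [[[se [eV le]] ss sec] _] := W.
exists e, s, id, (fun=> gone H), eV, id; split=> //.
  by split; [exact: smooth_at_id|exact: near_ptW|exact: near_ptW].
by apply: (WQrep_near W); apply: near_ptW => y //=; rewrite bact1.
Qed.

(** Cancelling eps on the left gives alpha the k-jet of the identity. Dividing the section by itself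
    gives a \o alpha^-1 \o eps^-1 the h-jet of the constant unit, and composing with eps \o alpha
    transfers this to a. *)
Lemma WQact_free w g : WQact w g w -> Wone g.
Proof.
move=> [e [s [al [a [eV [alV [W1 W2 le la W3]]]]]]].
have [[[se _] ss sec] _] := W1; have [[[sal dal] o sa] _] := W2.
have [je js] := WQrep_jets W1 W3.
have seV := local_inverse_smooth le; have E := local_inverse_at le.
have N1 : near_pt (origin : euclid R m) (fun z => alV (al z) = z) by case: la.
have N2 : near_pt (origin : euclid R m) (fun z => eV (e z) = z) by case: le.
have [_ _ sb] := smooth_at_transport le la o sa.
have s1 : smooth_at (e \o al) origin by apply: (smooth_at_comp sal); rewrite o.
apply: (Wrep_congr W2 (germ_id m H)).
  note j := (jet_eq_comp se s1 seV seV je jet_eq_refl).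
  have N2' : near_pt (al origin) (fun z => eV (e z) = z) by rewrite o.
  have j1 : jet_eq k origin (fun z => eV (e (al z))) al.
    exact/jet_eq_near/(smooth_at_pre sal N2').
  have j0 : jet_eq k origin id (fun z => eV (e z)).
    by apply: jet_eq_near; apply: filterS N2 => z.
  exact: (jet_eq_sym (jet_eq_trans j0 (jet_eq_trans j j1))).
have sa' : smooth_at (fun y => bact Q (s y) (a (alV (eV y)))) (e origin).
  exact: smooth_at_bact.
have j2 : jet_eq h (e origin) (fun y => a (alV (eV y))) (fun=> gone H).
  apply: (jet_eq_division ss ss sa' ss _ _ jet_eq_refl (jet_eq_sym js)).
    exact: near_ptW.
  by apply: near_ptW => y; rewrite bact1.
have E' : (e \o al) origin = e origin by rewrite /= o.
rewrite -E' in sb j2.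
note j3 := (jet_eq_comp s1 s1 sb smooth_at_cst jet_eq_refl j2).
apply: jet_eq_trans _ j3; apply: jet_eq_near.
have N2' : near_pt (al origin) (fun z => eV (e z) = z) by rewrite o.
by apply: filterS2 N1 (smooth_at_pre sal N2') => z /= Ez ->; rewrite Ez.
Qed.

(** A criterion without inverses: [WQact] involves eps^-1 and alpha^-1, but they disappear when the
    sections are compared along eps', which parametrises a neighbourhood of the base point. *)
Lemma WQact_sections w w' g eps sigma eps' sigma' alpha a :
  WQrep w eps sigma -> WQrep w' eps' sigma' -> Wrep g alpha a ->
  near_pt origin (fun y => eps (alpha y) = eps' y) ->
  near_pt origin (fun y => bact Q (sigma (eps' y)) (a y) = sigma' (eps' y)) ->
  WQact w g w'.
Proof.
move=> W W' G N1 N2.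
have [[[se [eV le]] ss sec] _] := W; have [[[sal [alV la]] o sa] _] := G.
exists eps, sigma, alpha, a, eV, alV; split=> //.
have E := near_pt_self N1; rewrite o in E.
apply: (WQrep_near W'); first by apply: filterS N1 => y /= ->.
rewrite -E.
have M1 := near_local_inverse_right le la o N1.
have M2 := near_local_inverse_right le la o N2.
have seV := local_inverse_smooth le.
have M4 : near_pt (eps origin) (fun y => alpha (alV (eV y)) = eV y).
  have N3 : near_pt (eV (eps origin)) (fun z => alpha (alV z) = z).
    by rewrite (local_inverse_at le); case: la; rewrite o.
  exact: (smooth_at_pre seV N3).
have M5 : near_pt (eps origin) (fun y => eps (eV y) = y) by case: le.
have M12 : near_pt (eps origin) (fun y => eps (alpha (alV (eV y))) = y).
  by apply: filterS2 M4 M5 => y ->.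
apply: filterS3 M1 M2 M12 => y E1 E2 E3.
by rewrite -E1 E3 in E2.
Qed.

Section AssociatedBundle.
Variables (F : manifold R) (lam : Wgroup m H k h -> F -> F).
Hypothesis hlam : smooth_left_action lam.

Lemma lam_one g f : Wone g -> lam g f = f.
Proof. by case: hlam => _ H1 _; exact: H1. Qed.

Lemma lam_mul g1 g2 g3 f : Wmul g1 g2 g3 -> lam g3 f = lam g1 (lam g2 f).
Proof. by case: hlam => _ _ H1; exact: H1. Qed.

(** The defining relation of the associated bundle: by associativity and inverses, translating the
    first component by g turns the set of pairs equivalent to (w, lam g f) into that of (w', f). *)
Lemma lam_class_act w g w' f : WQact w g w' ->
  lam_class lam w (lam g f) = lam_class lam w' f.
Proof.
move=> A; apply/seteqP; split=> -[w'' f''] [g2 /= [A2 E]].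
  have [gi [one [one1 Mi Ai]]] := WQact_inv A.
  have [g3 [M3 A3]] := WQact_assoc Ai A2.
  exists g3; split=> //=.
  by rewrite (lam_mul _ M3) -E -(lam_mul _ Mi) lam_one.
have [g3 [M3 A3]] := WQact_assoc A A2.
by exists g3; split=> //=; rewrite (lam_mul _ M3) -E.
Qed.

(** The pair (w', f') belongs to its own class through the unit, hence to the class of (w, f). *)
Lemma lam_class_eq w f w' f' : lam_class lam w f = lam_class lam w' f' ->
  exists2 g, WQact w g w' & f = lam g f'.
Proof.
move=> E; have : lam_class lam w' f' (w', f').
  have [one O] := Wone_ex m H k h.
  by exists one; split; [exact: WQact_one|rewrite lam_one].
by rewrite -E => -[g [A Ef]]; exists g.
Qed.

Lemma lam_class_inj w f f' : lam_class lam w f = lam_class lam w f' -> f = f'.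
Proof. by move=> /lam_class_eq[g /WQact_free O ->]; exact: lam_one. Qed.

Lemma Qlam_ex w f : exists q : Qlam Q lam, sval q = lam_class lam w f.
Proof.
have W : exists w' f', lam_class lam w f = lam_class lam w' f' by exists w, f.
pose q : Qlam Q lam := exist _ (lam_class lam w f) W.
by exists q.
Qed.

End AssociatedBundle.

(** The maps at time t are total functions but meaningful only over the points where the flow exists
    at that time, so the condition is local on the base. It bears on whole fibres, as equivariance
    requires. *)
Definition local_automorphism (phi : M -> M) (Phi : Q -> Q) (x : M) : Prop :=
  local_diffeo_at phi x /\ near_pt x (fun y => forall u, bproj Q u = y ->
    [/\ smooth_at Phi u, bproj Q (Phi u) = phi y &
        forall a : H, Phi (bact Q u a) = bact Q (Phi u) a]).

Lemma frame_lift eps sigma phi Phi phiV : frame_rep eps sigma ->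
  local_automorphism phi Phi (eps origin) -> local_inverse phi (eps origin) phiV ->
  frame_rep (phi \o eps) (Phi \o sigma \o phiV).
Proof.
move=> [de ss sec] [dphi NPhi] lphi.
have E := local_inverse_at lphi; have sV := local_inverse_smooth lphi.
have Esec := near_pt_self sec.
have ss' : smooth_at sigma (phiV (phi (eps origin))) by rewrite E.
have [sPhi _ _] := near_pt_self NPhi _ Esec.
split.
- exact: local_diffeo_comp.
- have s1 : smooth_at (sigma \o phiV) (phi (eps origin)).
    exact: (smooth_at_comp sV ss').
  by apply: (smooth_at_comp s1); rewrite /= E.
- have sec' : near_pt (phiV (phi (eps origin))) (fun y => bproj Q (sigma y) = y).
    by rewrite E.
  have NPhi' : near_pt (phiV (phi (eps origin))) (fun y => forall u, bproj Q u = y ->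
    [/\ smooth_at Phi u, bproj Q (Phi u) = phi y &
        forall a : H, Phi (bact Q u a) = bact Q (Phi u) a]) by rewrite E.
  have [_ _ l] := lphi.
  apply: filterS3 l (smooth_at_pre sV sec') (smooth_at_pre sV NPhi') => y l1 l2 l3.
  by have [_ /= -> _] := l3 _ l2.
Qed.

(** Two local inverses of phi have the same jet at phi (eps 0) by [jet_eq_inverse]; the chain rule
    does the rest. *)
Lemma WQlift_rep w w' eps sigma eps' sigma' phi Phi phiV phiV' :
  WQrep w eps sigma -> WQrep w eps' sigma' ->
  local_automorphism phi Phi (eps origin) ->
  local_inverse phi (eps origin) phiV -> local_inverse phi (eps origin) phiV' ->
  WQrep w' (phi \o eps) (Phi \o sigma \o phiV) ->
  WQrep w' (phi \o eps') (Phi \o sigma' \o phiV').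
Proof.
move=> W1 W2 LA l1 l2 W3.
have [je js] := WQrep_jets W1 W2.
have [[[se _] ss sec] _] := W1; have [[[se' _] ss' sec'] _] := W2.
have E0 : eps origin = eps' origin by case: je.
have LA' := LA; have l2' := l2; rewrite E0 in LA' l2'.
have [[sphi _] NPhi] := LA; have Esec := near_pt_self sec.
have Es : sigma (eps origin) = sigma' (eps origin) by case: js.
have [sPhi _ _] := near_pt_self NPhi _ Esec.
have sphi' : smooth_at phi (eps' origin) by rewrite -E0.
apply: (WQrep_congr W3 (frame_lift W2.1 LA' l2')).
  exact: (jet_eq_comp se se' sphi sphi je jet_eq_refl).
have E1 := local_inverse_at l1; have E2 := local_inverse_at l2.
have s1 := local_inverse_smooth l1; have s2 := local_inverse_smooth l2.
note jV := (jet_eq_inverse (k := h) sphi sphi l1 l2 jet_eq_refl).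
rewrite -E0 in ss'.
rewrite -E1 in ss ss' js.
note j1 := (jet_eq_comp s1 s2 ss ss' jV js).
have t1 : smooth_at (sigma \o phiV) (phi (eps origin)) by exact: (smooth_at_comp s1 ss).
have t2 : smooth_at (sigma' \o phiV') (phi (eps origin)).
  by apply: (smooth_at_comp s2); rewrite E2 -E1.
have u1 : smooth_at Phi (sigma (phiV (phi (eps origin)))) by rewrite E1.
exact: (jet_eq_comp t1 t2 u1 u1 j1 jet_eq_refl).
Qed.

Lemma WQlift_ex w eps sigma phi Phi : WQrep w eps sigma ->
  local_automorphism phi Phi (eps origin) -> exists w', WQlift phi Phi w w'.
Proof.
move=> W LA; have [[_ [phiV l]] _] := LA.
have [w' W'] := WQrep_ex k h (frame_lift W.1 LA l).
exists w' => e s V; have [[E0 _] _] := WQrep_jets W V.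
by exists phiV; split; [rewrite -E0|exact: (WQlift_rep W V LA l l W')].
Qed.

Lemma WQlift_act w1 w1' g w eps sigma phi Phi : WQrep w1 eps sigma ->
  local_automorphism phi Phi (eps origin) ->
  WQlift phi Phi w1 w1' -> WQact w1 g w ->
  exists w', WQlift phi Phi w w' /\ WQact w1' g w'.
Proof.
move=> W LA L [e [s [al [a [eV [alV [W1 W2 le la W3]]]]]]].
have [[E0 _] _] := WQrep_jets W W1; rewrite E0 in LA.
have [[[sal dal] o sa] _] := W2.
have LA' : local_automorphism phi Phi ((e \o al) origin) by rewrite /= o.
have [w' L'] := WQlift_ex W3 LA'; exists w'; split=> //.
have [phiV [l V]] := L _ _ W1.
have [phiV' [l' V']] := L' _ _ W3.
have l2 : local_inverse phi ((e \o al) origin) phiV by rewrite /= o.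
have {}V' := WQlift_rep W3 W3 LA' l' l2 V'.
have [[[se _] ss sec] _] := W1.
exists (phi \o e), (Phi \o s \o phiV), al, a, (eV \o phiV), alV; split=> //.
  exact: local_inverse_comp.
apply: (WQrep_near V'); first exact: near_ptW.
have sV := local_inverse_smooth l; have E := local_inverse_at l.
rewrite /= o.
have [_ NPhi] := LA.
have N : near_pt (e origin) (fun y => Phi (bact Q (s y) (a (alV (eV y)))) =
    bact Q (Phi (s y)) (a (alV (eV y)))).
  by apply: filterS2 sec NPhi => y Ey /(_ _ Ey)[].
have N' : near_pt (phiV (phi (e origin))) (fun y => Phi (bact Q (s y) (a (alV (eV y)))) =
    bact Q (Phi (s y)) (a (alV (eV y)))) by rewrite E.
exact: (smooth_at_pre sV N').
Qed.

End JetAction.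

(** * Charts of the associated bundle *)

(** Derivatives in y are derivatives of G in the joint variable, by [dlist_slice]. This is why the
    jet coordinates of a smooth family of maps are smooth in the parameter. *)
Lemma sm_taylor_family (R : realType) n m p lo k
    (G : 'rV[R]_(n + m) -> 'rV[R]_p) (a : 'rV[R]_n) :
  sm G (row_mx a 0) ->
  sm (fun v => taylor lo k (fun y => G (row_mx v y)) 0) a.
Proof.
move=> sG; apply/sm_mxP => i l; rewrite (ord1 i).
case/mxvec_indexP: l => r j.
have s : sm (fun v : 'rV[R]_n => row_mx v (0 : 'rV[R]_m)) a.
  exact: sm_row_mx (sm_id a) (sm_cst _ _).
have sD := sm_comp_at s erefl
  (sm_dlist [seq row_mx 0 v | v <- basis (mword (enum_val r : mindex m lo k))] sG).
apply: sm_eq ((sm_mxP _ _).1 sD 0 j) => v.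
by rewrite mxvecE mxE mpartialE dlist_slice.
Qed.

Section Frames.
Context {R : realType}.
Variables (M : manifold R) (H : lie_group R) (Q : principal_bundle M H).
Variables (k h : nat).
Hypothesis hk : (h <= k)%N.
Let m := sdim M.

(** The frame of the section s in the charts of [Qlam_space]: a translation read in the chart b. *)
Definition chart_frame (b : chart R M m) (x : M) : euclid R m -> M :=
  fun y => cinv b (cmap b x + y).

Lemma chart_frame0 b x : charts b -> cdom b x -> chart_frame b x origin = x.
Proof. by move=> hb bx; rewrite /chart_frame addr0 atlas_cmapK. Qed.

Lemma near_chart_frame b x : charts b -> cdom b x ->
  near_pt (origin : euclid R m) (fun y => cdom b (chart_frame b x y) /\
    cmap b (chart_frame b x y) = cmap b x + y).
Proof.
move=> hb bx; apply/near_pt_euclid.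
note N := (chart_near hb bx); rewrite -{1}[cmap b x]addr0 in N.
have s : sm (fun y : 'rV[R]_m => cmap b x + y) 0 by exact: smD (sm_cst _ _) (sm_id _).
exact: (sm_near_pre s N).
Qed.

Lemma smooth_chart_frame b x : charts b -> cdom b x ->
  smooth_at (chart_frame b x) origin.
Proof.
move=> hb bx.
have s : @smooth_at R (euclid R m) (euclid R m) (fun y : 'rV[R]_m => cmap b x + y) origin.
  by apply/smooth_at_euclid; exact: smD (sm_cst _ _) (sm_id _).
apply: (smooth_at_comp s); rewrite addr0.
by apply: smooth_at_cinv => //; exists x.
Qed.

Lemma chart_frame_inverse b x : charts b -> cdom b x ->
  local_inverse (chart_frame b x) origin (fun z => cmap b z - cmap b x).
Proof.
move=> hb bx; have E := chart_frame0 hb bx; split; rewrite ?E.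
- have s1 : @smooth_at R (euclid R m) (euclid R m) (fun y : 'rV[R]_m => y - cmap b x) (cmap b x).
    by apply/smooth_at_euclid; exact: smB (sm_id _) (sm_cst _ _).
  exact: (smooth_at_comp (smooth_at_cmap hb bx) s1).
- apply: filterS (near_chart_frame hb bx) => y [_ ->].
  by rewrite addrC addKr.
- apply: filterS (near_chart_dom hb bx) => y by_.
  by rewrite /chart_frame addrC subrK atlas_cmapK.
Qed.

Lemma chart_frame_rep b x sigma : charts b -> cdom b x ->
  smooth_at sigma x -> near_pt x (fun y => bproj Q (sigma y) = y) ->
  frame_rep (chart_frame b x) sigma.
Proof.
move=> hb bx ss sec; split; rewrite ?chart_frame0//.
split; first exact: smooth_chart_frame.
by eexists; exact: chart_frame_inverse.
Qed.

(** The quotient is merely chosen fibre by fibre; [smooth_division] later provides its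
    smoothness. *)
Lemma division_ex (X : charted R) {aX : atlas X} (f g : X -> Q) x :
  near_pt x (fun y => bproj Q (f y) = bproj Q (g y)) ->
  exists a : X -> H, near_pt x (fun y => bact Q (f y) (a y) = g y).
Proof.
move=> N.
have C y : exists a, bproj Q (f y) = bproj Q (g y) -> bact Q (f y) a = g y.
  have [E|nE] := pselect (bproj Q (f y) = bproj Q (g y)).
    by have [a Ea] := bact_trans E; exists a.
  by exists (gone H).
by have [a Ha] := choice C; exists a; apply: filterS N => y; exact: Ha.
Qed.

(** The group element is represented by alpha = eps^-1 \o eps' and by the quotient of the two
    sections along eps'. *)
Lemma WQact_trans_ex (w w' : WQ Q k h) eps sigma eps' sigma' :
  WQrep w eps sigma -> WQrep w' eps' sigma' -> eps origin = eps' origin ->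
  exists g, WQact w g w'.
Proof.
move=> W W' E.
have [[[se [eV le]] ss sec] _] := W; have [[[se' [eV' le']] ss' sec'] _] := W'.
have E1 := local_inverse_at le; have sV := local_inverse_smooth le.
have sd : local_diffeo_at (eV \o eps') origin.
  apply: local_diffeo_comp; first by split=> //; exists eV'.
  rewrite -E; split=> //; exists eps; exact: local_inverse_sym.
have N : near_pt origin (fun y => bproj Q (sigma (eps' y)) = bproj Q (sigma' (eps' y))).
  rewrite E in sec.
  by apply: filterS2 (smooth_at_pre se' sec) (smooth_at_pre se' sec') => y -> ->.
have [a Na] := division_ex N.
have sa : smooth_at a origin.
  apply: (smooth_division _ _ Na); apply: (smooth_at_comp se') => //.
  by rewrite -E.
have gr : germ_rep (eV \o eps') a by split=> //; rewrite /= -E.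
have [g G] := Wrep_ex k h gr; exists g.
apply: (WQact_sections W W' G _ Na).
have NV : near_pt (eps' origin) (fun y => eps (eV y) = y) by rewrite -E; case: le.
exact: (smooth_at_pre se' NV).
Qed.

End Frames.

Section AssociatedCharts.
Context {R : realType}.
Variables (M : manifold R) (H : lie_group R) (Q : principal_bundle M H).
Variables (k h : nat).
Hypothesis hk : (h <= k)%N.
Variables (F : manifold R) (lam : Wgroup (sdim M) H k h -> F -> F).
Hypothesis hlam : smooth_left_action lam.
Implicit Types (q : Qlam Q lam) (x : M) (f : F).

Definition trivialises (b : chart R M (sdim M)) (c : chart R F (sdim F))
    (O : set M) (sigma : M -> Q) q x f : Prop :=
  [/\ O x, cdom c f & exists w, WQrep w (chart_frame b x) sigma /\
    sval q = lam_class lam w f].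

Definition section_on (O : set M) (sigma : M -> Q) : Prop :=
  forall x, O x -> smooth_at sigma x /\ bproj Q (sigma x) = x.

Lemma section_near (O : set M) sigma x : sopen O -> section_on O sigma -> O x ->
  near_pt x (fun y => bproj Q (sigma y) = y).
Proof. by move=> oO sec Ox; exists O; split=> // y /sec[]. Qed.

(** Equivalent pairs lie over the same point because alpha fixes the origin. *)
Lemma in_fibre_uniq q x x' : in_fibre q x -> in_fibre q x' -> x = x'.
Proof.
move=> [w [f [e [s [E W <-]]]]] [w' [f' [e' [s' [E' W' <-]]]]].
move: E'; rewrite E => /(lam_class_eq hlam)[g A _].
have [e1 [s1 [al [a [eV [alV [W1 [[_ o _] _] _ _ W3]]]]]]] := A.
have [[E1 _] _] := WQrep_jets W W1; have [[E2 _] _] := WQrep_jets W' W3.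
by rewrite E1 E2 /= o.
Qed.

Section OneChart.
Variables (b : chart R M (sdim M)) (c : chart R F (sdim F)) (O : set M)
  (sigma : M -> Q).
Hypotheses (hb : charts b) (hc : charts c) (oO : sopen O)
  (Ob : O `<=` cdom b) (sec : section_on O sigma).

Lemma trivialises_fibre q x f : trivialises b c O sigma q x f -> in_fibre q x.
Proof.
move=> [Ox _ [w [W E]]]; exists w, f, (chart_frame b x), sigma; split=> //.
exact/(chart_frame0 hb)/Ob.
Qed.

Lemma trivialises_uniq q x f x' f' :
  trivialises b c O sigma q x f -> trivialises b c O sigma q x' f' ->
  x = x' /\ f = f'.
Proof.
move=> T T'; have E := in_fibre_uniq (trivialises_fibre T) (trivialises_fibre T').
split=> //; subst x'.
move: T T' => [_ _ [w [W Eq]]] [_ _ [w' [W' Eq']]].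
have Ew := WQrep_inj W W'; subst w'.
by apply: (lam_class_inj hlam (w := w)); rewrite -Eq Eq'.
Qed.

Lemma trivialises_inj q q' x f :
  trivialises b c O sigma q x f -> trivialises b c O sigma q' x f -> q = q'.
Proof.
move=> [_ _ [w [W Eq]]] [_ _ [w' [W' Eq']]].
by have Ew := WQrep_inj W W'; apply: sig_inj; rewrite Eq Eq' Ew.
Qed.

Lemma section_frame_ex x : O x -> exists w : WQ Q k h, WQrep w (chart_frame b x) sigma.
Proof.
move=> Ox; apply: WQrep_ex; apply: chart_frame_rep => //; first exact: Ob.
  by case: (sec Ox).
exact: section_near Ox.
Qed.

Lemma trivialises_ex x f : O x -> cdom c f -> exists q, trivialises b c O sigma q x f.
Proof.
move=> Ox cf; have [w W] := section_frame_ex Ox.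
by have [q Eq] := Qlam_ex lam w f; exists q; split=> //; exists w.
Qed.

(** The trivialisation is a relation between points and coordinates, one-to-one by freeness of the
    action and injectivity of [b] and [c]. Choice turns both directions into functions, with default
    values 0 and q0. *)
Lemma Qlam_chart_ex (q0 : Qlam Q lam) :
  exists C : chart R (Qlam_space Q lam) (sdim M + sdim F),
    [/\ @charts R (Qlam_space Q lam) C,
        cdom C = [set q | exists x f, trivialises b c O sigma q x f] &
        forall q x f, trivialises b c O sigma q x f ->
          cmap C q = row_mx (cmap b x) (cmap c f) /\ cinv C (cmap C q) = q].
Proof.
pose P q (v : 'rV[R]_(sdim M + sdim F)) := exists x f,
  trivialises b c O sigma q x f /\ v = row_mx (cmap b x) (cmap c f).
have Ef q : exists v, forall v', P q v' -> P q v.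
  have [[v Pv]|nP] := pselect (exists v, P q v); first by exists v.
  by exists 0 => v' Pv'; case: nP; exists v'.
have Eg v : exists q, forall q', P q' v -> P q v.
  have [[q Pq]|nP] := pselect (exists q, P q v); first by exists q.
  by exists q0 => q' Pq'; case: nP; exists q'.
have [f Hf] := choice Ef; have [g Hg] := choice Eg.
exists (Chart [set q | exists x f, trivialises b c O sigma q x f] f g).
have K q x y : trivialises b c O sigma q x y ->
    f q = row_mx (cmap b x) (cmap c y) /\ g (f q) = q.
  move=> T; have PT : P q (row_mx (cmap b x) (cmap c y)) by exists x, y.
  have [x' [y' [T' Ev]]] := Hf q _ PT.
  have [ex ey] := trivialises_uniq T T'; subst x' y'; split=> //.
  rewrite Ev; have [x' [y' [T2 /eq_row_mx[e1 e2]]]] := Hg _ _ PT.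
  have ex : x = x'.
    have Ox : O x by case: T.
    have Ox' : O x' by case: T2.
    by rewrite -(atlas_cmapK hb (Ob Ox)) e1 (atlas_cmapK hb (Ob Ox')).
  have ey : y = y'.
    have cy : cdom c y by case: T.
    have cy' : cdom c y' by case: T2.
    by rewrite -(atlas_cmapK hc cy) e2 (atlas_cmapK hc cy').
  by subst x' y'; exact: trivialises_inj T2 T.
split=> //.
by exists b, c, O, sigma; split.
Qed.

End OneChart.

Lemma section_cover x : exists b U sigma,
  [/\ charts b, sopen U, U `<=` cdom b, section_on U sigma & U x].
Proof.
have [b [hb bx]] := atlas_cover x; have [sigma N] := local_section Q x.
have : near_pt x (fun y => cdom b y /\ (smooth_at sigma y /\ bproj Q (sigma y) = y)).
  by apply: filterS2 (near_chart_dom hb bx) N => y.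
move=> [U [oU Ux HU]]; exists b, U, sigma; split=> //.
  by move=> y /HU[].
by move=> y /HU[].
Qed.

(** The fibre coordinate is fixed before the chart of F, which is dictated only later by the
    smoothness of [lam] at this coordinate. *)
Lemma trivialises_cover q x b U sigma : in_fibre q x ->
  charts b -> sopen U -> U `<=` cdom b -> section_on U sigma -> U x ->
  exists f, forall c, charts c -> cdom c f -> trivialises b c U sigma q x f.
Proof.
move=> [w [f [e [s [E W Ex]]]]] hb oU Ub sec Ux.
have [w' W'] := section_frame_ex hb oU Ub sec Ux.
have [g A] := WQact_trans_ex W' W (etrans (chart_frame0 hb (Ub _ Ux)) (esym Ex)).
exists (lam g f) => c hc cf; split=> //; exists w'; split=> //.
by rewrite (lam_class_act hk hlam _ A).
Qed.

End AssociatedCharts.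

(** * Smoothness of the lift of a family of automorphisms *)

Section LiftedFamily.
Context {R : realType}.
Variables (M : manifold R) (H : lie_group R) (Q : principal_bundle M H).
Variables (k h : nat).
Hypothesis hk : (h <= k)%N.
Variables (F : manifold R) (lam : Wgroup (sdim M) H k h -> F -> F).
Hypothesis hlam : smooth_left_action lam.
Variables (T : charted R) (aT : atlas T).
Variables (phi : T -> M -> M) (Phi : T -> Q -> Q)
  (Psi : T -> Qlam Q lam -> Qlam Q lam).

Definition lift_at (p : T * M) : Prop :=
  [/\ @smooth_at R (prod_charted T M) M (fun p => phi p.1 p.2) p,
      (forall u, bproj Q u = p.2 ->
        @smooth_at R (prod_charted T Q) Q (fun z => Phi z.1 z.2) (p.1, u)),
      local_automorphism (phi p.1) (Phi p.1) p.2 &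
      forall q : Qlam Q lam, in_fibre q p.2 ->
        Qlam_lift (phi p.1) (Phi p.1) q (Psi p.1 q)].

Section OnePoint.
Variables (b b' : chart R M (sdim M)) (U U' : set M) (sigma sigma' : M -> Q).
Hypotheses (hb : charts b) (hb' : charts b') (oU : sopen U) (oU' : sopen U').
Hypotheses (Ub : U `<=` cdom b) (Ub' : U' `<=` cdom b').
Hypotheses (sec : section_on U sigma) (sec' : section_on U' sigma').
Variables (delta : T * M -> H) (t : T) (x : M).
Hypotheses (Ux : U x) (Ux' : U' (phi t x)) (lift_tx : lift_at (t, x)).
Hypothesis delta_tx : @near_pt R (prod_charted T M) (t, x)
  (fun p => bact Q (sigma' (phi p.1 p.2)) (delta p) = Phi p.1 (sigma p.2)).

(* With s and s' the sections of W^{k,h}Q given by (b, sigma) and (b', sigma'),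
   W^{k,h}Phi_t (s x) = s' (phi_t x) (.) g where g is the element of W^{k,h}_m H
   represented by [alpha_at] and [a_at]. *)
Definition alpha_at : euclid R (sdim M) -> euclid R (sdim M) :=
  fun y => cmap b' (phi t (chart_frame b x y)) - cmap b' (phi t x).

Definition a_at : euclid R (sdim M) -> H := fun y => delta (t, chart_frame b x y).

Lemma smooth_delta : @smooth_at R (prod_charted T M) H delta (t, x).
Proof.
have [s1 s2 _ _] := lift_tx.
have [ss Ex] := sec Ux; have [ss' _] := sec' Ux'.
have s3 : @smooth_at R (prod_charted T M) Q (fun p => sigma' (phi p.1 p.2)) (t, x).
  exact: (smooth_at_comp s1 ss').
have s4 : @smooth_at R (prod_charted T M) Q (fun p => sigma p.2) (t, x).
  exact: (@smooth_at_comp R (prod_charted T M) M Q _ _ _ snd sigma (t, x)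
    smooth_at_snd ss).
have s5 : @smooth_at R (prod_charted T M) Q (fun p => Phi p.1 (sigma p.2)) (t, x).
  exact: (@smooth_at_comp2 R (prod_charted T M) T Q Q _ _ _ _ (t, x) fst
    (fun p => sigma p.2) Phi (s2 _ Ex) smooth_at_fst s4).
exact: (smooth_division s3 s5 delta_tx).
Qed.

Lemma smooth_slice : @smooth_at R (euclid R (sdim M)) (prod_charted T M)
  (fun y => (t, chart_frame b x y)) origin.
Proof.
apply: smooth_at_pair; first exact: smooth_at_cst.
exact: (smooth_chart_frame hb (Ub Ux)).
Qed.

Lemma slice0 : (t, chart_frame b x origin) = (t, x).
Proof. by rewrite (chart_frame0 hb (Ub Ux)). Qed.

Lemma germ_at : germ_rep alpha_at a_at.
Proof.
have [_ _ [dphi _] _] := lift_tx.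
have E := chart_frame0 hb (Ub Ux).
have l := chart_frame_inverse hb' (Ub' Ux').
have s' := smooth_chart_frame hb' (Ub' Ux').
split.
- have d1 : local_diffeo_at (phi t \o chart_frame b x) origin.
    apply: local_diffeo_comp; last by rewrite E.
    split; first exact: (smooth_chart_frame hb (Ub Ux)).
    by eexists; exact: (chart_frame_inverse hb (Ub Ux)).
  apply: (@local_diffeo_comp R (euclid R (sdim M)) M (euclid R (sdim M)) _ _ _
    (phi t \o chart_frame b x) (fun z => cmap b' z - cmap b' (phi t x)) origin d1).
  rewrite /= E; have E' := chart_frame0 hb' (Ub' Ux').
  split; first by have := local_inverse_smooth l; rewrite E'.
  by exists (chart_frame b' (phi t x)); have := local_inverse_sym s' l; rewrite E'.
- by rewrite /alpha_at E subrr.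
- by apply: (smooth_at_comp smooth_slice); rewrite slice0; exact: smooth_delta.
Qed.

Lemma a_at0 : a_at origin = delta (t, x).
Proof. by rewrite /a_at slice0. Qed.

Lemma lift_trivialises g q f (c c' : chart R F (sdim F)) :
  Wrep g alpha_at a_at -> trivialises b c U sigma q x f -> cdom c' (lam g f) ->
  trivialises b' c' U' sigma' (Psi t q) (phi t x) (lam g f).
Proof.
move=> G Tq c'f; have fq := trivialises_fibre hb Ub Tq.
have [_ _ [[sphi _] _] HL] := lift_tx.
have [_ _ [w [W Eq]]] := Tq.
have [w' [L Eq']] := HL q fq w f Eq.
have [phiV [l W']] := L _ _ W.
have [ws Ws] := section_frame_ex k h hb' oU' Ub' sec' Ux'.
split=> //; exists ws; split=> //.
rewrite Eq'; apply: esym; apply: (lam_class_act hk hlam).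
have E := chart_frame0 hb (Ub Ux).
have s := smooth_chart_frame hb (Ub Ux).
(* Along phi_t composed with the frame at x, the two conditions are the definition of [alpha_at] and
   the equation satisfied by [delta]. *)
apply: (WQact_sections Ws W' G).
  have N : near_pt (phi t (chart_frame b x origin)) (cdom b').
    by rewrite E; exact: near_chart_dom (Ub' Ux').
  have s2 : smooth_at (phi t) (chart_frame b x origin) by rewrite E.
  note s3 := (smooth_at_comp s s2).
  apply: filterS (smooth_at_pre s3 N) => y b'y.
  by rewrite /alpha_at /chart_frame addrC subrK atlas_cmapK.
have N1 : @near_pt R (prod_charted T M) (t, chart_frame b x origin)
    (fun p => bact Q (sigma' (phi p.1 p.2)) (delta p) = Phi p.1 (sigma p.2)).
  by rewrite slice0.
have N2 : near_pt (chart_frame b x origin) (fun z => phiV (phi t z) = z) by case: l.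
apply: filterS2 (smooth_at_pre smooth_slice N1) (smooth_at_pre s N2) => y /= E1 E2.
by rewrite E2.
Qed.

End OnePoint.

(** The charts of Q_lambda over x0 and over phi t0 x0 are built from local sections. In these charts
    the lift is explicit, and near (t0, q0) it coincides with a composite [E] of smooth maps. *)
Lemma smooth_at_lift t0 x0 (q0 : Qlam Q lam) : in_fibre q0 x0 ->
  @near_pt R (prod_charted T M) (t0, x0) lift_at ->
  @smooth_at R (prod_charted T (Qlam_space Q lam)) (Qlam_space Q lam)
    (fun p => Psi p.1 p.2) (t0, q0).
Proof.
move=> fq0 NL; have L0 := near_pt_self NL.
have [b [U [sigma [hb oU Ub sec Ux0]]]] := section_cover Q x0.
have [b' [U' [sigma' [hb' oU' Ub' sec' Ux0']]]] := section_cover Q (phi t0 x0).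
have [f1 T1] := trivialises_cover hk hlam fq0 hb oU Ub sec Ux0.
have [eT [heT et0]] := atlas_cover t0.
have [sphi _ _ _] := L0.
have FF : ProperFilter (@near_pt R (prod_charted T M) (t0, x0)).
  exact: near_pt_filter.
have NU : @near_pt R (prod_charted T M) (t0, x0) (fun p => U p.2).
  have NU0 : near_pt x0 U by exists U.
  exact: (@smooth_at_pre R (prod_charted T M) M _ _ snd (t0, x0) _ smooth_at_snd NU0).
have NU' : @near_pt R (prod_charted T M) (t0, x0) (fun p => U' (phi p.1 p.2)).
  have NU0 : near_pt (phi t0 x0) U' by exists U'.
  exact: (smooth_at_pre sphi NU0).
have Nfib : @near_pt R (prod_charted T M) (t0, x0) (fun p =>
    bproj Q (sigma' (phi p.1 p.2)) = bproj Q (Phi p.1 (sigma p.2))).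
  apply: filterS3 NL NU NU' => -[t x] /= [_ _ [_ LA] _] Ux Ux'.
  have [_ ->] := sec' _ Ux'.
  by have [_ -> _] := near_pt_self LA _ (sec _ Ux).2.
have [delta Nd] := division_ex Nfib.
have [[g0 G0] [sl _ _]] : (exists g0, @Wrep R (sdim M) H k h g0 (alpha_at b b' t0 x0)
    (a_at b delta t0 x0)) /\ smooth_left_action lam.
  split=> //; apply: Wrep_ex.
  exact: (germ_at hb hb' Ub Ub' sec sec' Ux0 Ux0' L0 Nd).
(* Smoothness of [lam] at (g0, f1) supplies a chart of W^{k,h}_m H and charts of F at the source and
   at the target; the charts of Q_lambda are built on the latter two. *)
have [_ [c' [V [[[CW [cF [hCW hcF ->]]] [/= CWg0 cFf1]] hc' [oV Vx Vimg] Vd sV]]]] := sl (g0, f1).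
have [cH [hcH CWdom CWeq]] := hCW.
(* Membership in the chart of W^{k,h}_m H depends only on the value of the group part at the origin,
   shared by all representatives of g0. *)
have cHd0 : cdom cH (delta (t0, x0)).
  move: CWg0; rewrite CWdom => -[al [a [W cHa]]].
  have [_ [Ea _]] := Wrep_jets W G0.
  by rewrite -(a_at0 hb Ub delta t0 Ux0) -Ea.
have CWG g t x : U x -> cdom cH (delta (t, x)) ->
    Wrep g (alpha_at b b' t x) (a_at b delta t x) ->
    cmap CW g = row_mx (taylor 1 k (alpha_at b b' t x) origin)
      (taylor 0 h (cmap cH \o a_at b delta t x) origin) /\
    cinv CW (cmap CW g) = g.
  move=> Ux cd W; apply: CWeq => //.
  by rewrite (a_at0 hb Ub delta t Ux).
have T0 := T1 _ hcF cFf1.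
have [C [hC Cdom CE]] := Qlam_chart_ex hlam hb hcF oU Ub sec q0.
have [C' [hC' Cdom' CE']] := Qlam_chart_ex hlam hb' hc' oU' Ub' sec' q0.
pose p0 := row_mx (cmap eT t0) (cmap b x0).
pose tt (p : 'rV[R]_(sdim T + sdim M)) := cinv eT (lsubmx p).
pose xx (p : 'rV[R]_(sdim T + sdim M)) := cinv b (rsubmx p).
have hTb : @charts R (prod_charted T M) (prod_chart eT b) by exact: prod_chartP.
have dTb : @cdom R (prod_charted T M) _ (prod_chart eT b) (t0, x0).
  by split=> //; exact: Ub.
have NG : \forall p \near p0, [/\ lift_at (tt p, xx p), U (xx p),
    U' (phi (tt p) (xx p)), cdom cH (delta (tt p, xx p)) &
    @near_pt R (prod_charted T M) (tt p, xx p)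
      (fun p => bact Q (sigma' (phi p.1 p.2)) (delta p) = Phi p.1 (sigma p.2))].
  have NcH : @near_pt R (prod_charted T M) (t0, x0) (fun p => cdom cH (delta p)).
    have sd := smooth_delta sec sec' Ux0 Ux0' L0 Nd.
    exact: (smooth_at_pre sd (near_chart_dom hcH cHd0)).
  have Nd' := near_pt_join Nd.
  apply/(@near_ptP R (prod_charted T M) _ _ _ (fun p => [/\ lift_at p, U p.2,
    U' (phi p.1 p.2), cdom cH (delta p) & @near_pt R (prod_charted T M) p
      (fun p => bact Q (sigma' (phi p.1 p.2)) (delta p) = Phi p.1 (sigma p.2))]) hTb dTb).
  by apply: filterS2 (filterI NL NU) (filterI NU' (filterI NcH Nd')) => p [? ?] [? [? ?]].
have NTb : \forall p \near p0, [/\ cdom eT (tt p), cmap eT (tt p) = lsubmx p &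
    cmap b (xx p) = rsubmx p].
  note NT := (@chart_near R (prod_charted T M) _ _ _ hTb dTb).
  apply: filterS NT => p [[/= d1 d2]].
  by rewrite -{3}[p]hsubmxK => /eq_row_mx[].
pose Bh (p : 'rV[R]_(sdim T + sdim M)) := cmap b' (phi (tt p) (xx p)).
have sB : sm Bh p0.
  have b'x : cdom b' (phi (t0, x0).1 (t0, x0).2) by exact: Ub'.
  by have [_] := (@smooth_atP R (prod_charted T M) M _ _ _ _ _ _ hTb dTb hb' b'x).1 sphi.
pose Dh (p : 'rV[R]_(sdim T + sdim M)) := cmap cH (delta (tt p, xx p)).
have sD : sm Dh p0.
  have sd := smooth_delta sec sec' Ux0 Ux0' L0 Nd.
  by have [_] := (@smooth_atP R (prod_charted T M) H _ _ _ _ _ _ hTb dTb hcH cHd0).1 sd.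
(* A frame at x is a translation in [b], so with (t, x, y) |-> (t, x + y) the germs [alpha_at] and
   [a_at] at varying (t, x) become slices in y of the fixed smooth maps [Ga] and [Gb]. *)
pose shift (w : 'rV[R]_(sdim T + sdim M + sdim M)) : 'rV[R]_(sdim T + sdim M) :=
  row_mx (lsubmx (lsubmx w)) (rsubmx (lsubmx w) + rsubmx w).
have shiftE p y : shift (row_mx p y) = row_mx (lsubmx p) (rsubmx p + y).
  by rewrite /shift row_mxKl row_mxKr.
have shift0 : shift (row_mx p0 0) = p0.
  by rewrite shiftE addr0 hsubmxK.
have ssl (w : 'rV[R]_(sdim T + sdim M + sdim M)) : sm (fun w => lsubmx w) w.
  exact: sm_lsubmx.
have sshift w : sm shift w.
  apply: sm_row_mx; first exact: (sm_comp_at (ssl w) erefl (sm_lsubmx _)).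
  apply: smD; first exact: (sm_comp_at (ssl w) erefl (sm_rsubmx _)).
  exact: sm_rsubmx.
pose Ga w := Bh (shift w) - Bh (lsubmx w).
pose Gb w := Dh (shift w).
have sGa : sm Ga (row_mx p0 0).
  apply: smB; first exact: (sm_comp_at (sshift _) shift0 sB).
  by apply: (sm_comp_at (ssl _) _ sB); rewrite row_mxKl.
have sGb : sm Gb (row_mx p0 0) by exact: (sm_comp_at (sshift _) shift0 sD).
(* The coordinates of the group element g(t, x). *)
pose N p := row_mx (taylor 1 k (fun y => Ga (row_mx p y)) 0)
                   (taylor 0 h (fun y => Gb (row_mx p y)) 0).
have sN : sm N p0 by apply: sm_row_mx; exact: sm_taylor_family.
have GaE p : cmap b (xx p) = rsubmx p ->
    (fun y => Ga (row_mx p y)) = alpha_at b b' (tt p) (xx p).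
  move=> Ep; apply/funext => y.
  by rewrite /Ga shiftE row_mxKl /Bh /alpha_at /chart_frame Ep /tt /xx !row_mxKl !row_mxKr.
have GbE p : cmap b (xx p) = rsubmx p ->
    (fun y => Gb (row_mx p y)) = cmap cH \o a_at b delta (tt p) (xx p).
  move=> Ep; apply/funext => y.
  by rewrite /Gb shiftE /Dh /a_at /= /chart_frame Ep /tt /xx !row_mxKl !row_mxKr.
have NE p g : cmap b (xx p) = rsubmx p -> U (xx p) ->
    cdom cH (delta (tt p, xx p)) ->
    Wrep g (alpha_at b b' (tt p) (xx p)) (a_at b delta (tt p) (xx p)) ->
    cmap CW g = N p /\ cinv CW (N p) = g.
  move=> Ep Ux cd W; have [E1 E2] := CWG _ _ _ Ux cd W.
  by rewrite -GaE // -GbE // in E1; rewrite -[N p]E1.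
have tt0 : tt p0 = t0 by rewrite /tt row_mxKl atlas_cmapK.
have xx0 : xx p0 = x0 by rewrite /xx row_mxKr (atlas_cmapK hb (Ub _ Ux0)).
have N0 : N p0 = cmap CW g0.
  have [] := NE p0 g0; rewrite ?tt0 ?xx0 //.
  by rewrite row_mxKr.
(* The action [lam] read in the charts given by its smoothness. *)
pose L (z : 'rV[R]_(#|{: mindex (sdim M) 1 k}| * sdim M +
    #|{: mindex (sdim M) 0 h}| * sdim H + sdim F)) :=
  cmap c' (lam (cinv CW (lsubmx z)) (cinv cF (rsubmx z))).
have sL : sm L (row_mx (cmap CW g0) (cmap cF f1)) by apply/smP; exists V.
(* The product chart groups its coordinates as (t, (x, f)), whereas g depends on (t, x). *)
pose pp (v : 'rV[R]_(sdim T + (sdim M + sdim F))) :=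
  row_mx (lsubmx v) (lsubmx (rsubmx v)).
pose zz (v : 'rV[R]_(sdim T + (sdim M + sdim F))) := rsubmx (rsubmx v).
pose v0 := row_mx (cmap eT t0) (row_mx (cmap b x0) (cmap cF f1)).
have spp v : sm pp v.
  apply: sm_row_mx; first exact: sm_lsubmx.
  exact: (sm_comp_at (sm_rsubmx _) erefl (sm_lsubmx _)).
have szz v : sm zz v by exact: (sm_comp_at (sm_rsubmx _) erefl (sm_rsubmx _)).
have pp0 : pp v0 = p0 by rewrite /pp /v0 row_mxKl row_mxKr row_mxKl.
have zz0 : zz v0 = cmap cF f1 by rewrite /zz /v0 !row_mxKr.
pose Y v := row_mx (N (pp v)) (zz v).
have sY : sm Y v0.
  by apply: sm_row_mx; [exact: (sm_comp_at (spp _) pp0 sN)|exact: szz].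
have Y0 : Y v0 = row_mx (cmap CW g0) (cmap cF f1) by rewrite /Y pp0 N0 zz0.
(* The map (t, x, f) |-> (phi_t x, lam g(t, x) f) in coordinates. *)
pose E v := row_mx (Bh (pp v)) (L (Y v)).
have sE : sm E v0.
  by apply: sm_row_mx; [exact: (sm_comp_at (spp _) pp0 sB)|exact: (sm_comp_at sY Y0 sL)].
have NV : \forall v \near v0, V (Y v).
  have NV0 : \forall z \near Y v0, V z by rewrite Y0; exact: open_near Vx _.
  exact: (sm_near_pre sY NV0).
have NF : \forall v \near v0, cdom cF (cinv cF (zz v)) /\ cmap cF (cinv cF (zz v)) = zz v.
  note NF0 := (chart_near hcF cFf1); rewrite -zz0 in NF0.
  exact: (sm_near_pre (szz v0) NF0).
rewrite -pp0 in NG NTb.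
have NGv := sm_near_pre (spp v0) NG; have NTv := sm_near_pre (spp v0) NTb.
have key : \forall v \near v0, exists t x q f, [/\ cdom eT t, trivialises b cF U sigma q x f,
    row_mx (cmap eT t) (cmap C q) = v,
    (cinv eT (lsubmx v), cinv C (rsubmx v)) = (t, q) &
    cdom C' (Psi t q) /\ cmap C' (Psi t q) = E v].
  apply: filterS2 (filterI NGv NTv) (filterI NV NF).
  move=> v [[Lt Ux Ux' cd nd] [dT eTt bx]] [VY [cf Ef]].
  have [g W] := Wrep_ex k h (germ_at hb hb' Ub Ub' sec sec' Ux Ux' Lt nd).
  have [E1 E2] := NE (pp v) g bx Ux cd W.
  have [q Tq] := trivialises_ex lam hb oU Ub sec Ux cf.
  have lY : cinv CW (lsubmx (Y v)) = g by rewrite /Y row_mxKl.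
  have rY : rsubmx (Y v) = zz v by rewrite /Y row_mxKr.
  have cl : cdom c' (lam g (cinv cF (zz v))).
    by have := Vd _ VY; rewrite lY rY.
  have T' := lift_trivialises hb hb' oU' Ub Ub' sec' Ux Ux' Lt nd W Tq cl.
  have [C1 C2] := CE _ _ _ Tq; have [C3 C4] := CE' _ _ _ T'.
  have lpp : lsubmx (pp v) = lsubmx v by rewrite /pp row_mxKl.
  have rpp : rsubmx (pp v) = lsubmx (rsubmx v) by rewrite /pp row_mxKr.
  have Cq : cmap C q = rsubmx v by rewrite C1 bx rpp Ef /zz hsubmxK.
  exists (tt (pp v)), (xx (pp v)), q, (cinv cF (zz v)); split=> //.
  - by rewrite eTt lpp Cq hsubmxK.
  - by rewrite -Cq C2 -lpp.
  - split; first by rewrite Cdom'; exists (phi (tt (pp v)) (xx (pp v))), (lam g (cinv cF (zz v))).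
    by rewrite C3 /E /L lY rY.
pose F0 := cmap C' \o (fun p => Psi p.1 p.2) \o cinv (prod_chart eT C).
have sF : sm F0 v0.
  apply: sm_ext sE; apply: filterS key => v [t [x [q [f [_ _ _ [e1 e2] [_ <-]]]]]].
  by rewrite /F0 /= e1 e2.
have [U1 [oU1 U1v sU1]] := (smP _ _).1 sF.
have [U2 [oU2 U2v HU2]] := near_open key.
have Ev0 : cmap (prod_chart eT C) (t0, q0) = v0.
  by rewrite /= (CE _ _ _ T0).1.
exists (prod_chart eT C), C', (U1 `&` U2); split=> //.
- split; first by exists eT, C.
  by split=> //=; rewrite Cdom; exists x0, f1.
- rewrite Ev0; split=> //; first exact: openI.
  move=> v [_ /HU2[t [x [q [f [dt Tq e _ _]]]]]].
  exists (t, q) => //=; split=> //=.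
  by rewrite Cdom; exists x, f.
- move=> v [_ /HU2[t [x [q [f [_ _ _ [e1 e2] [dC _]]]]]]].
  by rewrite /= e1 e2.
- by move=> n; apply: Ck_sub (sU1 n) => v [].
Qed.

End LiftedFamily.

(** * Differentials and the Kosmann vector field *)

Section Differentials.
Context {R : realType}.

Definition chart_diff (X Y : charted R) (c : chart R X (sdim X))
    (d : chart R Y (sdim Y)) (f : X -> Y) (x : X) (v : 'rV[R]_(sdim X)) :
    'rV[R]_(sdim Y) :=
  'D_v (fun w => cmap d (f (cinv c w))) (cmap c x).

Lemma derive_chain (U V W : normedModType R) (f : U -> V) (g : V -> W) x v :
  differentiable f x -> differentiable g (f x) ->
  'D_v (fun y => g (f y)) x = 'D_('D_v f x) g (f x).
Proof.
move=> df dg; have dgf : differentiable (g \o f) x by exact: differentiable_comp.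
by rewrite -[fun y => g (f y)]/(g \o f) !deriveE// diff_comp.
Qed.

Lemma derive_row_mx (V : normedModType R) n p (f : V -> 'rV[R]_n) (g : V -> 'rV[R]_p)
    (a v : V) : sm f a -> sm g a ->
  'D_v (fun x => row_mx (f x) (g x)) a = row_mx ('D_v f a) ('D_v g a).
Proof.
move=> sf sg; apply/rowP => j.
rewrite (nbhs_singleton (near_derive_mx v 0 j (sm_row_mx sf sg))).
rewrite -(splitK j); case: (fintype.split j) => j' /=.
  rewrite row_mxEl (nbhs_singleton (near_derive_mx v 0 j' sf)).
  by congr ('D_v _ a); apply/funext => x; rewrite row_mxEl.
rewrite row_mxEr (nbhs_singleton (near_derive_mx v 0 j' sg)).
by congr ('D_v _ a); apply/funext => x; rewrite row_mxEr.
Qed.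

Lemma chart_diff_comp (X Y Z : charted R) {aX : atlas X} {aY : atlas Y}
    {aZ : atlas Z} c d e (f : X -> Y) (g : Y -> Z) x v :
  smooth_at f x -> smooth_at g (f x) ->
  charts c -> cdom c x -> charts d -> cdom d (f x) -> charts e -> cdom e (g (f x)) ->
  chart_diff c e (fun y => g (f y)) x v = chart_diff d e g (f x) (chart_diff c d f x v).
Proof.
move=> sf sg hc cx hd dx he ex.
have [N1 s1] := (smooth_atP hc cx hd dx).1 sf.
have [N2 s2] := (smooth_atP hd dx he ex).1 sg.
have E : {near cmap c x, (fun w => cmap e (g (cinv d (cmap d (f (cinv c w)))))) =1
    (fun w => cmap e (g (f (cinv c w))))}.
  by move: N1 => /(near_ptP hc cx); apply: filterS => w dw; rewrite (atlas_cmapK hd dw).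
rewrite /chart_diff -(near_eq_derive v E).
have Ef : cmap d (f (cinv c (cmap c x))) = cmap d (f x) by rewrite atlas_cmapK.
have d2 : differentiable (fun w => cmap e (g (cinv d w))) (cmap d (f (cinv c (cmap c x)))).
  by rewrite Ef; exact: sm_differentiable.
have d1 := sm_differentiable s1.
by rewrite (derive_chain v d1 d2) Ef.
Qed.

Lemma mdiffE (M N : manifold R) (f : M -> N) x v : smooth_at f x ->
  mdiff f x v = chart_diff (chart_at x) (chart_at (f x)) f x v.
Proof.
move=> sf; have [hc cx] := chart_atP (manifoldP M) x.
have [hd dx] := chart_atP (manifoldP N) (f x).
have [_ s] := (smooth_atP hc cx hd dx).1 sf.
by rewrite /chart_diff deriveE//; exact: sm_differentiable.
Qed.

Lemma mdiff_comp (M N K : manifold R) (f : M -> N) (g : N -> K) x v :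
  smooth_at f x -> smooth_at g (f x) ->
  mdiff (fun y => g (f y)) x v = mdiff g (f x) (mdiff f x v).
Proof.
move=> sf sg; have [hc cx] := chart_atP (manifoldP M) x.
have [hd dx] := chart_atP (manifoldP N) (f x).
have [he ex] := chart_atP (manifoldP K) (g (f x)).
rewrite (mdiffE _ sg) (mdiffE _ sf) mdiffE; last exact: (smooth_at_comp sf sg).
exact: (chart_diff_comp v sf sg hc cx hd dx he ex).
Qed.

Lemma mdiff_ext (M N : manifold R) (f g : M -> N) x v :
  near_pt x (fun y => f y = g y) -> smooth_at f x -> mdiff f x v = mdiff g x v.
Proof.
move=> fg sf; have sg : smooth_at g x by exact: smooth_at_ext fg sf.
have [hc cx] := chart_atP (manifoldP M) x.
rewrite (mdiffE _ sf) (mdiffE _ sg) -(near_pt_self fg); apply: near_eq_derive.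
by move: fg => /(near_ptP hc cx); apply: filterS => w ->.
Qed.

Lemma mdiff_id (M : manifold R) (x : M) v : mdiff id x v = v.
Proof.
have [hc cx] := chart_atP (manifoldP M) x.
rewrite mdiffE; last exact: smooth_at_id.
have E : {near cmap (chart_at x) x, (fun w => cmap (chart_at x) (cinv (chart_at x) w)) =1 id}.
  by note N := (chart_near hc cx); apply: filterS N => w [].
by rewrite /chart_diff (near_eq_derive v E) derive_id.
Qed.

Lemma mdiff_cst (M N : manifold R) (y : N) (x : M) v : mdiff (fun=> y) x v = 0.
Proof.
by rewrite mdiffE; [rewrite /chart_diff derive_cst|exact: smooth_at_cst].
Qed.

Lemma mdiff0 (M N : manifold R) (f : M -> N) x : mdiff f x 0 = 0.
Proof. by rewrite /mdiff linear0. Qed.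

Lemma mdiffB (M N : manifold R) (f : M -> N) x v w :
  mdiff f x (v - w) = mdiff f x v - mdiff f x w.
Proof. by rewrite /mdiff linearB. Qed.

Lemma smooth_line_differentiable (X : charted R) {aX : atlas X} (g : R -> X) t d :
  @smooth_at R (line R) X g t -> charts d -> cdom d (g t) ->
  differentiable (fun s => cmap d (g s)) t.
Proof.
move=> sg hd dx.
have [_ s] := (@smooth_atP R (line R) X _ _ _ _ line_chart _ erefl I hd dx).1 sg.
have -> : (fun s => cmap d (g s)) =
    (fun w : 'rV[R]_1 => cmap d (g (w 0 0))) \o (fun s => const_mx s).
  by apply/funext => r /=; rewrite mxE.
apply: differentiable_comp; last exact: sm_differentiable.
apply/differentiable_mxP => i j.
rewrite (_ : (fun y => _) = id); first exact: ex_diff.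
by apply/funext => y; rewrite mxE.
Qed.

Lemma derive1_chart_comp (X Y : charted R) {aX : atlas X} {aY : atlas Y}
    (g : R -> X) (f : X -> Y) t d e :
  @smooth_at R (line R) X g t -> smooth_at f (g t) ->
  charts d -> cdom d (g t) -> charts e -> cdom e (f (g t)) ->
  derive1 (fun s => cmap e (f (g s))) t =
  chart_diff d e f (g t) (derive1 (fun s => cmap d (g s)) t).
Proof.
move=> sg sf hd dx he ex.
have [N2 s2] := (smooth_atP hd dx he ex).1 sf.
note dg := (smooth_line_differentiable sg hd dx).
have E : {near t, (fun s => cmap e (f (cinv d (cmap d (g s))))) =1
    (fun s => cmap e (f (g s)))}.
  have Nd : @near_pt R (line R) t (fun s => cdom d (g s)).
    exact: (smooth_at_pre sg (near_chart_dom hd dx)).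
  by move: Nd => /near_pt_line; apply: filterS => s ds; rewrite (atlas_cmapK hd ds).
rewrite !derive1E -(near_eq_derive (1 : R) E).
have d2 : differentiable (fun w => cmap e (f (cinv d w))) (cmap d (g t)).
  exact: sm_differentiable.
exact: (derive_chain (1 : R) dg d2).
Qed.

Lemma velocity_comp (M N : manifold R) (g : R -> M) (f : M -> N) t :
  @smooth_at R (line R) M g t -> smooth_at f (g t) ->
  velocity (fun s => f (g s)) t = mdiff f (g t) (velocity g t).
Proof.
move=> sg sf; have [hd dx] := chart_atP (manifoldP M) (g t).
have [he ex] := chart_atP (manifoldP N) (f (g t)).
rewrite (mdiffE _ sf); exact: (derive1_chart_comp sg sf hd dx he ex).
Qed.

(** As df kills w, the pair (f, g) moves w to a vector (0, dg w), so only the derivative of [op] in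
    its second variable remains. *)
Lemma mdiff_pair_vertical (M N K L : manifold R) (f : M -> N) (g : M -> K)
    (op : N * K -> L) x w :
  @smooth_at R (prod_charted N K) L op (f x, g x) ->
  smooth_at f x -> smooth_at g x -> mdiff f x w = 0 ->
  mdiff (fun y => op (f y, g y)) x w = mdiff (fun b => op (f x, b)) (g x) (mdiff g x w).
Proof.
move=> so sf sg dw.
have [hc cx] := chart_atP (manifoldP M) x.
have [hd dx] := chart_atP (manifoldP N) (f x).
have [he ex] := chart_atP (manifoldP K) (g x).
have [hl lx] := chart_atP (manifoldP L) (op (f x, g x)).
set c := chart_at x in hc cx *; set d := chart_at (f x) in hd dx *.
set e := chart_at (g x) in he ex *; set l := chart_at (op (f x, g x)) in hl lx *.
have sp : @smooth_at R M (prod_charted N K) (fun y => (f y, g y)) x.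
  exact: smooth_at_pair.
have sop : smooth_at (fun y => op (f y, g y)) x by exact: (smooth_at_comp sp so).
have ssl : @smooth_at R K (prod_charted N K) (fun b => (f x, b)) (g x).
  by apply: smooth_at_pair; [exact: smooth_at_cst|exact: smooth_at_id].
have sb : smooth_at (fun b => op (f x, b)) (g x) by exact: (smooth_at_comp ssl so).
have hde := @prod_chartP R N K _ _ hd he.
have dex : @cdom R (prod_charted N K) _ (prod_chart d e) (f x, g x) by [].
have [N1 s1] := (smooth_atP hc cx hd dx).1 sf.
have [N2 s2] := (smooth_atP hc cx he ex).1 sg.
rewrite (mdiffE w sop) (mdiffE _ sb) (mdiffE w sg).
rewrite (@chart_diff_comp M (prod_charted N K) L _ _ _ c (prod_chart d e) l
  (fun y => (f y, g y)) op x w sp so hc cx hde dex hl lx).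
have -> : @chart_diff M (prod_charted N K) c (prod_chart d e) (fun y => (f y, g y)) x w =
    row_mx 0 (chart_diff c e g x w) :> 'rV[R]_(sdim N + sdim K).
  have df : chart_diff c d f x w = 0 by rewrite -mdiffE.
  rewrite -df; exact: derive_row_mx.
set xi := chart_diff c e g x w.
have := @dlist_slice R (sdim N) (sdim K) 1 (sdim L) [:: xi]
  (fun z => cmap l (op (cinv (prod_chart d e) z))) (cmap d (f x)) (cmap e (g x)).
rewrite /= /chart_diff => <-.
have Esl : (fun y : 'rV[R]_(sdim K) => cmap l
    (op (cinv d (lsubmx (row_mx (cmap d (f x)) y)),
         cinv e (rsubmx (row_mx (cmap d (f x)) y))))) =
    (fun y => cmap l (op (f x, cinv e y))).
  by apply/funext => y; rewrite row_mxKl row_mxKr atlas_cmapK.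
exact: (congr1 (fun F => 'D_xi F (cmap e (g x))) Esl).
Qed.

End Differentials.

(** * Equivariance of the Kosmann vector field *)

Section Kosmann.
Context {R : realType}.

(** The intermediate point is given up to an equation such as u.1 = u, and the composite up to
    pointwise equality. *)
Lemma mdiff_comp_at (M N K : manifold R) (f : M -> N) (g : N -> K)
    (l : M -> K) x y v :
  smooth_at f x -> smooth_at g y -> f x = y -> (forall z, g (f z) = l z) ->
  mdiff g y (mdiff f x v) = mdiff l x v.
Proof.
move=> sf sg E /funext El; subst y.
by rewrite -(mdiff_comp v sf sg) El.
Qed.

Section Vertical.
Variables (M : manifold R) (H : lie_group R) (Q : principal_bundle M H).
Implicit Types (u : Q) (a : H).

Lemma smooth_bactl u : @smooth R H Q (fun a => bact Q u a).
Proof.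
by move=> a; apply: smooth_at_bact; [exact: smooth_at_cst|exact: smooth_at_id].
Qed.

(** The orbit map a |-> u.a has the left inverse v |-> psi(u)^-1 psi(v), smooth at u. *)
Lemma mdiff_bactl_inj u v : mdiff (fun a => bact Q u a) (gone H) v = 0 -> v = 0.
Proof.
move=> E; have [psi N] := local_psi Q (bproj Q u).
have [sp Hp] := near_pt_self N u erefl.
pose l v := gmul (ginv (psi u)) (psi v).
have sl : smooth_at l (bact Q u (gone H)).
  rewrite bact1; apply: smooth_at_gmul => //; exact: smooth_at_cst.
have El a : l (bact Q u a) = id a by rewrite /l Hp gmulVK.
have := mdiff_comp_at v (@smooth_bactl u (gone H)) sl erefl El.
by rewrite E mdiff0 mdiff_id.
Qed.

Lemma mdiff_bact_bproj u v : mdiff (bproj Q) u (mdiff (fun a => bact Q u a) (gone H) v) = 0.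
Proof.
have s1 := @smooth_bactl u (gone H).
have s2 : smooth_at (bproj Q) u by exact: bproj_smooth.
rewrite (mdiff_comp_at (l := fun=> bproj Q u) v s1 s2 (bact1 u)) ?mdiff_cst//.
by move=> a; rewrite bproj_act.
Qed.

(** In a trivialisation a vertical vector moves only the group factor, and tau (x, b) = u.(psi(u)^-1
    b) exhibits this motion as one along the orbit of u. *)
Lemma vertical_bact u w : mdiff (bproj Q) u w = 0 ->
  exists v, w = mdiff (fun a => bact Q u a) (gone H) v.
Proof.
move=> dw.
have [U [tau [psi [[oU Ux] H1 H2 H3 H4]]]] := local_triviality Q (bproj Q u).
have [sp Eu] := H3 u Ux.
have [st _] := H1 _ (psi u) Ux.
have sb : smooth_at (bproj Q) u by exact: bproj_smooth.
have V := mdiff_pair_vertical (op := tau) st sb sp dw.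
have N : near_pt u (fun y => tau (bproj Q y, psi y) = y).
  have NU : near_pt (bproj Q u) U by exists U.
  by apply: filterS (smooth_at_pre sb NU) => y /H3[].
have s1 : smooth_at (fun y => tau (bproj Q y, psi y)) u.
  apply: smooth_at_ext (smooth_at_id (x := u)).
  by apply: filterS N => y.
rewrite (mdiff_ext w N s1) mdiff_id in V.
pose l a := gmul (ginv (psi u)) a.
exists (mdiff l (psi u) (mdiff psi u w)).
have sl : smooth_at l (psi u).
  by apply: smooth_at_gmul; [exact: smooth_at_cst|exact: smooth_at_id].
have El : l (psi u) = gone H by rewrite /l gmulV.
rewrite {1}V; apply: esym.
apply: (mdiff_comp_at _ sl (@smooth_bactl u (gone H)) El) => a.
by rewrite -{1}Eu -H2// /l gmulKV.
Qed.

End Vertical.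

Section Equivariance.
Variables (M : manifold R) (H G : lie_group R) (Q : principal_bundle M H)
  (P : principal_bundle M G) (S : reductive_structure Q P).
Variables (Xi : Q -> 'rV[R]_(sdim Q)) (hXi : invariant_vector_field Xi).
Implicit Types (u : P) (a : G).

Lemma jG1 : jG S (gone G) = gone H.
Proof.
apply: (@gmul_inj _ _ (jG S (gone G))); rewrite -jG_mul gmul1.
by rewrite gmulg1.
Qed.

Lemma jGV a : jG S (ginv a) = ginv (jG S a).
Proof. by apply: ginv_uniq; rewrite -jG_mul gmulgV jG1. Qed.

Lemma jP_smooth u : smooth_at (jP S) u.
Proof. by have [+ _] := jP_immersion S; exact. Qed.

Lemma jG_smooth a : smooth_at (jG S) a.
Proof. by have [+ _] := jG_immersion S; exact. Qed.

Lemma one_parameter0 mu (g : R -> H) : one_parameter_subgroup mu g -> g 0 = gone H.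
Proof.
move=> [_ gD _]; apply: (@gmul_inj _ _ (g 0)).
by rewrite -gD addr0 gmulg1.
Qed.

Lemma m_space_vertical (u : Q) v : m_space S u v ->
  exists2 mu, mu \in mfrak S & v = mdiff (fun a : H => bact Q u a) (gone H) mu.
Proof.
move=> [mu [g [m1 og ->]]]; exists mu => //.
have [sg gD vg] := og; have g0 := one_parameter0 og.
by rewrite (velocity_comp (sg 0) (@smooth_bactl _ _ Q u (g 0))) vg g0.
Qed.

Definition kosmann_set u : set 'rV[R]_(sdim P) :=
  [set v | m_space S (jP S u) (Xi (jP S u) - mdiff (jP S) u v)].

(** The difference w of two candidates is sent by jP to the fundamental vector of some nu in m. It
    is also vertical in P, hence the fundamental vector of some element of the Lie algebra of G.
    Orbit maps being immersive, nu lies in the intersection of this algebra with m, so nu = 0. *)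
Lemma kosmann_uniq u v v' : kosmann_set u v -> kosmann_set u v' -> v = v'.
Proof.
move=> /m_space_vertical[mu m1 E1] /m_space_vertical[mu' m2 E2].
apply/eqP; rewrite -subr_eq0; apply/eqP; set w := v - v'.
pose nu := mu' - mu.
have mnu : nu \in mfrak S by exact: rpredB.
have Ew : mdiff (jP S) u w = mdiff (fun a : H => bact Q (jP S u) a) (gone H) nu.
  by rewrite !mdiffB -E1 -E2 opprB [RHS]addrC subrKA.
have dw : mdiff (bproj P) u w = 0.
  have sb : smooth_at (bproj Q) (jP S u) by exact: bproj_smooth.
  have := mdiff_comp_at w (jP_smooth u) sb erefl (jP_proj S).
  by rewrite Ew mdiff_bact_bproj.
have [ga Eg] := vertical_bact dw.
have E3 : mdiff (jP S) u w =
    mdiff (fun a : H => bact Q (jP S u) a) (gone H) (mdiff (jG S) (gone G) ga).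
  rewrite Eg.
  rewrite (mdiff_comp_at ga (jG_smooth (gone G)) (@smooth_bactl _ _ Q (jP S u) _) jG1
    (fun a => esym (jP_act S u a))).
  exact: (mdiff_comp_at ga (@smooth_bactl _ _ P u (gone G)) (jP_smooth u) (bact1 u)).
have E4 : mdiff (jG S) (gone G) ga = nu.
  apply/eqP; rewrite -subr_eq0; apply/eqP/(@mdiff_bactl_inj _ _ Q (jP S u)).
  by rewrite mdiffB -E3 Ew subrr.
have nu0 : nu = 0.
  apply/eqP; rewrite -memv0 -(mfrak_cap S) memv_cap mnu andbT.
  by rewrite -E4; apply/memv_imgP; exists ga; rewrite ?memvf// lfunE.
have [_ inj] := jP_immersion S; apply: (inj u).
by rewrite Ew nu0 !mdiff0.
Qed.

(** Since u.exp(t mu).A = (u.A).(A^-1 exp(t mu) A), translation by A sends the m-part at u to the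
    m-part at u.A, generated by Ad(A^-1) mu, which stays in m. *)
Lemma kosmann_set_act u a v : kosmann_set u v ->
  kosmann_set (bact P u a) (mdiff (fun u' => bact P u' a) u v).
Proof.
move=> [mu [g [m1 og Ev]]]; have [sg gD vg] := og; have g0 := one_parameter0 og.
set A := jG S a.
pose g' t := gmul (gmul (ginv A) (g t)) (ginv (ginv A)).
pose c b := gmul (gmul (ginv A) b) (ginv (ginv A)).
have sc : @smooth R H H c.
  move=> b; apply: smooth_at_gmul; last exact: smooth_at_cst.
  by apply: smooth_at_gmul; [exact: smooth_at_cst|exact: smooth_at_id].
have sg' : @smooth R (line R) H g' by move=> t; exact: (smooth_at_comp (sg t) (sc _)).
exists (Ad (ginv A) mu), g'; split.
- by rewrite /A -jGV; exact: mfrak_Ad.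
- split=> //.
    move=> s t; rewrite /g' gD ginvK -!gmulA; congr gmul; congr gmul.
    by rewrite gmulKV.
  by rewrite (velocity_comp (sg 0) (sc _)) vg g0.
have Es : smooth_at (fun u' : Q => bact Q u' A) (jP S u) by exact: smooth_bactr.
have -> : Xi (jP S (bact P u a)) = mdiff (fun u' : Q => bact Q u' A) (jP S u) (Xi (jP S u)).
  by rewrite jP_act hXi.2.
have -> : mdiff (jP S) (bact P u a) (mdiff (fun u' => bact P u' a) u v) =
    mdiff (fun u' : Q => bact Q u' A) (jP S u) (mdiff (jP S) u v).
  have sa : smooth_at (fun u' => bact P u' a) u by exact: smooth_bactr.
  rewrite (mdiff_comp_at (l := fun y => jP S (bact P y a)) v sa (jP_smooth _))//.
  apply: esym; apply: (mdiff_comp_at v (jP_smooth u) Es) => // y.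
  by rewrite jP_act.
rewrite -mdiffB Ev.
have sl : @smooth_at R (line R) Q (fun t => bact Q (jP S u) (g t)) 0.
  exact: (smooth_at_comp (sg 0) (smooth_bactl _ _)).
have Es0 : smooth_at (fun u' : Q => bact Q u' A) (bact Q (jP S u) (g 0)) by exact: smooth_bactr.
have Et : (fun t => bact Q (jP S (bact P u a)) (g' t)) =
    (fun t => bact Q (bact Q (jP S u) (g t)) A).
  by apply/funext => t; rewrite jP_act -!bactM /g' ginvK !gmulA gmulgV gmul1.
rewrite Et (velocity_comp sl Es0).
by have -> : bact Q (jP S u) (g 0) = jP S u by rewrite g0 bact1.
Qed.

Lemma kosmann_act u a :
  kosmann S Xi (bact P u a) = mdiff (fun u' => bact P u' a) u (kosmann S Xi u).
Proof.
have [[v Kv]|nK] := pselect (exists v, kosmann_set u v).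
  have K1 : kosmann_set u (kosmann S Xi u) by exact: (xgetPex 0 (ex_intro _ v Kv)).
  have K2 := kosmann_set_act a K1.
  have K3 : kosmann_set (bact P u a) (kosmann S Xi (bact P u a)).
    exact: (xgetPex 0 (ex_intro _ _ K2)).
  exact: kosmann_uniq K3 K2.
(* Without a decomposition both sides are the default value 0. *)
have -> : kosmann S Xi u = 0.
  by apply: xgetPN => v Kv; apply: nK; exists v.
rewrite mdiff0; apply: xgetPN => v Kv; apply: nK.
have := kosmann_set_act (ginv a) Kv; rewrite bactK => K.
by eexists; exact: K.
Qed.

End Equivariance.
End Kosmann.

(** * Flows *)

Section ODE.
Context {R : realType}.

Lemma norm_coord m n (A : 'M[R]_(m, n)) i j : `|A i j| <= `|A|.
Proof. by rewrite [leRHS]/Num.Def.normr/= mx_normrE; exact: (le_bigmax _ _ (i, j)). Qed.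

Lemma norm_le_coord m n (A : 'M[R]_(m, n)) e : 0 <= e ->
  (forall i j, `|A i j| <= e) -> `|A| <= e.
Proof.
move=> e0 H; rewrite /Num.Def.normr/= mx_normrE; apply: bigmax_le => // -[i j].
Qed.

(** On a small ball the partial derivatives are bounded by their norm at the centre plus 1. The ball
    is convex, so the mean value theorem applies on segments, coordinate by coordinate. *)
Lemma local_lipschitz n p (f : 'rV[R]_n -> 'rV[R]_p) a : sm f a ->
  exists2 L : R, 0 <= L & exists2 e : R, 0 < e & forall y z,
    ball a e y -> ball a e z -> `|f y - f z| <= L * `|y - z|.
Proof.
move=> sf.
pose B (i : 'I_n) : R := `|'D_(delta_mx 0 i) f a| + 1.
have Ni (i : 'I_n) : \forall y \near a, `|'D_(delta_mx 0 i) f y| <= B i.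
  have := sm_continuous (sm_derive (delta_mx 0 i) sf).
  move=> /cvgrPdist_lt/(_ 1 ltr01); apply: filterS => y /ltW H.
  rewrite -[X in `|X|](subrK ('D_(delta_mx 0 i) f a)) addrC.
  by apply: le_trans (ler_normD _ _) _; rewrite lerD2l distrC.
have NB : \forall y \near a, sm f y /\ forall i : 'I_n, `|'D_(delta_mx 0 i) f y| <= B i.
  note NA := (filter_forall _ Ni).
  exact: (filterI (sm_near sf) NA).
exists (\sum_(i < n) B i); first by apply: sumr_ge0 => i _; rewrite addr_ge0.
move: NB => /nbhs_ballP[e /= e0 H]; exists e => // y z ay az.
apply: norm_le_coord => [|i j].
  by rewrite mulr_ge0// sumr_ge0// => k _; rewrite addr_ge0.
rewrite (ord1 i) !mxE; set v := y - z.
have conv t : 0 <= t <= 1 -> ball a e (z + t *: v).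
  move=> /andP[t0 t1]; rewrite -ball_normE /=.
  have -> : a - (z + t *: v) = (1 - t) *: (a - z) + t *: (a - y).
    by apply/rowP => l; rewrite !mxE; ring.
  apply: le_lt_trans (ler_normD _ _) _; rewrite !normrZ.
  rewrite (ger0_norm t0) ger0_norm ?subr_ge0//.
  move: ay az; rewrite -!ball_normE /= => ay az.
  have [->|tn0] := eqVneq t 0; first by rewrite subr0 mul1r mul0r addr0.
  have tp : 0 < t by rewrite lt0r tn0.
  have -> : e = (1 - t) * e + t * e by ring.
  by rewrite ler_ltD// ?ler_wpM2l ?subr_ge0// ?ltW// ltr_pM2l.
pose g x := f x 0 j.
have sg t : 0 <= t <= 1 -> sm g (z + t *: v).
  by move=> /conv/H[sfx _]; exact: (sm_mxP _ _).1 sfx 0 j.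
have [t /andP[t0 t1]] := MVT_line ltr01 (fun t ht => sm_differentiable (sg t ht)).
rewrite scale1r mul1r (_ : z + v = y); last by rewrite /v addrC subrK.
move=> E; rewrite [_ - _]E /g.
have t01 : 0 <= t <= 1 by rewrite !ltW.
have [sx Hx] := H _ (conv t t01).
rewrite -(nbhs_singleton (near_derive_mx v 0 j sx)).
apply: le_trans (norm_coord _ _ _) _.
rewrite (derive_basis v sx) mulr_suml.
apply: le_trans (ler_norm_sum _ _ _) _; apply: ler_sum => i' _.
rewrite normrZ mulrC; apply: ler_pM => //; exact: norm_coord.
Qed.

(** Let c maximise |z| on a closed interval of radius d around t0. The mean value theorem gives |z
    c| <= d K |z c| with d K <= 1 / 2, so that |z c| = 0. *)
Lemma zero_ode n (z : R -> 'rV[R]_n) (L t0 : R) : z t0 = 0 ->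
  (\forall t \near t0, differentiable z t /\ `|'D_1 z t| <= L * `|z t|) ->
  \forall t \near t0, z t = 0.
Proof.
move=> z0 /nbhs_ballP[e /= e0 H].
pose K := `|L| + 1; have K0 : 0 < K by rewrite ltr_wpDl.
(* The bound e / 2 keeps the closed interval inside the ball of radius e, and 1 / (2 K) yields the
   factor 1 / 2. *)
pose d := Num.min (e / 2) (1 / (2 * K)).
have d0 : 0 < d by rewrite lt_min !divr_gt0// mulr_gt0.
have de : d < e by rewrite gt_min ltr_pdivrMr// ltr_pMr// ltr1n.
have dK : d * K <= 1 / 2.
  have : d <= 1 / (2 * K) by rewrite ge_min lexx orbT.
  rewrite -(ler_pM2r K0) => /le_trans; apply.
  by rewrite invfM mulrA divfK// gt_eqF.
have Hd t : `|t - t0| <= d -> differentiable z t /\ `|'D_1 z t| <= K * `|z t|.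
  move=> td; have [|df le] := H t.
    by rewrite -ball_normE /= distrC; apply: le_lt_trans de.
  split=> //; apply: le_trans le _; apply: ler_wpM2r => //.
  by rewrite /K (le_trans (ler_norm L))// lerDl.
have t0d : t0 - d <= t0 + d by rewrite lerD2l (le_trans _ (ltW d0))// oppr_le0 ltW.
have cz : {within `[t0 - d, t0 + d], continuous (fun t => `|z t|)}.
  apply: continuous_in_subspaceT => t; rewrite inE /= in_itv /= -ler_distl => td.
  apply: (continuous_comp (f := z)); last exact: norm_continuous.
  by apply: differentiable_continuous; have [] := Hd t td.
have [c cin cmax] := EVT_max t0d cz.
move: cin; rewrite in_itv /= -ler_distl => cd.
have half : `|z c| <= 1 / 2 * `|z c|.
  apply: norm_le_coord => [|i j]; first by rewrite mulr_ge0// divr_ge0.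
  rewrite (ord1 i); pose g t := z t 0 j.
  have seg r : 0 <= r <= 1 -> `|t0 + r *: (c - t0) - t0| <= d.
    move=> /andP[r0 r1]; rewrite addrAC subrr add0r normrZ ger0_norm//.
    by apply: le_trans cd; rewrite ler_piMl.
  have dg r : 0 <= r <= 1 -> differentiable g (t0 + r *: (c - t0)).
    by move=> /seg/Hd[/differentiable_mxP + _]; apply.
  have [r /andP[r0 r1]] := MVT_line ltr01 dg.
  have r01 : 0 <= r <= 1 by rewrite !ltW.
  rewrite scale1r (_ : t0 + (c - t0) = c); last by rewrite addrC subrK.
  move=> E; rewrite mul1r /g z0 mxE subr0 in E; rewrite E.
  have [dz le] := Hd _ (seg r r01).
  set xi := t0 + r *: (c - t0) in dz le *.
  have E1 : 'D_1 g xi = ('D_1 z xi) 0 j.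
    by rewrite derive_mx ?mxE//; exact: diff_derivable.
  have Ev : c - t0 = (c - t0) *: (1 : R) by rewrite [RHS]mulr1.
  have -> : 'D_(c - t0) (fun t => z t 0 j) xi = (c - t0) * ('D_1 z xi) 0 j.
    by rewrite -E1 !deriveE; [rewrite {1}Ev linearZ|exact: dg..].
  rewrite normrM; apply: (@le_trans _ _ (d * (K * `|z c|))).
    apply: ler_pM => //; apply: le_trans (norm_coord _ _ _) _.
    apply: le_trans le _; rewrite ler_pM2l//; apply: cmax.
    by rewrite in_itv /= -ler_distl; exact: seg.
  by rewrite mulrA ler_wpM2r.
have zc0 : `|z c| = 0.
  apply/eqP; rewrite eq_le normr_ge0 andbT.
  by move: half; move: `|z c| => r half; lra.
apply/nbhs_ballP; exists d => // t; rewrite -ball_normE /= distrC => td.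
apply/eqP; rewrite -normr_le0 -zc0; apply: cmax.
by rewrite in_itv /= -ler_distl ltW.
Qed.

End ODE.

(** * Uniqueness of integral curves and consequences for flows *)

Section Flows.
Context {R : realType}.
Variables (N : manifold R) (X : N -> 'rV[R]_(sdim N)).

Lemma integral_curve_chart (J : set R) (g : R -> N) t (c : chart R N (sdim N)) :
  integral_curve X J g -> J t -> charts c -> cdom c (g t) ->
  'D_1 (fun s => cmap c (g s)) t = chart_diff (chart_at (g t)) c id (g t) (X (g t)).
Proof.
move=> ig Jt hc cg; have [sg vg] := ig t Jt.
have [hd dx] := chart_atP (manifoldP N) (g t).
note E := (derive1_chart_comp sg (smooth_at_id (x := g t)) hd dx hc cg).
by rewrite -vg -derive1E; exact: E.
Qed.

Lemma near_line_pre (g : R -> N) (t0 : R) (P : N -> Prop) :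
  @smooth_at R (line R) N g t0 -> near_pt (g t0) P -> \forall t \near t0, P (g t).
Proof. by move=> sg NP; apply/near_pt_line; exact: (smooth_at_pre sg NP). Qed.

Lemma smooth_line_add (s t : R) : @smooth_at R (line R) (line R) (fun r => r + s) t.
Proof.
apply/(@smooth_atP R (line R) (line R) _ _ _ _ line_chart line_chart) => //; split.
  exact: near_ptW.
apply/sm_mxP => i j; apply: sm_eq (smD (sm_coord _ 0 0) (sm_cst s _)) => v.
by rewrite /= mxE.
Qed.

Lemma integral_curve_shift (J : set R) (g : R -> N) (s : R) :
  integral_curve X J g -> integral_curve X [set t : R | J (t + s)] (fun t => g (t + s)).
Proof.
move=> ig t Jt; have [sg vg] := ig _ Jt; split.
  exact: (@smooth_at_comp R (line R) (line R) N _ _ _ (fun r => r + s) g t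
    (smooth_line_add s t) sg).
rewrite -vg /velocity /derive1; set F := (fun _ => _); set F' := (fun _ => _).
suff -> : F = F' by [].
by apply/funext => r; rewrite /F /F' /= addrA.
Qed.

Lemma integral_curve_sub (J J' : set R) (g : R -> N) :
  J `<=` J' -> integral_curve X J' g -> integral_curve X J g.
Proof. by move=> JJ ig t /JJ; exact: ig. Qed.

Lemma integral_curve_map (K : manifold R) (Y : K -> 'rV[R]_(sdim K))
    (psi : N -> K) (J : set R) (g : R -> N) :
  smooth psi -> (forall p, mdiff psi p (X p) = Y (psi p)) ->
  integral_curve X J g -> integral_curve Y J (fun t => psi (g t)).
Proof.
move=> sp XY ig t Jt; have [sg vg] := ig t Jt; split.
  exact: (smooth_at_comp sg (sp _)).
by rewrite (velocity_comp sg (sp _)) vg XY.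
Qed.

Variables (D : set (R * N)) (Phi : R -> N -> N).
Hypothesis hflow : is_flow X D Phi.

Lemma flow_curve u : integral_curve X [set t : R | D (t, u)] (fun t => Phi t u).
Proof. exact: (@flow_integral _ _ _ _ _ hflow u). Qed.

(* The generator of a smooth flow is smooth, being its derivative at time 0. *)
Lemma flow_generator_sm (u : N) (c : chart R N (sdim N)) : charts c -> cdom c u ->
  exists f : 'rV[R]_(sdim N) -> 'rV[R]_(sdim N), sm f (cmap c u) /\
    near_pt u (fun p => f (cmap c p) = chart_diff (chart_at p) c id p (X p)).
Proof.
move=> hc cu.
pose G (w : 'rV[R]_(1 + sdim N)) := cmap c (Phi ((lsubmx w) 0 0) (cinv c (rsubmx w))).
pose w0 : 'rV[R]_(1 + sdim N) := row_mx (const_mx 0) (cmap c u).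
have sG : sm G w0.
  have s := flow_smooth hflow (flow_dom0 hflow u).
  have hl : @charts R (prod_charted (line R) N) (prod_chart line_chart c).
    exact: (@prod_chartP R (line R) N).
  have d0 : @cdom R (prod_charted (line R) N) _ (prod_chart line_chart c) (0, u) by [].
  have cu' : cdom c (Phi (0 : R, u).1 (0 : R, u).2) by rewrite (flow0 hflow).
  by have [_] := (@smooth_atP R (prod_charted (line R) N) N _ _ _ _ _ _ hl d0 hc cu').1 s.
pose dir : 'rV[R]_(1 + sdim N) := row_mx (const_mx 1) 0.
pose ins (v : 'rV[R]_(sdim N)) : 'rV[R]_(1 + sdim N) := row_mx (const_mx 0) v.
have sins : sm ins (cmap c u) by apply: sm_row_mx; [exact: sm_cst|exact: sm_id].
exists (fun v => 'D_dir G (ins v)); split.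
  exact: (sm_comp_at sins erefl (sm_derive dir sG)).
have N1 : near_pt u (fun p => sm G (ins (cmap c p))).
  have NG := sm_near_pre sins (sm_near sG).
  apply/(near_ptP hc cu); note NC := (chart_near hc cu).
  by apply: filterS2 NG NC => v sv [_ ->].
apply: filterS2 N1 (near_chart_dom hc cu) => p sp cp.
have df : derivable G (ins (cmap c p) + 0 *: dir) dir.
  by rewrite scale0r addr0; exact/diff_derivable/sm_differentiable.
have := is_derive_line df; rewrite scale0r addr0 => -[_ <-].
have E : (fun s => G (ins (cmap c p) + s *: dir)) = (fun s => cmap c (Phi s p)).
  apply/funext => s; rewrite /ins /dir scale_row_mx add_row_mx scaler0 addr0.
  by rewrite /G row_mxKl row_mxKr atlas_cmapK// !mxE add0r mulr1.
rewrite E; have c0 : cdom c (Phi 0 p) by rewrite (flow0 hflow).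
rewrite (integral_curve_chart (@flow_curve p) (flow_dom0 hflow p) hc c0).
by rewrite (flow0 hflow).
Qed.

(** In a chart both curves solve x' = f x with f locally Lipschitz, so their difference satisfies
    the hypothesis of [zero_ode]. *)
Lemma integral_curve_near_uniq (J : set R) (g1 g2 : R -> N) t0 : open J ->
  integral_curve X J g1 -> integral_curve X J g2 -> J t0 -> g1 t0 = g2 t0 ->
  \forall t \near t0, g1 t = g2 t.
Proof.
move=> oJ i1 i2 Jt E0.
have [c [hc cu]] := atlas_cover (g1 t0).
have cu2 : cdom c (g2 t0) by rewrite -E0.
have [f [sf Nf]] := flow_generator_sm hc cu.
have [s1 _] := i1 t0 Jt; have [s2 _] := i2 t0 Jt.
note Nc := (near_chart_dom hc cu); have Nf2 := Nf; have Nc2 := Nc.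
rewrite E0 in Nf2 Nc2.
have NJ : \forall t \near t0, J t by exact: open_near Jt _.
have [L L0 [e e0 lip]] := local_lipschitz sf.
pose x t := cmap c (g1 t); pose y t := cmap c (g2 t).
have xb : \forall t \near t0, ball (cmap c (g1 t0)) e (x t).
  have cx : {for t0, continuous x}.
    exact/differentiable_continuous/(smooth_line_differentiable s1 hc cu).
  by apply: cx; exact: nbhsx_ballx.
have yb : \forall t \near t0, ball (cmap c (g1 t0)) e (y t).
  have cy : {for t0, continuous y}.
    exact/differentiable_continuous/(smooth_line_differentiable s2 hc cu2).
  by rewrite E0; apply: cy; exact: nbhsx_ballx.
have N1 : \forall t \near t0, [/\ cdom c (g1 t), differentiable x t & 'D_1 x t = f (x t)].
  apply: filterS3 NJ (near_line_pre s1 Nc) (near_line_pre s1 Nf) => t Jt' ct ft.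
  split=> //; first by have [st _] := i1 t Jt'; exact: (smooth_line_differentiable st hc ct).
  by rewrite (integral_curve_chart i1 Jt' hc ct) -ft.
have N2 : \forall t \near t0, [/\ cdom c (g2 t), differentiable y t & 'D_1 y t = f (y t)].
  apply: filterS3 NJ (near_line_pre s2 Nc2) (near_line_pre s2 Nf2) => t Jt' ct ft.
  split=> //; first by have [st _] := i2 t Jt'; exact: (smooth_line_differentiable st hc ct).
  by rewrite (integral_curve_chart i2 Jt' hc ct) -ft.
have z0 : \forall t \near t0, x t - y t = 0.
  apply: (@zero_ode _ _ (fun t => x t - y t) L); first by rewrite /x /y E0 subrr.
  apply: filterS2 (filterI xb yb) (filterI N1 N2) => t [bx by_] [[_ dx Ex] [_ dy Ey]].
  split; first exact: differentiableB.
  rewrite (deriveB (diff_derivable dx) (diff_derivable dy)) Ex Ey.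
  exact: lip.
apply: filterS3 z0 N1 N2 => t /eqP; rewrite subr_eq0 => /eqP E [c1 _ _] [c2 _ _].
by rewrite -(atlas_cmapK hc c1) -/(x t) E (atlas_cmapK hc c2).
Qed.

(** Inside the connected set J, the curves agree on a set that is open by local uniqueness and
    closed because N is Hausdorff. *)
Lemma integral_curve_uniq (J : set R) (g1 g2 : R -> N) t0 : open J -> is_interval J ->
  integral_curve X J g1 -> integral_curve X J g2 -> J t0 -> g1 t0 = g2 t0 ->
  forall t, J t -> g1 t = g2 t.
Proof.
move=> oJ /connected_intervalP cJ i1 i2 Jt E0.
pose B := [set t : R | J t /\ g1 t = g2 t].
suff BJ : B = J by move=> t; rewrite -BJ => -[].
apply: cJ; first by exists t0.
  exists B; last by apply/seteqP; split=> [t [Jt' e]|t [_ []]].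
  rewrite openE => t [Jt' e]; rewrite /interior.
  have NJ : \forall t \near t, J t by exact: open_near Jt' _.
  by apply: filterS2 NJ (integral_curve_near_uniq oJ i1 i2 Jt' e).
exists (closure B); first exact: closed_closure.
apply/seteqP; split=> [t [Jt' e]|t [Jt' clt]]; first by split=> //; exact: subset_closure.
split=> //; apply: contrapT => ne.
have [U [V [oU oV Ux Vx UV]]] := manifold_hausdorff (manifoldP N) ne.
have [s1 _] := i1 t Jt'; have [s2 _] := i2 t Jt'.
have NU : near_pt (g1 t) U by exists U.
have NV : near_pt (g2 t) V by exists V.
have NUV : nbhs t [set r : R | U (g1 r) /\ V (g2 r)].
  by apply: filterS2 (near_line_pre s1 NU) (near_line_pre s2 NV) => r.
have [r [[Jr er] [Ur Vr]]] := clt _ NUV.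
have : (U `&` V) (g2 r) by split=> //; rewrite -er.
by rewrite UV.
Qed.

Lemma flow_dom_open u : open [set t : R | D (t, u)].
Proof.
rewrite openE => t Dt; rewrite /interior.
have ND : @near_pt R (prod_charted (line R) N) (t, u) D.
  by exists D; split=> //; exact: (flow_open hflow).
have s : @smooth_at R (line R) (prod_charted (line R) N) (fun t => (t, u)) t.
  exact: (@smooth_at_pair R (line R) (line R) N _ _ _ id (fun=> u) t smooth_at_id smooth_at_cst).
apply/near_pt_line.
exact: (@smooth_at_pre R (line R) (prod_charted (line R) N) _ _ _ _ D s ND).
Qed.

Lemma is_interval_shift (J : set R) s : is_interval J -> is_interval [set t : R | J (t + s)].
Proof.
move=> iJ x y Jx Jy z /andP[xz zy].
by apply: (iJ _ _ Jx Jy); rewrite !lerD2r xz.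
Qed.

Lemma open_shift (J : set R) (s : R) : open J -> open [set t : R | J (t + s)].
Proof.
move=> oJ; apply: (open_comp (f := fun t => t + s)) oJ => t _.
by apply: cvgD; [exact: cvg_id|exact: cvg_cst].
Qed.

(** The curve r |-> Phi (r + t) u passes through Phi t u at time 0. Maximality of the flow covers
    its interval of definition, and uniqueness identifies it with the flow line of Phi t u. *)
Lemma flow_translate s t u : D (t, u) -> D (s + t, u) ->
  D (s, Phi t u) /\ Phi s (Phi t u) = Phi (s + t) u.
Proof.
move=> Dt Dst.
pose J := [set r : R | D (r + t, u)].
have oJ : open J by exact: (open_shift (s := t) (@flow_dom_open u)).
have iJ : is_interval J by exact: (is_interval_shift (s := t) (@flow_interval _ _ _ _ _ hflow u)).
have J0 : J 0 by rewrite /J /= add0r.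
have ig := integral_curve_shift (s := t) (@flow_curve u).
have E0 : Phi (0 + t) u = Phi t u by rewrite add0r.
have JD := flow_maximal hflow oJ iJ J0 E0 ig.
split; first exact: JD.
have ih := integral_curve_sub JD (@flow_curve (Phi t u)).
apply: (integral_curve_uniq oJ iJ ih ig J0 _ Dst).
by rewrite (flow0 hflow) add0r.
Qed.

Lemma flow_inverse t u : D (t, u) -> D (- t, Phi t u) /\ Phi (- t) (Phi t u) = u.
Proof.
move=> Dt; have D0 : D (- t + t, u) by rewrite addNr; exact: (flow_dom0 hflow).
have [D1 E] := flow_translate Dt D0; split=> //.
by rewrite E addNr (flow0 hflow).
Qed.

Lemma flow_compose s t u : D (t, u) -> D (s, Phi t u) ->
  D (s + t, u) /\ Phi (s + t) u = Phi s (Phi t u).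
Proof.
move=> Dt Ds; have [Dm Em] := flow_inverse Dt.
suff Dst : D (s + t, u) by have [_ ->] := flow_translate Dt Dst.
(* Going back from Phi t u by time -t turns this into the membership of (s + t, u). *)
have Ds' : D (s + t + - t, Phi t u) by rewrite addrK.
by have [+ _] := flow_translate Dm Ds'; rewrite Em.
Qed.

(** The image under psi of the flow line of u is an integral curve through psi u, to which
    maximality and uniqueness apply. *)
Lemma flow_equivariant (psi : N -> N) : smooth psi ->
  (forall p, mdiff psi p (X p) = X (psi p)) ->
  forall t u, D (t, u) -> D (t, psi u) /\ Phi t (psi u) = psi (Phi t u).
Proof.
move=> sp hp t u Dt.
pose J := [set r : R | D (r, u)].
have oJ : open J by exact: flow_dom_open.
have iJ : is_interval J by exact: (flow_interval hflow).
have J0 : J 0 by exact: (flow_dom0 hflow).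
have ig := integral_curve_map sp hp (@flow_curve u).
have E0 : psi (Phi 0 u) = psi u by rewrite (flow0 hflow).
have JD := flow_maximal hflow oJ iJ J0 E0 ig.
split; first exact: JD.
have ih := integral_curve_sub JD (@flow_curve (psi u)).
apply: (integral_curve_uniq oJ iJ ih ig J0 _ Dt).
by rewrite !(flow0 hflow).
Qed.

End Flows.

(** * The induced automorphisms *)

Section Assembly.
Context {R : realType}.

Lemma sopen_near (X : charted R) {aX : atlas X} (U : set X) :
  (forall x, U x -> near_pt x U) -> sopen U.
Proof.
move=> H c hc; rewrite openE => _ [x [Ux cx] <-]; rewrite /interior.
note N := ((near_ptP hc cx).1 (H x Ux)); note NC := (chart_near hc cx).
by apply: filterS2 N NC => v Uv [cv E]; exists (cinv c v).
Qed.

Lemma local_inverse_ext (X Y : charted R) {aX : atlas X} {aY : atlas Y}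
    (f f' : X -> Y) x g :
  near_pt x (fun y => f y = f' y) -> local_inverse f x g -> local_inverse f' x g.
Proof.
move=> ff' [sg gf fg]; have E := near_pt_self ff'.
split; first by rewrite -E.
  by apply: filterS2 ff' gf => y ->.
rewrite -E; have gfx : g (f x) = x by exact: near_pt_self gf.
have ff'' : near_pt (g (f x)) (fun y => f y = f' y) by rewrite gfx.
by apply: filterS2 fg (smooth_at_pre sg ff'') => y Ey <-.
Qed.

Variables (M : manifold R) (H G : lie_group R)
    (Q : principal_bundle M H) (P : principal_bundle M G)
    (S : reductive_structure Q P)
    (Xi : Q -> 'rV[R]_(sdim Q)) (hXi : invariant_vector_field Xi)
    (D : set (R * P)) (PhiK : R -> P -> P)
    (hflow : is_flow (kosmann S Xi) D PhiK).

Definition base_domain : set (R * M) :=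
  [set p | exists u, bproj P u = p.2 /\ D (p.1, u)].

Lemma flow_act t u a : D (t, u) ->
  D (t, bact P u a) /\ PhiK t (bact P u a) = bact P (PhiK t u) a.
Proof.
move=> Dt; apply: (flow_equivariant hflow (psi := fun u => bact P u a)) => //.
  exact: smooth_bactr.
by move=> p; rewrite kosmann_act.
Qed.

(** G is transitive on the fibres and preserves D, so a single point of the fibre decides for all of
    them. *)
Lemma base_domain_fibre t u : base_domain (t, bproj P u) -> D (t, u).
Proof.
move=> [u' /= [E Du']]; have [a <-] := bact_trans E.
by have [] := flow_act a Du'.
Qed.

Lemma base_domain_dom t u : D (t, u) -> base_domain (t, bproj P u).
Proof. by exists u. Qed.

Lemma jP_decomp (q : Q) (u : P) : bproj P u = bproj Q q ->
  exists a, bact Q (jP S u) a = q.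
Proof. by move=> E; apply: bact_trans; rewrite jP_proj. Qed.

Lemma base_flow_ex : exists phi : R -> M -> M,
  forall t u, D (t, u) -> bproj P (PhiK t u) = phi t (bproj P u).
Proof.
have C (p : R * M) : exists y, forall u, bproj P u = p.2 -> D (p.1, u) ->
    bproj P (PhiK p.1 u) = y.
  have [[u [E Du]]|nE] := pselect (base_domain p).
    exists (bproj P (PhiK p.1 u)) => u' E' Du'.
    have [a <-] : exists a, bact P u a = u' by apply: bact_trans; rewrite E.
    by have [_ ->] := flow_act a Du; rewrite bproj_act.
  by exists p.2 => u E Du; case: nE; exists u.
have [f Hf] := choice C; exists (fun t x => f (t, x)) => t u Du.
exact: (Hf (t, bproj P u)).
Qed.

(** If u.a = u'.a', then u' = u.b with b in G, and a = b a' by freeness; both decompositions give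
    the same image because PhiK commutes with b. *)
Lemma induced_flow_ex : exists PhiQ : R -> Q -> Q, forall t u a, D (t, u) ->
  PhiQ t (bact Q (jP S u) a) = bact Q (jP S (PhiK t u)) a.
Proof.
have C (p : R * Q) : exists y, forall u a, bact Q (jP S u) a = p.2 -> D (p.1, u) ->
    bact Q (jP S (PhiK p.1 u)) a = y.
  have [[u [a [E Du]]]|nE] := pselect (exists u a, bact Q (jP S u) a = p.2 /\ D (p.1, u)).
    exists (bact Q (jP S (PhiK p.1 u)) a) => u' a' E' Du'.
    have Ep : bproj P u = bproj P u'.
      have := congr1 (bproj Q) (etrans E (esym E')).
      by rewrite !bproj_act !jP_proj.
    have [b Eb] := bact_trans Ep.
    have [_ ->] : D (p.1, u') /\ PhiK p.1 u' = bact P (PhiK p.1 u) b.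
      by rewrite -Eb; exact: flow_act.
    rewrite jP_act -bactM; congr (bact Q _ _).
    apply: (@bact_free _ _ _ _ (jP S u)).
    by rewrite E -E' -Eb jP_act bactM.
  by exists p.2 => u a E Du; case: nE; exists u, a.
have [f Hf] := choice C; exists (fun t x => f (t, x)) => t u a Du.
exact/esym/(Hf (t, bact Q (jP S u) a)).
Qed.

Variables (phi : R -> M -> M) (PhiQ : R -> Q -> Q).
Hypothesis Hphi : forall t u, D (t, u) -> bproj P (PhiK t u) = phi t (bproj P u).
Hypothesis HPhi : forall t u a, D (t, u) ->
  PhiQ t (bact Q (jP S u) a) = bact Q (jP S (PhiK t u)) a.
Local Notation E := base_domain.

Lemma induced_act t q b : E (t, bproj Q q) -> PhiQ t (bact Q q b) = bact Q (PhiQ t q) b.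
Proof.
have [u Eu] := bproj_surj P (bproj Q q).
rewrite -Eu => /base_domain_fibre Du.
have [a <-] := jP_decomp Eu.
by rewrite -bactM !HPhi// bactM.
Qed.

Lemma induced_proj t q : E (t, bproj Q q) -> bproj Q (PhiQ t q) = phi t (bproj Q q).
Proof.
have [u Eu] := bproj_surj P (bproj Q q).
rewrite -Eu => /base_domain_fibre Du; have [a <-] := jP_decomp Eu.
by rewrite HPhi// bproj_act jP_proj -Hphi.
Qed.

Lemma base_domain0 x : E (0, x).
Proof.
have [u <-] := bproj_surj P x; apply: base_domain_dom.
exact: (flow_dom0 hflow).
Qed.

Lemma base_flow0 x : phi 0 x = x.
Proof.
have [u <-] := bproj_surj P x.
by rewrite -Hphi ?(flow0 hflow)//; exact: (flow_dom0 hflow).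
Qed.

Lemma induced_flow0 q : PhiQ 0 q = q.
Proof.
have [u Eu] := bproj_surj P (bproj Q q); have [a <-] := jP_decomp Eu.
by rewrite HPhi ?(flow0 hflow)//; exact: (flow_dom0 hflow).
Qed.

Lemma base_flow_inverse t x : E (t, x) -> E (- t, phi t x) /\ phi (- t) (phi t x) = x.
Proof.
have [u <-] := bproj_surj P x => /base_domain_fibre Du.
have [D1 E1] := flow_inverse hflow Du.
rewrite -Hphi//; split; first exact: base_domain_dom.
by rewrite -Hphi// E1.
Qed.

Lemma base_flow_add s t x : E (t, x) -> E (s, phi t x) ->
  E (s + t, x) /\ phi (s + t) x = phi s (phi t x).
Proof.
have [u <-] := bproj_surj P x => /base_domain_fibre Du.
rewrite -Hphi// => /base_domain_fibre Ds.
have [D1 E1] := flow_compose hflow Du Ds; split; first exact: base_domain_dom.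
by rewrite -!Hphi// E1.
Qed.

Lemma induced_flow_add s t q : E (t, bproj Q q) -> E (s, phi t (bproj Q q)) ->
  PhiQ (s + t) q = PhiQ s (PhiQ t q).
Proof.
have [u Eu] := bproj_surj P (bproj Q q).
rewrite -Eu => /base_domain_fibre Du.
rewrite -Hphi// => /base_domain_fibre Ds; have [a <-] := jP_decomp Eu.
have [D1 E1] := flow_compose hflow Du Ds.
by rewrite !HPhi// E1.
Qed.

(** For a local section s of P, E contains the preimage near (t, x) of the open set D under (t', y)
    |-> (t', s y). *)
Lemma base_domain_near t x : E (t, x) -> @near_pt R (prod_charted (line R) M) (t, x) E.
Proof.
move=> Etx; have [s Ns] := local_section P x.
have [ss sx] := near_pt_self Ns.
have Dt : D (t, s x) by apply: base_domain_fibre; rewrite sx.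
have ND : @near_pt R (prod_charted (line R) P) (t, s x) D.
  by exists D; split=> //; exact: (flow_open hflow).
have FF : ProperFilter (@near_pt R (prod_charted (line R) M) (t, x)).
  exact: near_pt_filter.
have s2 : @smooth_at R (prod_charted (line R) M) P (fun p => s p.2) (t, x).
  exact: (@smooth_at_comp R (prod_charted (line R) M) M P _ _ _ snd s (t, x)
    smooth_at_snd ss).
have s3 : @smooth_at R (prod_charted (line R) M) (prod_charted (line R) P)
    (fun p => (p.1, s p.2)) (t, x).
  exact: (@smooth_at_pair R (prod_charted (line R) M) (line R) P _ _ _ fst
    (fun p => s p.2) (t, x) smooth_at_fst s2).
note N1 := (@smooth_at_pre R (prod_charted (line R) M) (prod_charted (line R) P)
  _ _ _ _ D s3 ND).
note N2 := (@smooth_at_pre R (prod_charted (line R) M) M _ _ snd (t, x) _ smooth_at_snd Ns).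
apply: filterS2 N1 N2 => -[t' y] /= Dy [_ sy].
by exists (s y).
Qed.

Lemma base_domain_open : @sopen R (prod_charted (line R) M) E.
Proof. by apply: sopen_near => -[t x]; exact: base_domain_near. Qed.

Lemma smooth_section_flow t x s : E (t, x) -> smooth_at s x -> bproj P (s x) = x ->
  @smooth_at R (prod_charted (line R) M) P (fun p => PhiK p.1 (s p.2)) (t, x).
Proof.
move=> Etx ss sx.
have Dt : D (t, s x) by apply: base_domain_fibre; rewrite sx.
have s2 : @smooth_at R (prod_charted (line R) M) P (fun p => s p.2) (t, x).
  exact: (@smooth_at_comp R (prod_charted (line R) M) M P _ _ _ snd s (t, x)
    smooth_at_snd ss).
exact: (@smooth_at_comp2 R (prod_charted (line R) M) (line R) P P _ _ _ _ (t, x) fst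
    (fun p => s p.2) PhiK (flow_smooth hflow Dt) smooth_at_fst s2).
Qed.

Lemma base_flow_smooth t x : E (t, x) ->
  @smooth_at R (prod_charted (line R) M) M (fun p => phi p.1 p.2) (t, x).
Proof.
move=> Etx; have [s Ns] := local_section P x.
have [ss sx] := near_pt_self Ns.
have FF : ProperFilter (@near_pt R (prod_charted (line R) M) (t, x)).
  exact: near_pt_filter.
note N2 := (@smooth_at_pre R (prod_charted (line R) M) M _ _ snd (t, x) _ smooth_at_snd Ns).
apply: (smooth_at_ext _ (smooth_at_bproj (smooth_section_flow Etx ss sx))).
apply: filterS2 (base_domain_near Etx) N2 => -[t' y] /= Ey [_ sy].
by rewrite Hphi ?sy//; apply: base_domain_fibre; rewrite sy.
Qed.

(** Near q a point y over x is jP (s x).a(y), with a smooth by division, so its image at time t' is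
    jP (PhiK t' (s x)).a(y). *)
Lemma induced_flow_smooth t q : E (t, bproj Q q) ->
  @smooth_at R (prod_charted (line R) Q) Q (fun p => PhiQ p.1 p.2) (t, q).
Proof.
move=> Etx; have [s Ns] := local_section P (bproj Q q).
have [ss sx] := near_pt_self Ns.
have sb : smooth_at (bproj Q) q by exact: bproj_smooth.
note Nq := (smooth_at_pre sb Ns).
have Na : near_pt q (fun y => bproj Q (jP S (s (bproj Q y))) = bproj Q y).
  by apply: filterS Nq => y [_ sy]; rewrite jP_proj.
have [a Ha] := division_ex (f := fun y => jP S (s (bproj Q y))) (g := id) Na.
have ssb : smooth_at (fun y => s (bproj Q y)) q by exact: (smooth_at_comp sb ss).
have sj : smooth_at (fun y => jP S (s (bproj Q y))) q.
  exact: (smooth_at_comp ssb (jP_smooth S _)).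
have sa : smooth_at a q by exact: (smooth_division sj smooth_at_id Ha).
pose L := prod_charted (line R) Q.
have FF : ProperFilter (@near_pt R L (t, q)) by exact: near_pt_filter.
have sb2 : @smooth_at R L (prod_charted (line R) M) (fun p => (p.1, bproj Q p.2)) (t, q).
  apply: (@smooth_at_pair R L (line R) M _ _ _ fst (fun p => bproj Q p.2) (t, q)).
    exact: smooth_at_fst.
  exact: (@smooth_at_comp R L Q M _ _ _ snd (bproj Q) (t, q) smooth_at_snd sb).
have s1 : @smooth_at R L P (fun p => PhiK p.1 (s (bproj Q p.2))) (t, q).
  exact: (@smooth_at_comp R L (prod_charted (line R) M) P _ _ _ _ _ (t, q) sb2
    (smooth_section_flow Etx ss sx)).
have s2 : @smooth_at R L Q (fun p => jP S (PhiK p.1 (s (bproj Q p.2)))) (t, q).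
  exact: (smooth_at_comp s1 (jP_smooth S _)).
have s3 : @smooth_at R L H (fun p => a p.2) (t, q).
  exact: (@smooth_at_comp R L Q H _ _ _ snd a (t, q) smooth_at_snd sa).
note s4 := (smooth_at_bact s2 s3).
apply: (smooth_at_ext _ s4).
note N1 := (@smooth_at_pre R L (prod_charted (line R) M) _ _ _ _ E sb2 (base_domain_near Etx)).
note N2 := (@smooth_at_pre R L Q _ _ snd (t, q) _ smooth_at_snd Ha).
note N3 := (@smooth_at_pre R L Q _ _ snd (t, q) _ smooth_at_snd Nq).
apply: filterS3 N1 N2 N3 => -[t' y] /= Ey Ha' [_ sy].
rewrite -{3}Ha' HPhi//.
by apply: base_domain_fibre; rewrite sy.
Qed.

Lemma slice_near t x : E (t, x) -> near_pt x (fun y => E (t, y)).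
Proof.
move=> Etx.
have s : @smooth_at R M (prod_charted (line R) M) (fun y => (t, y)) x.
  by apply: smooth_at_pair; [exact: smooth_at_cst|exact: smooth_at_id].
exact: (@smooth_at_pre R M (prod_charted (line R) M) _ _ _ _ E s (base_domain_near Etx)).
Qed.

Lemma base_flow_smooth_slice t x : E (t, x) -> smooth_at (phi t) x.
Proof.
move=> Etx.
have s : @smooth_at R M (prod_charted (line R) M) (fun y => (t, y)) x.
  by apply: smooth_at_pair; [exact: smooth_at_cst|exact: smooth_at_id].
exact: (@smooth_at_comp R M (prod_charted (line R) M) M _ _ _ _
  (fun p => phi p.1 p.2) x s (base_flow_smooth Etx)).
Qed.

Lemma induced_flow_smooth_slice t q : E (t, bproj Q q) -> smooth_at (PhiQ t) q.
Proof.
move=> Etx.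
have s : @smooth_at R Q (prod_charted (line R) Q) (fun y => (t, y)) q.
  by apply: smooth_at_pair; [exact: smooth_at_cst|exact: smooth_at_id].
exact: (@smooth_at_comp R Q (prod_charted (line R) Q) Q _ _ _ _
  (fun p => PhiQ p.1 p.2) q s (induced_flow_smooth Etx)).
Qed.

Lemma base_flow_local_inverse t x : E (t, x) -> local_inverse (phi t) x (phi (- t)).
Proof.
move=> Etx; have [Em Ei] := base_flow_inverse Etx.
split; first exact: base_flow_smooth_slice.
  by apply: filterS (slice_near Etx) => y /base_flow_inverse[].
apply: filterS (slice_near Em) => y /base_flow_inverse[].
by rewrite opprK.
Qed.

Lemma base_flow_automorphism t x : E (t, x) -> local_automorphism (phi t) (PhiQ t) x.
Proof.
move=> Etx; split.
  split; first exact: base_flow_smooth_slice.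
  by exists (phi (- t)); exact: base_flow_local_inverse.
apply: filterS (slice_near Etx) => y Ey u Eu; rewrite -Eu in Ey *.
split; first exact: induced_flow_smooth_slice.
  exact: induced_proj.
by move=> a; exact: induced_act.
Qed.

End Assembly.

(** * Existence, uniqueness and composition of lifts to Q_lambda *)

Section QlamLifts.
Context {R : realType}.
Variables (M : manifold R) (H : lie_group R) (Q : principal_bundle M H).
Variables (k h : nat).
Hypothesis hk : (h <= k)%N.
Variables (F : manifold R) (lam : Wgroup (sdim M) H k h -> F -> F).
Hypothesis hlam : smooth_left_action lam.
Implicit Types (q : Qlam Q lam) (x : M) (phi : M -> M) (Phi : Q -> Q).

Lemma WQlift_uniq (w w' w'' : WQ Q k h) eps sigma phi Phi : WQrep w eps sigma ->
  local_automorphism phi Phi (eps origin) ->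
  WQlift phi Phi w w' -> WQlift phi Phi w w'' -> w' = w''.
Proof.
move=> W LA L1 L2; have [phiV [l V]] := L1 _ _ W; have [phiV' [l' V']] := L2 _ _ W.
exact: WQrep_inj (WQlift_rep W W LA l l' V) V'.
Qed.

Lemma in_fibre_ex q : exists x, in_fibre q x.
Proof.
have [w [f E]] := svalP q; have [eps [sigma W]] := WQrep_rep w.
by exists (eps origin), w, f, eps, sigma.
Qed.

(** [Qlam_lift] quantifies over all representatives of q. Any other one differs from (w, f) by a
    group element g, and the lift to W^{k,h}Q commutes with g. *)
Lemma Qlam_lift_ex q x phi Phi : in_fibre q x -> local_automorphism phi Phi x ->
  exists q', Qlam_lift phi Phi q q'.
Proof.
move=> [w [f [eps [sigma [E W <-]]]]] LA.
have [w' L] := WQlift_ex W LA; have [q' E'] := Qlam_ex lam w' f.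
exists q' => w2 f2 E2; have Ec := E; rewrite E2 in Ec.
have [g A Ef] := lam_class_eq hlam (esym Ec).
have [w2' [L2 A2]] := WQlift_act W LA L A.
exists w2'; split=> //.
by rewrite E' Ef (lam_class_act hk hlam _ A2).
Qed.

Lemma Qlam_lift_uniq q q' q'' x phi Phi : in_fibre q x -> local_automorphism phi Phi x ->
  Qlam_lift phi Phi q q' -> Qlam_lift phi Phi q q'' -> q' = q''.
Proof.
move=> [w [f [eps [sigma [E W <-]]]]] LA L1 L2.
have [w1 [l1 E1]] := L1 _ _ E; have [w2 [l2 E2]] := L2 _ _ E.
by apply: sig_inj; rewrite E1 E2 (WQlift_uniq W LA l1 l2).
Qed.

Lemma Qlam_lift_fibre q q' x phi Phi : in_fibre q x ->
  Qlam_lift phi Phi q q' -> in_fibre q' (phi x).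
Proof.
move=> [w [f [eps [sigma [E W <-]]]]] L.
have [w' [l E']] := L _ _ E; have [phiV [_ W']] := l _ _ W.
by exists w', f, (phi \o eps), (Phi \o sigma \o phiV).
Qed.

Lemma Qlam_lift_id q phi Phi : (forall x, phi x = x) -> (forall u, Phi u = u) ->
  Qlam_lift phi Phi q q.
Proof.
move=> /funext -> /funext -> w f E; exists w; split=> // eps sigma W.
exists id; split=> //; split; [exact: smooth_at_id|exact: near_ptW|exact: near_ptW].
Qed.

(** Agreement with the composites is asked only near x, which is what the group law of a local flow
    provides. *)
Lemma Qlam_lift_comp q q' q'' x phi1 Phi1 phi2 Phi2 phi3 Phi3 : in_fibre q x ->
  local_automorphism phi1 Phi1 x ->
  near_pt x (fun y => phi2 (phi1 y) = phi3 y) ->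
  near_pt x (fun y => forall u, bproj Q u = y -> Phi2 (Phi1 u) = Phi3 u) ->
  Qlam_lift phi1 Phi1 q q' -> Qlam_lift phi2 Phi2 q' q'' ->
  local_automorphism phi3 Phi3 x -> Qlam_lift phi3 Phi3 q q''.
Proof.
move=> fq LA N1 N2 L1 L2 LA3 w f E.
have [w' [l1 E1]] := L1 _ _ E; have [w'' [l2 E2]] := L2 _ _ E1.
exists w''; split=> // eps sigma W.
have Ex : eps origin = x.
  by apply: (in_fibre_uniq hlam _ fq); exists w, f, eps, sigma.
rewrite -Ex in N1 N2 LA LA3.
have [phiV [lV W1]] := l1 _ _ W; have [phiV2 [lV2 W2]] := l2 _ _ W1.
have [[s1 _] _] := LA.
note l21 := (local_inverse_comp s1 lV lV2).
have l3 : local_inverse phi3 (eps origin) (phiV \o phiV2).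
  exact: (local_inverse_ext N1 l21).
exists (phiV \o phiV2); split=> //.
have [[se _] ss sec] := W.1.
apply: (WQrep_near W2).
  by apply: filterS (smooth_at_pre se N1) => y /= ->.
rewrite /= (near_pt_self N1).
have N3 : near_pt (eps origin) (fun y => Phi2 (Phi1 (sigma y)) = Phi3 (sigma y)).
  by apply: filterS2 sec N2 => y Ey; exact.
have sV := local_inverse_smooth l3; have EV := local_inverse_at l3.
rewrite -EV in N3.
exact: (smooth_at_pre sV N3).
Qed.

End QlamLifts.

(** [smooth_at_comp] asks for atlases, and [Qlam_space] is handled without one; the slice is
    therefore taken inside the product chart at hand. *)
Lemma smooth_at_time_slice (R : realType) (X Y : charted R) (f : R -> X -> Y) t x :
  @smooth_at R (prod_charted (line R) X) Y (fun p => f p.1 p.2) (t, x) ->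
  smooth_at (f t) x.
Proof.
move=> [_ [d [U [[[_ [c [-> hc ->]]] /= [_ cx]] hd [oU Ux Uimg] Ud sU]]]].
pose ins (v : 'rV[R]_(sdim X)) : 'rV[R]_(1 + sdim X) := row_mx (const_mx t) v.
have sins v : sm ins v by apply: sm_row_mx; [exact: sm_cst|exact: sm_id].
exists c, d, (ins @^-1` U); split=> //.
- split=> //; first by apply: open_comp oU => v _; exact: sm_continuous.
  move=> v /Uimg[[t' y] [/= _ cy] /eq_row_mx[_ E]].
  by exists y.
- by move=> v /Ud; rewrite /= row_mxKl row_mxKr mxE.
- move=> n; apply: Ck_pointwise => v Uv.
  have sv : sm (cmap d \o f t \o cinv c) v.
    have sF : sm (cmap d \o (fun p => f p.1 p.2) \o
        (fun v : 'rV[R]_(1 + sdim X) => ((lsubmx v) 0 0, cinv c (rsubmx v)))) (ins v).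
      by apply/smP; exists U.
    apply: sm_eq (sm_comp_at (sins v) erefl sF) => y.
    by rewrite /= row_mxKl row_mxKr mxE.
  exact: (nbhs_singleton sv n).
Qed.

Theorem corollary5p15 (R : realType) (M : manifold R) (H G : lie_group R)
    (Q : principal_bundle M H) (P : principal_bundle M G)
    (S : reductive_structure Q P)
    (Xi : Q -> 'rV[R]_(sdim Q)) (hXi : invariant_vector_field Xi)
    (D : set (R * P)) (PhiK : R -> P -> P)
    (hflow : is_flow (kosmann S Xi) D PhiK)
    (k h : nat) (hk : (h <= k)%N) (F : manifold R)
    (lam : Wgroup (sdim M) H k h -> F -> F) (hlam : smooth_left_action lam) :
  let E : set (R * M) := [set p | exists u, bproj P u = p.2 /\ D (p.1, u)] in
  exists (phi : R -> M -> M) (PhiQ : R -> Q -> Q)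
         (Psi : R -> Qlam Q lam -> Qlam Q lam),
    [/\ forall t u, D (t, u) -> bproj P (PhiK t u) = phi t (bproj P u),
        forall t u a, D (t, u) ->
          PhiQ t (bact Q (jP S u) a) = bact Q (jP S (PhiK t u)) a,
        forall t q x, E (t, x) -> in_fibre q x ->
          Qlam_lift (phi t) (PhiQ t) q (Psi t q),
        local_one_parameter_group E phi Psi &
        D = setT ->
          (forall t, principal_automorphism (phi t) (PhiQ t)) /\
          one_parameter_group phi Psi].
Proof.
move=> E.
have [phi Hphi] := base_flow_ex hXi hflow.
have [PhiQ HPhi] := induced_flow_ex hXi hflow.
have aut t x : E (t, x) -> local_automorphism (phi t) (PhiQ t) x.
  exact: (base_flow_automorphism hXi hflow Hphi HPhi).
(* A point q lies over one x only, so a single choice serves every x; outside the domain the default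
   is q itself. *)
have lift_ex (p : R * Qlam Q lam) : exists q', forall x, E (p.1, x) ->
    in_fibre p.2 x -> Qlam_lift (phi p.1) (PhiQ p.1) p.2 q'.
  case: p => t q /=; have [x0 fx0] := in_fibre_ex q.
  have [Ex0|nE] := pselect (E (t, x0)).
    have [q' L] := Qlam_lift_ex hk hlam fx0 (aut _ _ Ex0).
    by exists q' => x _ _.
  by exists q => x Ex fx; case: nE; rewrite (in_fibre_uniq hlam fx0 fx).
have [Psi0 HPsi0] := choice lift_ex.
pose Psi t q := Psi0 (t, q).
have HPsi t q x : E (t, x) -> in_fibre q x -> Qlam_lift (phi t) (PhiQ t) q (Psi t q).
  exact: (HPsi0 (t, q)).
have E0 x : E (0, x) by exact: (base_domain0 hflow).
have Enear t x : E (t, x) -> @near_pt R (prod_charted (line R) M) (t, x) E.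
  exact: (base_domain_near hXi hflow).
have Psi_fibre t q x : E (t, x) -> in_fibre q x -> in_fibre (Psi t q) (phi t x).
  by move=> Ex fx; exact: Qlam_lift_fibre fx (HPsi _ _ _ Ex fx).
have Psi_smooth t q x : E (t, x) -> in_fibre q x ->
    @smooth_at R (prod_charted (line R) (Qlam_space Q lam)) (Qlam_space Q lam)
      (fun p => Psi p.1 p.2) (t, q).
  move=> Ex fx.
  note L := (@smooth_at_lift R M H Q k h hk F lam hlam (line R) _ phi PhiQ Psi t x q fx).
  apply: L.
  have FF : ProperFilter (@near_pt R (prod_charted (line R) M) (t, x)).
    exact: near_pt_filter.
  apply: filterS (Enear _ _ Ex) => -[s y] Ey; split=> /=.
  - exact: (base_flow_smooth hXi hflow Hphi).
  - by move=> u Eu; apply: (induced_flow_smooth hXi hflow HPhi); rewrite Eu.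
  - exact: aut.
  - by move=> q' fq'; exact: HPsi Ey fq'.
have Psi_id q : Psi 0 q = q.
  have [x fx] := in_fibre_ex q.
  apply: (Qlam_lift_uniq fx (aut _ _ (E0 x)) (HPsi _ _ _ (E0 x) fx)).
  apply: Qlam_lift_id; first exact: (base_flow0 hflow Hphi).
  exact: (induced_flow0 hflow HPhi).
have phi_add s t x : E (t, x) -> E (s, phi t x) ->
    E (s + t, x) /\ phi (s + t) x = phi s (phi t x).
  exact: (base_flow_add hXi hflow Hphi).
have Psi_add q s t x : in_fibre q x -> E (t, x) -> E (s, phi t x) ->
    Psi (s + t) q = Psi s (Psi t q).
  move=> fx Et Es; have [Est _] := phi_add _ _ _ Et Es.
  apply: (Qlam_lift_uniq fx (aut _ _ Est) (HPsi _ _ _ Est fx)).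
  (* By uniqueness of lifts, it remains to see that lifting by time t and then by time s is a lift
     for time s + t, which only involves the flow near x. *)
  have Nt := slice_near hXi hflow Et.
  have st := base_flow_smooth_slice hXi hflow Hphi Et.
  have Ns : near_pt x (fun y => E (s, phi t y)).
    exact: (smooth_at_pre st (slice_near hXi hflow Es)).
  apply: (Qlam_lift_comp hlam fx (aut _ _ Et) _ _ (HPsi _ _ _ Et fx)
    (HPsi _ _ _ Es (Psi_fibre _ _ _ Et fx)) (aut _ _ Est)).
    by apply: filterS2 Nt Ns => y Ey Esy; have [_ ->] := phi_add _ _ _ Ey Esy.
  apply: filterS2 Nt Ns => y Ey Esy u Eu; rewrite -Eu in Ey Esy.
  exact/esym/(induced_flow_add hXi hflow Hphi HPhi).
exists phi, PhiQ, Psi; split=> //.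
  split=> //.
  - split; first exact: (base_domain_open hXi hflow).
    exact: E0.
  - move=> t x Ex; split; first exact: (base_flow_smooth hXi hflow Hphi).
    by have [] := base_flow_inverse hXi hflow Hphi Ex.
  - by move=> q t x fx Ex; split; [exact: Psi_fibre|exact: Psi_smooth Ex fx].
  - move=> q s t x fx Et Es; split; first by have [] := phi_add _ _ _ Et Es.
    exact: Psi_add fx Et Es.
move=> DT.
(* With E everything, the local statements hold at every point, and the maps at time -t are global
   inverses. *)
have ET t x : E (t, x).
  by have [u <-] := bproj_surj P x; exists u; rewrite DT.
have phi_diffeo t : diffeo (phi t).
  split; first by move=> x; exact: (base_flow_smooth_slice hXi hflow Hphi (ET _ _)).
  exists (phi (- t)); split.
  - by move=> x; exact: (base_flow_smooth_slice hXi hflow Hphi (ET _ _)).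
  - by move=> x; have [] := base_flow_inverse hXi hflow Hphi (ET t x).
  - move=> x; have [_] := base_flow_inverse hXi hflow Hphi (ET (- t) x).
    by rewrite opprK.
have PhiQK s t q : s + t = 0 -> PhiQ s (PhiQ t q) = q.
  move=> st; rewrite -(induced_flow_add hXi hflow Hphi HPhi) ?st; try exact: ET.
  exact: (induced_flow0 hflow HPhi).
have PsiK s t q : s + t = 0 -> Psi s (Psi t q) = q.
  by move=> st; have [x fx] := in_fibre_ex q;
    rewrite -(Psi_add _ _ _ _ fx (ET _ _) (ET _ _)) st Psi_id.
have Psi_slice t : @smooth R (Qlam_space Q lam) (Qlam_space Q lam) (Psi t).
  move=> q; have [x fx] := in_fibre_ex q.
  exact: (smooth_at_time_slice (Psi_smooth _ _ _ (ET t x) fx)).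
split.
  move=> t; split=> //.
  - split; first by move=> q; exact: (induced_flow_smooth_slice hXi hflow HPhi (ET _ _)).
    exists (PhiQ (- t)); split.
    + by move=> q; exact: (induced_flow_smooth_slice hXi hflow HPhi (ET _ _)).
    + by move=> q; rewrite PhiQK// addNr.
    + by move=> q; rewrite PhiQK// addrN.
  - by move=> q; exact: (induced_proj hXi hflow Hphi HPhi (ET _ _)).
  - by move=> q a; exact: (induced_act hXi hflow HPhi _ (ET _ _)).
split=> //.
- move=> t; split=> //.
    split=> //; exists (Psi (- t)); split=> //.
      by move=> q; rewrite PsiK// addNr.
    by move=> q; rewrite PsiK// addrN.
  by move=> q x fx; exact: Psi_fibre.
- move=> s t q; have [x fx] := in_fibre_ex q.
  exact: Psi_add fx (ET _ _) (ET _ _).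
- by move=> [t q]; have [x fx] := in_fibre_ex q; exact: Psi_smooth (ET t x) fx.
Qed.
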